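(* Let $\mathcal{H}$ be a set of two connected graphs with $\mathcal{H}\in\{\{K_{1,3},Z_4\},\{K_{1,3},B_{1,2}\},\{K_{1,3},N_{1,1,1}\},\{P_4,W\},\{K_{1,3}^{**},Z_1\}\}$. Then every $2$-connected $\mathcal{H}$-free graph has a dominating cycle.
   Context: All graphs are finite and simple. A cycle $C$ in a graph $G$ is dominating if every edge of $G$ has at least one end vertex on $C$. $G$ is $\mathcal{H}$-free if it contains no member of $\mathcal{H}$ as an induced subgraph. $P_n$ is the path of order $n$, $K_{1,3}$ the claw. $Z_n$ is obtained from a triangle by attaching a path with $n$ new vertices at one triangle vertex. $B_{m,n}$ is obtained from a triangle $abc$ by attaching a path of $m$ new vertices at $a$ and a path of $n$ new vertices at $b$. $N_{l,m,n}$ is obtained from a triangle $abc$ by attaching paths of $l,m,n$ new vertices at $a,b,c$ respectively. $W=K_1+3K_2$ (one vertex joined to all vertices of three disjoint edges). $K_{1,3}^{*}$ is $K_{1,3}$ with each edge subdivided once, and $K_{1,3}^{**}$ is obtained from $K_{1,3}^{*}$ by deleting one vertex of degree $1$. *)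

(* Defs.v *)
From Stdlib Require List.
From mathcomp Require Import all_boot.

Set Implicit Arguments.
Unset Strict Implicit.
Unset Printing Implicit Defensive.

Record sgraph := SGraph {
  vertex :> finType;
  adj : rel vertex;
  adj_sym : symmetric adj;
  adj_irrefl : irreflexive adj }.
Arguments adj {s}.

Definition iso (G H : sgraph) : Prop :=
  exists2 f : G -> H, bijective f & forall x y, adj (f x) (f y) = adj x y.

(* The empty graph is not connected. *)
Definition connected (G : sgraph) : Prop :=
  0 < #|G| /\ forall x y : G, connect adj x y.

Section Induced.
Variables (G : sgraph) (S : {set G}).
Definition induced_adj : rel {x : G | x \in S} :=
  fun x y => adj (val x) (val y).
Lemma induced_sym : symmetric induced_adj.
Proof. by move=> x y; apply: adj_sym. Qed.
Lemma induced_irrefl : irreflexive induced_adj.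
Proof. by move=> x; apply: adj_irrefl. Qed.
Definition induced := SGraph induced_sym induced_irrefl.
End Induced.

Definition delete_vertex (G : sgraph) (v : G) : sgraph :=
  induced [set~ v].

Definition k_connected (k : nat) (G : sgraph) : Prop :=
  k < #|G| /\ forall X : {set G}, #|X| < k -> connected (induced (~: X)).

Definition contains_induced (G H : sgraph) : Prop :=
  exists S : {set G}, iso (induced S) H.

(* Families of graphs are lists, since [sgraph] has no decidable equality.
   Freeness depends only on the isomorphism classes of the members. *)
Definition free (F : seq sgraph) (G : sgraph) : Prop :=
  forall H, List.In H F -> ~ contains_induced G H.

(* A cycle is the cyclic sequence of its vertices. *)
Definition is_cycle (G : sgraph) (c : seq G) : Prop :=
  2 < size c /\ ucycle adj c.

Definition dominating (G : sgraph) (c : seq G) : Prop :=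
  forall x y : G, adj x y -> (x \in c) || (y \in c).

Definition has_dominating_cycle (G : sgraph) : Prop :=
  exists c : seq G, is_cycle c /\ dominating c.

Section Complete.
Variable n : nat.
Definition complete_adj : rel 'I_n := fun x y => x != y.
Lemma complete_sym : symmetric complete_adj.
Proof. by move=> x y; rewrite /complete_adj eq_sym. Qed.
Lemma complete_irrefl : irreflexive complete_adj.
Proof. by move=> x; rewrite /complete_adj eqxx. Qed.
Definition complete := SGraph complete_sym complete_irrefl.
End Complete.

Section CompleteBipartite.
Variables m n : nat.
Definition bipartite_adj : rel ('I_m + 'I_n)%type := fun x y =>
  match x, y with
  | inl _, inr _ | inr _, inl _ => true
  | _, _ => false
  end.
Lemma bipartite_sym : symmetric bipartite_adj.
Proof. by move=> [x|x] [y|y]. Qed.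
Lemma bipartite_irrefl : irreflexive bipartite_adj.
Proof. by move=> [x|x]. Qed.
Definition complete_bipartite := SGraph bipartite_sym bipartite_irrefl.
End CompleteBipartite.

Definition consecutive (i j : nat) : bool := (i.+1 == j) || (j.+1 == i).

Lemma consecutive_sym : symmetric consecutive.
Proof. by move=> i j; rewrite /consecutive orbC. Qed.
Lemma consecutive_irrefl : irreflexive consecutive.
Proof. by move=> i; rewrite /consecutive orbb; elim: i. Qed.

Section Path.
Variable n : nat.
Definition path_adj : rel 'I_n := fun i j => consecutive i j.
Lemma path_sym : symmetric path_adj.
Proof. by move=> i j; apply: consecutive_sym. Qed.
Lemma path_irrefl : irreflexive path_adj.
Proof. by move=> i; apply: consecutive_irrefl. Qed.
Definition path_graph := SGraph path_sym path_irrefl.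
End Path.

(* The join, written with [+] in the literature. *)
Section Join.
Variables G H : sgraph.
Definition join_adj : rel (G + H)%type := fun x y =>
  match x, y with
  | inl x, inl y => adj x y
  | inr x, inr y => adj x y
  | _, _ => true
  end.
Lemma join_sym : symmetric join_adj.
Proof. by move=> [x|x] [y|y] //=; apply: adj_sym. Qed.
Lemma join_irrefl : irreflexive join_adj.
Proof. by move=> [x|x] /=; apply: adj_irrefl. Qed.
Definition join := SGraph join_sym join_irrefl.
End Join.

(* n vertex-disjoint copies of G. *)
Section Copies.
Variables (n : nat) (G : sgraph).
Definition copies_adj : rel ('I_n * G)%type := fun x y =>
  (x.1 == y.1) && adj x.2 y.2.
Lemma copies_sym : symmetric copies_adj.
Proof. by move=> x y; rewrite /copies_adj eq_sym adj_sym. Qed.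
Lemma copies_irrefl : irreflexive copies_adj.
Proof. by move=> x; rewrite /copies_adj adj_irrefl andbF. Qed.
Definition copies := SGraph copies_sym copies_irrefl.
End Copies.

(* Every edge is subdivided once: the vertices are those of G and one new
   vertex for each edge, adjacent to the two ends of that edge. *)
Section Subdivision.
Variable G : sgraph.
Definition edges : {set {set G}} :=
  [set e | [exists x, exists y, adj x y && (e == [set x; y])]].
Definition subdivision_adj : rel (G + {e : {set G} | e \in edges})%type :=
  fun u v =>
  match u, v with
  | inl x, inr e | inr e, inl x => x \in val e
  | _, _ => false
  end.
Lemma subdivision_sym : symmetric subdivision_adj.
Proof. by move=> [x|e] [y|f]. Qed.
Lemma subdivision_irrefl : irreflexive subdivision_adj.
Proof. by move=> [x|e]. Qed.
Definition subdivision := SGraph subdivision_sym subdivision_irrefl.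
End Subdivision.

(* The vertex (i, k) is at distance k from the i-th triangle vertex (i, 0)
   along the path attached there; the path attached at the i-th triangle vertex
   has l, m, n new vertices for i = 0, 1, 2 respectively. *)
Section Net.
Variables l m n : nat.
Definition net_vertex : finType :=
  {i : 'I_3 & 'I_(tnth [tuple l; m; n] i).+1}.
Definition net_adj : rel net_vertex := fun u v =>
  let i : nat := tagged u in let j : nat := tagged v in
  if tag u == tag v then consecutive i j else (i == 0) && (j == 0).
Lemma net_sym : symmetric net_adj.
Proof.
by move=> u v; rewrite /net_adj eq_sym consecutive_sym andbC.
Qed.
Lemma net_irrefl : irreflexive net_adj.
Proof. by move=> u; rewrite /net_adj eqxx consecutive_irrefl. Qed.
Definition N_graph := SGraph net_sym net_irrefl.
End Net.

Definition B_graph (m n : nat) : sgraph := N_graph m n 0.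
Definition Z_graph (n : nat) : sgraph := N_graph n 0 0.

Definition W_graph : sgraph := join (complete 1) (copies 3 (complete 2)).

Definition claw : sgraph := complete_bipartite 1 3.
Definition claw_star : sgraph := subdivision claw.

(* The vertices of degree 1 of the subdivided claw are the leaves of the claw;
   they are equivalent under automorphisms, so any of them may be deleted. *)
Definition claw_star_leaf : claw_star := inl (inr ord0).
Definition claw_star_star : sgraph := delete_vertex claw_star_leaf.

(* Main.v *)
(* Let C be a longest cycle and suppose that G - C has a component D with an edge.
   As G is 2-connected, two disjoint edges join D to vertices u and v of C; let A
   and B be the two u-v paths of C. The nonadjacencies below hold because otherwise
   the cycle could be rerouted through D and become longer.

   For the claw with N(1,1,1) or B(1,2), grow initial parts of A and B, as long as
   the part of C covered so far has Hamiltonian paths from u to both of its ends.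
   The process gets stuck before reaching v, and then shortest paths from D, and
   from the two next vertices of A and B, meet in a triangle with three legs.

   For the claw with Z(4), and for P4 with W, choose u, v and C with B shortest. In
   the first case u and v have only one neighbour each in B, and Z(4) appears either
   near u, starting with D, or near v, starting inside B. In the second case u is
   adjacent to all of B, and W is centred at u.

   For the subdivided claw with the paw, G is triangle-free. Choose C with, in
   addition, as few edges off C as possible; then attachments of D that are
   consecutive on C have no common neighbour in D. The vertices reached from u along
   the two sides of C, before the next attachment, form levels such that exactly
   consecutive levels are joined, and completely so. Hence one side can be inserted
   into the other in pairs, losing at most one vertex while D contributes two. *)
Require Import Defs.
From Stdlib Require List Classical_Prop.
From mathcomp Require Import all_boot zify.

Set Implicit Arguments.
Unset Strict Implicit.
Unset Printing Implicit Defensive.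

(** * Recognising the forbidden graphs *)


(** All nonadjacencies follow one template, [noc]: a closed path [s] and a list [r] of missed
    vertices together account for the old cycle and a path [Q] through [D]; if [r] is shorter than
    [Q], the cycle was not longest. So a link with two vertices pays for one skipped cycle vertex,
    and the proof keeps such links whenever it changes [u], [v] or the cycle.

    For the subdivided claw this is the obstacle. Pairwise insertion can leave one vertex over,
    which a link with a single vertex would not repay. Hence a common neighbour [e] of consecutive
    attachments must be excluded, and length alone does not do it: exchanging a cycle vertex for [e]
    keeps the length, so the number of edges off the cycle has to decide.

    For the nets the obstacle is to keep the legs apart. Maximality of the frontier does this: no
    covered vertex sees both next vertices [xA] and [xB], and a covered neighbour of one of them can
    be cut out of a Hamiltonian path and used elsewhere.

    The symmetries [config_swap] and [config_flip] exchange the sides and the attachments, so each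
    fact is proved at one corner only. *)

Lemma contains_embedding (G H : sgraph) (f : H -> G) :
  injective f -> (forall x y, adj (f x) (f y) = adj x y) ->
  contains_induced G H.
Proof.
move=> f_inj f_adj; pose S := [set f x | x in [set: H]].
have fS x : f x \in S by apply: imset_f.
pose g (x : H) : induced S := Sub (f x) (fS x).
have g_inj : injective g by move=> x y /(congr1 val) /f_inj.
have g_surj (z : induced S) : exists x, g x == z.
  case: z => z zS; case/imsetP: (zS) => x _ zx.
  by exists x; apply/eqP/val_inj; rewrite /= zx.
pose h z := xchoose (g_surj z).
have hK : cancel h g by move=> z; apply/eqP/(xchooseP (g_surj z)).
have gK : cancel g h by move=> x; apply: g_inj; rewrite hK.
exists S; exists h; first by exists g.
by move=> x y; rewrite -f_adj -[in RHS](hK x) -[in RHS](hK y).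
Qed.

(** Hypotheses other than plain arithmetic on [nat] are discarded before [lia], whose preprocessing
    would otherwise work through the many boolean facts about paths and adjacency. *)
Ltac slia :=
  repeat match goal with H : ?T |- _ =>
    lazymatch T with
    | nat => fail
    | @eq nat _ _ => fail
    | is_true (leq _ _) => fail
    | is_true (~~ (leq _ _)) => fail
    | is_true (@eq_op _ ?x _) => lazymatch type of x with nat => fail | _ => clear H end
    | is_true (~~ (@eq_op _ ?x _)) => lazymatch type of x with nat => fail | _ => clear H end
    | is_true (@eq_op _ ?x _ || _) =>
        lazymatch type of x with nat => fail | _ => clear H end
    | _ => clear H
    end end; lia.

Section Embeddings.
Variable G : sgraph.
Implicit Types x y z a b c : G.

Lemma adjC x y : adj x y = adj y x.
Proof. exact: adj_sym. Qed.

(** Injectivity comes for free: equal images have equal adjacencies, and no two vertices of a net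
    have the same open neighbourhood. Testing against the triangle, the vertex itself and the
    predecessors on the legs suffices. So the lemmas for [Z], [B] and [N] need no distinctness
    hypotheses. *)
Lemma contains_net l m n (L : nat -> nat -> G) :
  (forall i p j q, i < 3 -> j < 3 ->
     p <= nth 0 [:: l; m; n] i -> q <= nth 0 [:: l; m; n] j ->
     adj (L i p) (L j q) =
       if i == j then consecutive p q else (p == 0) && (q == 0)) ->
  contains_induced G (N_graph l m n).
Proof.
move=> HL.
pose f (w : N_graph l m n) := L (tag w) (tagged w).
have bound (w : N_graph l m n) : nat_of_ord (tagged w) <= nth 0 [:: l; m; n] (tag w).
  by have := ltn_ord (tagged w); rewrite ltnS => /leq_trans; apply; rewrite (tnth_nth 0).
have f_adj s t : adj (f s) (f t) = adj s t.
  by rewrite /f HL ?ltn_ord ?bound.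
have inj i p j q : i < 3 -> j < 3 -> p <= nth 0 [:: l; m; n] i ->
    q <= nth 0 [:: l; m; n] j -> L i p = L j q -> i = j /\ p = q.
  move=> i3 j3 pl ql E.
  have K k r : k < 3 -> r <= nth 0 [:: l; m; n] k ->
     (if i == k then consecutive p r else (p == 0) && (r == 0)) =
     (if j == k then consecutive q r else (q == 0) && (r == 0)).
    by move=> k3 rl; rewrite -!HL // E.
  have Kp := K i p.-1 i3 (leq_trans (leq_pred p) pl).
  have Kq := K j q.-1 j3 (leq_trans (leq_pred q) ql).
  have := K 0 0 isT isT; have := K 1 0 isT isT; have := K 2 0 isT isT.
  have := K i p i3 pl; move: Kp Kq; rewrite !eqxx /consecutive.
  move: i3 j3 {pl ql K E}; case: i => [|[|[|//]]] _; case: j => [|[|[|//]]] _ /=;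
    move: p q => [|p] [|q]; rewrite /= ?orbF ?eqSS; lia.
apply: (@contains_embedding _ _ f) => // s t.
case/inj => //; case: s t => [i p] [j q] /= /val_inj ij.
by case: j / ij q => q /= /val_inj ->.
Qed.

Ltac adj_close := first
  [ done | exact: adj_irrefl | by rewrite adjC
  | by apply: negbTE | by rewrite adjC; apply: negbTE ].

Ltac net_embedding :=
  let i := fresh in let p := fresh in let j := fresh in let q := fresh in
  move=> i p j q;
  case: i => [|[|[|//]]] _; case: j => [|[|[|//]]] _ /=;
  (case: p => [|[|[|[|[|p]]]]] //= _; case: q => [|[|[|[|[|q]]]]] //= _; adj_close).

Lemma contains_Z4 a b c p1 p2 p3 p4 :
  adj a b -> adj a c -> adj b c ->
  adj c p1 -> adj p1 p2 -> adj p2 p3 -> adj p3 p4 ->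
  ~~ adj a p1 -> ~~ adj a p2 -> ~~ adj a p3 -> ~~ adj a p4 ->
  ~~ adj b p1 -> ~~ adj b p2 -> ~~ adj b p3 -> ~~ adj b p4 ->
  ~~ adj c p2 -> ~~ adj c p3 -> ~~ adj c p4 ->
  ~~ adj p1 p3 -> ~~ adj p1 p4 -> ~~ adj p2 p4 ->
  contains_induced G (Z_graph 4).
Proof.
move=> *; rewrite ?/Z_graph ?/B_graph; apply: (@contains_net 4 0 0 (fun i =>
  nth c (nth [::] [:: [:: c; p1; p2; p3; p4]; [:: a]; [:: b]] i))).
net_embedding.
Qed.

Lemma contains_B12 a b c p q1 q2 :
  adj a b -> adj a c -> adj b c -> adj a p -> adj b q1 -> adj q1 q2 ->
  ~~ adj a q1 -> ~~ adj a q2 -> ~~ adj b p -> ~~ adj b q2 ->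
  ~~ adj c p -> ~~ adj c q1 -> ~~ adj c q2 -> ~~ adj p q1 -> ~~ adj p q2 ->
  contains_induced G (B_graph 1 2).
Proof.
move=> *; rewrite ?/Z_graph ?/B_graph; apply: (@contains_net 1 2 0 (fun i =>
  nth c (nth [::] [:: [:: a; p]; [:: b; q1; q2]; [:: c]] i))).
net_embedding.
Qed.

Lemma contains_N111 a b c p q r :
  adj a b -> adj a c -> adj b c -> adj a p -> adj b q -> adj c r ->
  ~~ adj a q -> ~~ adj a r -> ~~ adj b p -> ~~ adj b r ->
  ~~ adj c p -> ~~ adj c q -> ~~ adj p q -> ~~ adj p r -> ~~ adj q r ->
  contains_induced G (N_graph 1 1 1).
Proof.
move=> *; rewrite ?/Z_graph ?/B_graph; apply: (@contains_net 1 1 1 (fun i =>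
  nth c (nth [::] [:: [:: a; p]; [:: b; q]; [:: c; r]] i))).
net_embedding.
Qed.

Lemma contains_Z1 a b c p :
  adj a b -> adj a c -> adj b c -> adj c p -> ~~ adj a p -> ~~ adj b p ->
  contains_induced G (Z_graph 1).
Proof.
move=> *; rewrite ?/Z_graph ?/B_graph; apply: (@contains_net 1 0 0 (fun i =>
  nth c (nth [::] [:: [:: c; p]; [:: a]; [:: b]] i))).
net_embedding.
Qed.

(** Unlike the vertices of a net, the leaves of a claw share their neighbourhood, so distinctness
    has to be assumed. *)
Lemma contains_claw c x y z :
  adj c x -> adj c y -> adj c z -> uniq [:: x; y; z] ->
  ~~ adj x y -> ~~ adj x z -> ~~ adj y z -> contains_induced G claw.
Proof.
move=> cx cy cz uxyz xy xz yz.
pose f (s : claw) := match s with inl _ => c | inr i => nth c [:: x; y; z] i end.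
have f_adj s t : adj (f s) (f t) = adj s t.
  case: s t => [s|[[|[|[|//]]] s]] [t|[[|[|[|//]]] t]] /=; adj_close.
apply: (contains_embedding (f := f)) => // s t st.
have := f_adj s t; rewrite st adj_irrefl.
case: s t st => [s|s] [t|t] //= st _; first by rewrite !ord1.
by congr inr; apply/val_inj/eqP; rewrite -(nth_uniq c _ _ uxyz) ?st ?ltn_ord.
Qed.

Lemma contains_P4 x y z t :
  adj x y -> adj y z -> adj z t -> ~~ adj x z -> ~~ adj x t -> ~~ adj y t ->
  contains_induced G (path_graph 4).
Proof.
move=> *; pose f (s : path_graph 4) := nth x [:: x; y; z; t] s.
have f_adj s r : adj (f s) (f r) = adj s r.
  case: s r => [[|[|[|[|//]]]] s] [[|[|[|[|//]]]] r]; adj_close.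
apply: (contains_embedding (f := f)) => // s r sr.
have E q : adj s q = adj r q by rewrite -!f_adj sr.
apply/val_inj; move: (E (inord 0)) (E (inord 1)) (E (inord 2)) (E (inord 3)).
rewrite /adj /= /path_adj !inordK //; clear sr E; case: s r.
by move=> [|[|[|[|//]]]] ? [[|[|[|[|//]]]] ?].
Qed.

Lemma contains_W c x1 y1 x2 y2 x3 y3 :
  adj c x1 -> adj c y1 -> adj c x2 -> adj c y2 -> adj c x3 -> adj c y3 ->
  adj x1 y1 -> adj x2 y2 -> adj x3 y3 ->
  ~~ adj x1 x2 -> ~~ adj x1 y2 -> ~~ adj y1 x2 -> ~~ adj y1 y2 ->
  ~~ adj x1 x3 -> ~~ adj x1 y3 -> ~~ adj y1 x3 -> ~~ adj y1 y3 ->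
  ~~ adj x2 x3 -> ~~ adj x2 y3 -> ~~ adj y2 x3 -> ~~ adj y2 y3 ->
  contains_induced G W_graph.
Proof.
move=> *; pose f (s : W_graph) := match s with
  | inl _ => c
  | inr (i, j) => nth c (nth [::] [:: [:: x1; y1]; [:: x2; y2]; [:: x3; y3]] i) j
  end.
have f_adj s r : adj (f s) (f r) = adj s r.
  case: s r => [[[|//] s]|[[[|[|[|//]]] i] [[|[|//]] j]]]
              [[[|//] r]|[[[|[|[|//]]] i'] [[|[|//]] j']]]; adj_close.
apply: (contains_embedding (f := f)) => // s r sr.
have E q : adj s q = adj r q by rewrite -!f_adj sr.
case: s r E {sr} => [s|[i j]] [r|[i' j']] E.
- by rewrite !ord1.
- by have := E (inr (i', j')); rewrite adj_irrefl.
- by have := E (inr (i, j)); rewrite adj_irrefl.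
have adjE (k k' : 'I_3) (l l' : 'I_2) : @adj W_graph (inr (k, l)) (inr (k', l')) =
  (k == k') && (l != l') by [].
have l_rev : j != rev_ord j by case: j {E} => [[|[|//]] ?].
have := E (inr (i, rev_ord j)); rewrite !adjE eqxx l_rev => /esym/andP[/eqP ii _].
have := E (inr (i, j)); rewrite !adjE ii eqxx /= => /esym.
by rewrite eqxx /= => /negbFE/eqP ->.
Qed.

Definition claw_edge (i : 'I_3) : {set claw} := [set inl ord0; inr i].

Lemma claw_edge_in i : claw_edge i \in edges claw.
Proof.
by rewrite inE; apply/existsP; exists (inl ord0); apply/existsP; exists (inr i) => /=.
Qed.

Definition claw_mid (i : 'I_3) : claw_star :=
  inr (exist (fun e => e \in edges claw) (claw_edge i) (claw_edge_in i)).

Variant claw_star_spec : claw_star -> Type :=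
  | ClawStarCentre : claw_star_spec (inl (inl ord0))
  | ClawStarLeaf i : claw_star_spec (inl (inr i))
  | ClawStarMid i : claw_star_spec (claw_mid i).

Lemma claw_starP s : claw_star_spec s.
Proof.
case: s => [[i|i]|[e ee]]; [by rewrite ord1; constructor|by constructor|].
have [i ei] : {i | e == claw_edge i}.
  apply: sigW; move: ee; rewrite inE => /existsP[s /existsP[t /andP[st /eqP ->]]].
  case: s t st => [s|s] [t|t] // _; first by exists t; rewrite ord1.
  by exists s; rewrite setUC ord1.
suff -> : inr (exist _ e ee) = claw_mid i by constructor.
by congr inr; apply: val_inj; apply/eqP.
Qed.

Lemma claw_star_centre_mid i : @adj claw_star (inl (inl ord0)) (claw_mid i).
Proof. by rewrite /adj /= !inE. Qed.

Lemma claw_star_leaf_mid i j : @adj claw_star (inl (inr i)) (claw_mid j) = (i == j).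
Proof. by rewrite /adj /= !inE. Qed.

Lemma contains_claw_star_star c p q q' r r' :
  adj c p -> adj c q -> adj c r -> adj q q' -> adj r r' ->
  ~~ adj c q' -> ~~ adj c r' -> ~~ adj p q -> ~~ adj p r -> ~~ adj p q' ->
  ~~ adj p r' -> ~~ adj q r -> ~~ adj q r' -> ~~ adj q' r -> ~~ adj q' r' ->
  contains_induced G claw_star_star.
Proof.
move=> cp cq cr qq rr *.
pose g (s : claw_star) : G := match s with
  | inl (inl _) => c
  (* Leaf 0 is the deleted vertex; its image [c] is a dummy. *)
  | inl (inr i) => nth c [:: c; q'; r'] i
  | inr e => if [pick i : 'I_3 | (inr i : claw) \in val e] is Some i
             then nth c [:: p; q; r] i else c
  end.
have gE i : g (claw_mid i) = nth c [:: p; q; r] i.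
  rewrite /g /=; case: pickP => [j|/(_ i)]; last by rewrite !inE eqxx.
  by rewrite !inE /= => /eqP[->].
have g_adj s t : s != claw_star_leaf -> t != claw_star_leaf -> adj (g s) (g t) = adj s t.
  have c0 i : adj (g (inl (inl ord0))) (g (claw_mid i)).
    by rewrite gE; case: i => [[|[|[|//]]] ?].
  have l0 i j : inl (inr i) != claw_star_leaf ->
      adj (g (inl (inr i))) (g (claw_mid j)) = (i == j).
    rewrite gE; case: i j => [[|[|[|//]]] ?] [[|[|[|//]]] ?] //= _; adj_close.
  case/claw_starP: s => [|i|i] sl; case/claw_starP: t => [|j|j] tl.
  - by rewrite !adj_irrefl.
  - case: j tl => [[|[|[|//]]] ?] //= _; adj_close.
  - by rewrite c0 claw_star_centre_mid.
  - case: i sl => [[|[|[|//]]] ?] //= _; adj_close.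
  - case: i j sl tl => [[|[|[|//]]] ?] [[|[|[|//]]] ?] //= _ _; adj_close.
  - by rewrite l0 // claw_star_leaf_mid.
  - by rewrite adjC c0 [RHS]adj_sym claw_star_centre_mid.
  - by rewrite adjC l0 // [RHS]adj_sym claw_star_leaf_mid.
  - rewrite !gE; case: i j {sl tl} => [[|[|[|//]]] ?] [[|[|[|//]]] ?] //=; adj_close.
have in_sub (s : claw_star_star) : val s != claw_star_leaf.
  by have := valP s; rewrite !inE.
apply: (contains_embedding (f := fun s : claw_star_star => g (val s))) => [s t st|s t].
  have E w : w != claw_star_leaf -> adj (val s) w = adj (val t) w.
    by move=> wl; rewrite -!g_adj // st.
  apply: val_inj; move: (in_sub s) (in_sub t) E {st}.
  have m0 i : claw_mid i != claw_star_leaf by [].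
  have neq i : exists j : 'I_3, j != i.
    by case: i => [[|[|[|//]]] ?]; [exists (inord 1)|exists ord0|exists ord0];
      rewrite -val_eqE /= ?inordK.
  case/claw_starP: (val s) => [|i|i] sl; case/claw_starP: (val t) => [|j|j] tl E //.
  - have [k kj] := neq j; have := E _ (m0 k).
    by rewrite claw_star_centre_mid claw_star_leaf_mid eq_sym (negbTE kj).
  - have := E _ (m0 j); rewrite claw_star_centre_mid; by rewrite adj_irrefl.
  - have [k kj] := neq i; have := E _ (m0 k).
    by rewrite claw_star_centre_mid claw_star_leaf_mid eq_sym (negbTE kj).
  - by have := E _ (m0 i); rewrite !claw_star_leaf_mid eqxx => /esym/eqP ->.
  - by have := E (inl (inl ord0)) isT; rewrite [RHS]adj_sym claw_star_centre_mid.
  - have := E _ (m0 i); rewrite claw_star_centre_mid; by rewrite adj_irrefl.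
  - by have := E (inl (inl ord0)) isT; rewrite adj_sym claw_star_centre_mid.
  - have [->//|ij] := eqVneq i j.
    have [i0|i0] := eqVneq i ord0.
      have j0 : inl (inr j) != claw_star_leaf by apply: contra ij => /eqP[->]; rewrite i0.
      have := E _ j0; rewrite ![adj (claw_mid _) _]adj_sym !claw_star_leaf_mid eqxx.
      by rewrite eq_sym (negbTE ij).
    have i1 : inl (inr i) != claw_star_leaf by apply: contra i0 => /eqP[->].
    have := E _ i1; rewrite ![adj (claw_mid _) _]adj_sym !claw_star_leaf_mid eqxx.
    by rewrite (negbTE ij).
by rewrite g_adj.
Qed.
End Embeddings.

(** * Paths and cycles around a component *)

Section Paths.
Variable G : sgraph.
Implicit Types (x y z u v a b d t : G) (s A B P Q : seq G) (D : {set G}).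

(** The list holds all vertices and both ends are indices: such lists are reversed by [rev] and
    joined by [++] with the joining edge as only obligation, which suits cycles described block by
    block. *)
Definition pth x y s :=
  exists p, [/\ s = x :: p, path adj x p & last x p = y].

Lemma pth1 x : pth x x [:: x].
Proof. by exists [::]. Qed.

Lemma pth_cat x y x' y' s s' :
  pth x y s -> adj y x' -> pth x' y' s' -> pth x y' (s ++ s').
Proof.
case=> p [-> xp <-] yx [q [-> xq <-]]; exists (p ++ x' :: q).
by rewrite cat_path last_cat /= xp yx.
Qed.

Lemma pth_rev x y s : pth x y s -> pth y x (rev s).
Proof.
case=> p [-> xp <-]; exists (rev (belast x p)); split.
- by rewrite lastI rev_rcons.
- by rewrite rev_path; apply: sub_path xp => a b /=; rewrite adjC.
- by case: p {xp} => [|b p] //=; rewrite rev_cons last_rcons.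
Qed.

Lemma pth_split x z a s s' : pth x z (s ++ a :: s') ->
  pth x a (rcons s a) /\ pth a z (a :: s').
Proof.
case=> p [E xp <-]; case: s E => [[-> ->]|b s [-> E]].
  by split; [exists [::]|exists p].
move: xp; rewrite -E cat_path last_cat /= => /and3P[xs sa as'].
split; last by exists s'.
by exists (rcons s a); rewrite rcons_path last_rcons xs.
Qed.

Lemma pth_split2 x z a b s s' : pth x z (s ++ a :: b :: s') ->
  [/\ pth x a (rcons s a), adj a b & pth b z (b :: s')].
Proof.
case/pth_split=> xa [p [[<-] /= /andP[ab bt] <-]].
by split=> //; exists s'.
Qed.

Lemma pth_rconsE x z s a : pth x z (rcons s a) -> z = a.
Proof.
case=> p [E _ <-]; move: E; case: s => [[_ <-]//|b s [_ <-]].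
by rewrite last_rcons.
Qed.

Lemma pth_consE x z s a : pth x z (a :: s) -> x = a.
Proof. by case=> p [[]]. Qed.

Lemma pth_head x z s : pth x z s -> x \in s.
Proof. by case=> p [-> *]; rewrite inE eqxx. Qed.

Lemma pth_last x z s : pth x z s -> z \in s.
Proof. by case=> p [-> _ <-]; rewrite mem_last. Qed.

Lemma pth_size x z s : pth x z s -> 0 < size s.
Proof. by case=> p [->]. Qed.

Definition att D x := [exists d in D, adj x d].

Lemma attP D x : reflect (exists2 d, d \in D & adj x d) (att D x).
Proof. exact: exists_inP. Qed.

Lemma natt D x d : ~~ att D x -> d \in D -> ~~ adj x d.
Proof. by move=> /exists_inPn H /H. Qed.

Definition far D x := (x \notin D) && ~~ att D x.

Lemma far_adj D x d : far D x -> d \in D -> ~~ adj x d.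
Proof. by case/andP=> _; apply: natt. Qed.

Lemma far_adjC D x d : far D x -> d \in D -> ~~ adj d x.
Proof. by move=> xD dD; rewrite adjC (far_adj xD). Qed.

Lemma far_neq D x d : far D x -> d \in D -> d != x.
Proof. by case/andP=> xD _ dD; apply: contraNneq xD => <-. Qed.

(* The cycle runs from u through A to v and returns through the reverse of B:
   both A and B are listed from u to v. D is a component of the rest. *)
Record config D u v A B : Prop := Config {
  config_pathA : path adj u (rcons A v);
  config_pathB : path adj u (rcons B v);
  config_uniq : uniq (u :: v :: A ++ B);
  config_disj : forall d, d \in D -> d \notin u :: v :: A ++ B;
  config_conn : forall d d', d \in D -> d' \in D ->
    exists Q, [/\ pth d d' Q, uniq Q & {subset Q <= D}];
  config_closed : forall d w, d \in D -> adj d w ->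
    w \in D \/ w \in u :: v :: A ++ B;
  config_longest : forall x y s, pth x y s -> uniq s -> adj y x ->
    2 < size s -> size s <= (size A + size B).+2 }.

Record link D x y Q d d' : Prop := Link {
  link_pth : pth d d' Q;
  link_adjl : adj x d;
  link_adjr : adj d' y;
  link_uniq : uniq Q;
  link_sub : {subset Q <= D} }.

(* r lists the vertices of the cycle that the cycle s through Q misses. *)
Lemma noc D u v A B Q x y s r : config D u v A B -> uniq Q -> {subset Q <= D} ->
  pth x y s -> adj y x -> perm_eq (s ++ r) (Q ++ u :: v :: A ++ B) ->
  size r < size Q -> False.
Proof.
move=> cf uQ QD xys yx E rQ.
have us : uniq (s ++ r).
  rewrite (perm_uniq E) cat_uniq uQ (config_uniq cf) andbT.
  by apply/hasPn => w wC; apply/negP => /QD /(config_disj cf); rewrite wC.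
have := perm_size E; rewrite !size_cat /= size_cat => sz.
move: us; rewrite cat_uniq => /andP[us _].
have := config_longest cf xys us yx; lia.
Qed.

End Paths.

Ltac adjs := solve [assumption | rewrite adjC; assumption].
Ltac pth_atom := first [eassumption | apply: pth1 | apply: pth_rev; eassumption].
Ltac pths := first [pth_atom | eapply pth_cat; [pth_atom | | pths]; adjs].
Ltac counts :=
  rewrite ?count_cat ?count_rev -?cats1 ?cat_rcons /= ?count_cat ?count_rev /= ?count_cat ?count_rev /=.
Ltac perms :=
  let a := fresh "a" in apply/permP => a;
  repeat match goal with H : is_true (perm_eq _ _) |- _ =>
    move/permP: H => /(_ a) end;
  counts; clear; lia.
Ltac sizes := rewrite ?size_rev /=; first [assumption | done | slia].
(** One rerouting: [s] is the new cycle in blocks, [r] the part of the old cycle that it loses. The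
    goals are that [s] is a path, that its ends are adjacent, that the vertices balance (by
    counting), and that [r] is shorter than the path through [D] described by [Pu] and [PD]. *)
Ltac cyc cf Pu PD s r := exfalso;
  eapply (noc (s := s) (r := r) cf Pu PD);
  [pths | adjs | perms | sizes].

(** * Elementary reroutings near the attachments *)

Section Configurations.
Variable G : sgraph.
Implicit Types (x y z u v a b d t : G) (s A B P Q : seq G) (D : {set G}).

Lemma config_swap D u v A B : config D u v A B -> config D u v B A.
Proof.
have E w : (w \in u :: v :: B ++ A) = (w \in u :: v :: A ++ B).
  by rewrite !inE !mem_cat (orbC (w \in B)).
case=> pA pB un dj cn cl lg; split=> //.
- by rewrite -(perm_uniq (s1 := u :: v :: A ++ B)) // !perm_cons perm_catC.
- by move=> d; rewrite E; apply: dj.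
- by move=> d w; rewrite E; apply: cl.
- by move=> x y s *; rewrite addnC; apply: (lg x y).
Qed.

Lemma path_rcons_rev u v A : path adj u (rcons A v) -> path adj v (rcons (rev A) u).
Proof.
move=> pA; rewrite -rev_cons.
have := rev_path adj u (rcons A v); rewrite last_rcons belast_rcons => ->.
by apply: sub_path pA => a b /=; rewrite adjC.
Qed.

Lemma config_flip D u v A B :
  config D u v A B -> config D v u (rev A) (rev B).
Proof.
have E : perm_eq (v :: u :: rev A ++ rev B) (u :: v :: A ++ B).
  by apply/permP => a; rewrite /= !count_cat !count_rev /=; lia.
case=> pA pB un dj cn cl lg; split=> //.
- exact: path_rcons_rev.
- exact: path_rcons_rev.
- by rewrite (perm_uniq E).
- by move=> d; rewrite (perm_mem E); apply: dj.
- by move=> d w; rewrite (perm_mem E); apply: cl.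
- by move=> x y s *; rewrite !size_rev; apply: (lg x y).
Qed.

Lemma link_flip D x y Q d d' : link D x y Q d d' -> link D y x (rev Q) d' d.
Proof.
case=> Qp xd dy Qu QD; split; rewrite ?rev_uniq //; first exact: pth_rev.
- by rewrite adjC.
- by rewrite adjC.
- by move=> w; rewrite mem_rev; apply: QD.
Qed.

Lemma path_pth u v A : path adj u (rcons A v) -> 0 < size A ->
  exists a z, [/\ pth a z A, adj u a & adj z v].
Proof.
case: A => [//|a A]; rewrite rcons_path => /= /andP[/andP[ua aA] zv] _.
by exists a, (last a A); split=> //; exists A.
Qed.


Lemma config_pth D u v A B : config D u v A B -> pth u v (u :: rcons A v).
Proof. by move=> cf; exists (rcons A v); rewrite last_rcons (config_pathA cf). Qed.

(** Otherwise [P] could replace [A]. If [B] is empty, the cycle closes with the edge [u v]. *)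
Lemma config_size D u v A B P d d' : config D u v A B -> link D u v P d d' ->
  size P <= size A.
Proof.
move=> cf [Pp ud dv Pu PD]; rewrite leqNgt; apply/negP => AP.
have [B0|B0] := posnP (size B).
  move/size0nil: B0 cf => -> cf; have := config_pathB cf => /= /andP[uv _].
  cyc cf Pu PD ([:: u] ++ P ++ [:: v]) A.
have [b1 [bn [Bp ub bv]]] := path_pth (config_pathB cf) B0.
cyc cf Pu PD ([:: u] ++ P ++ [:: v] ++ rev B) A.
Qed.

Record ends u v A a z : Prop := Ends {
  ends_pth : pth a z A; ends_l : adj u a; ends_r : adj z v }.

Lemma ends_rev u v A a z : ends u v A a z -> ends v u (rev A) z a.
Proof. by case=> Ap ua zv; split; [exact: pth_rev|by rewrite adjC|by rewrite adjC]. Qed.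

Lemma config_endsA D u v A B P d d' : config D u v A B -> link D u v P d d' ->
  exists a z, ends u v A a z.
Proof.
move=> cf lk; have := config_size cf lk; have := pth_size (link_pth lk) => P0 PA.
have [|a [z [Ap ua zv]]] := path_pth (config_pathA cf); first by lia.
by exists a, z.
Qed.

Lemma config_endsB D u v A B P d d' : config D u v A B -> link D u v P d d' ->
  exists b w, ends u v B b w.
Proof. by move/config_swap; apply: config_endsA. Qed.

Lemma config_inA D u v A B w : config D u v A B -> w \in A -> w \notin D.
Proof.
move=> cf wA; apply/negP => /(config_disj cf); rewrite !inE mem_cat wA.
by rewrite /= !orbT.
Qed.

Lemma config_neqAB D u v A B a b : config D u v A B -> a \in A -> b \in B -> a != b.
Proof.
move=> cf aA bB; apply/eqP => E; have := config_uniq cf.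
rewrite !cons_uniq cat_uniq => /andP[_ /andP[_ /and3P[_ /hasPn/(_ _ bB)]]].
by rewrite /= -E aA.
Qed.

(** If [u] and its cycle neighbour [a] both saw [D], a path through [D] could be inserted between
    them. *)
Lemma first_far D u v A B P d d' a z : config D u v A B -> link D u v P d d' ->
  ends u v A a z -> far D a.
Proof.
move=> cf lk [Ap ua zv]; rewrite /far (config_inA cf (pth_head Ap)) /=; apply/attP => -[d0 d0D ad0].
have [b [w [Bp ub wv]]] := config_endsB cf lk.
case: lk => Pp ud dv Pu PD; have dD := PD _ (pth_head Pp).
have [Q [Qp Qu QD]] := config_conn cf dD d0D.
have := pth_size Qp => Q0.
cyc cf Qu QD ([:: u] ++ Q ++ A ++ [:: v] ++ rev B) (Nil G).
Qed.

Lemma last_far D u v A B P d d' a z : config D u v A B -> link D u v P d d' ->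
  ends u v A a z -> far D z.
Proof.
by move=> cf lk /ends_rev; apply: first_far (config_flip cf) (link_flip lk).
Qed.

(** Along the cycle, [a] and [w] are the successors of [u] and [v]. An edge between them would close
    a cycle that crosses [D] to [v], runs back along [A] and then back along [B] to [u]. *)
Lemma cross_first_last D u v A B P d d' a z b w :
  config D u v A B -> link D u v P d d' ->
  ends u v A a z -> ends u v B b w -> ~~ adj a w.
Proof.
move=> cf [Pp ud dv Pu PD] [Ap ua zv] [Bp ub wv]; apply/negP => aw.
have := pth_size Pp => P0.
cyc cf Pu PD (P ++ [:: v] ++ rev A ++ rev B ++ [:: u]) (Nil G).
Qed.

Lemma natt_next D u v A1 t x A2 B : config D u v (A1 ++ t :: x :: A2) B ->
  att D t -> far D x.
Proof.
move=> cf /attP[d dD td]; rewrite /far (config_inA cf) /=; last first.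
  by rewrite mem_cat !inE eqxx !orbT.
apply/attP => -[d' d'D xd'].
have [Q [Qp Qu QD]] := config_conn cf dD d'D; have := pth_size Qp => Q0.
have := config_pth cf; rewrite -cats1 -catA -[u :: _]/((u :: A1) ++ _) /=.
move=> /(@pth_split2 _ u v t x (u :: A1))[p1 tx p2].
have [B0|B0] := posnP (size B).
  move/size0nil: B0 cf => -> cf; have := config_pathB cf => /= /andP[uv _].
  cyc cf Qu QD (rcons (u :: A1) t ++ Q ++ (x :: A2 ++ [:: v])) (Nil G).
have [b1 [bn [Bp ub bv]]] := path_pth (config_pathB cf) B0.
cyc cf Qu QD (rcons (u :: A1) t ++ Q ++ (x :: A2 ++ [:: v]) ++ rev B) (Nil G).
Qed.

Definition claw_free := forall c x y z, adj c x -> adj c y -> adj c z ->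
  ~~ adj x y -> ~~ adj x z -> uniq [:: x; y; z] -> adj y z.

Section ClawFree.
Hypothesis cfG : claw_free.


Lemma claw_far D x d y y' : adj x d -> d \in D -> adj x y -> adj x y' ->
  far D y -> far D y' -> y != y' -> adj y y'.
Proof.
move=> xd dD xy xy' fy fy' yy'; apply: (cfG xd xy xy'); rewrite ?(far_adjC _ dD) //=.
by rewrite !inE negb_or !(far_neq _ dD) // yy'.
Qed.

Lemma claw_first D u v A B P d d' a z b w :
  config D u v A B -> link D u v P d d' ->
  ends u v A a z -> ends u v B b w -> adj a b.
Proof.
move=> cf lk eA eB.
have fa := first_far cf lk eA; have fb := first_far (config_swap cf) lk eB.
case: lk eA eB => Pp ud dv Pu PD [Ap ua zv] [Bp ub wv].
apply: (claw_far ud (PD _ (pth_head Pp)) ua ub) => //.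
exact: config_neqAB cf (pth_head Ap) (pth_head Bp).
Qed.

Lemma claw_last D u v A B P d d' a z b w :
  config D u v A B -> link D u v P d d' ->
  ends u v A a z -> ends u v B b w -> adj z w.
Proof.
move=> cf lk /ends_rev eA /ends_rev eB.
exact: claw_first (config_flip cf) (link_flip lk) eA eB.
Qed.

(** The edge [a b] replaces the passage through [u]: from [u] go to [w], back along [B], over to
    [a], along [A] to [v], and home through [D]. *)
Lemma claw_far_end D u v A B P d d' a z b w :
  config D u v A B -> link D u v P d d' ->
  ends u v A a z -> ends u v B b w -> ~~ adj u w.
Proof.
move=> cf lk eA eB; have ab := claw_first cf lk eA eB.
case: lk eA eB => Pp ud dv Pu PD [Ap ua zv] [Bp ub wv]; apply/negP => uw.
have := pth_size Pp => P0.
cyc cf Pu PD ([:: u] ++ rev B ++ A ++ [:: v] ++ rev P) (Nil G).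
Qed.

End ClawFree.
End Configurations.

(** * Induced paths *)

Section InducedPath.
Variable G : sgraph.
Implicit Types (x y : G) (p q : seq G) (S T : pred G).

Definition induced_path (e : seq G) := forall x i j, i < size e -> j < size e ->
  adj (nth x e i) (nth x e j) = consecutive i j.

Lemma last_take x p i : i <= size p -> last x (take i p) = nth x (x :: p) i.
Proof.
move=> ip; rewrite (last_nth x) size_takel //.
by case: i ip => [|i] ip //=; rewrite nth_take.
Qed.

Lemma last_drop x p i : i <= size p -> last (nth x (x :: p) i) (drop i p) = last x p.
Proof. by move=> ip; rewrite -last_take // -last_cat cat_take_drop. Qed.

Lemma path_drop x p i : i <= size p -> path adj x p ->
  path adj (nth x (x :: p) i) (drop i p).
Proof.
by move=> ip; rewrite -last_take // -{1}(cat_take_drop i p) cat_path => /andP[].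
Qed.

Lemma path_take x p i : path adj x p -> path adj x (take i p).
Proof. by rewrite -{1}(cat_take_drop i p) cat_path => /andP[]. Qed.

(** Induction on the length: a vertex of [T] before the end, a repeated vertex or a chord each give
    a shorter path of the same kind. *)
Lemma shortest_path S T x p :
  path adj x p -> all S p -> T (last x p) ->
  exists q, [/\ path adj x q /\ uniq (x :: q), all S q, T (last x q),
    forall i, i < size q -> ~~ T (nth x (x :: q) i) & induced_path (x :: q)].
Proof.
have [n] := ubnP (size p); elim: n p => // n IH p; rewrite ltnS => pn xp Sp Tp.
have sub q : {subset q <= p} -> all S q by move=> qp; apply/allP => y /qp /(allP Sp).
have [/existsP[i Ti]|/existsPn nT] :=
  boolP [exists i : 'I_(size p), T (nth x (x :: p) i)].
  have ip := ltn_ord i; apply: (IH (take i p)).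
  - by rewrite size_takel ?(leq_trans ip) // ltnW.
  - exact: path_take.
  - by apply: sub => y /mem_take.
  - by rewrite last_take // ltnW.
have [/existsP[i /existsP[j /andP[ij E]]]|/existsPn uni] :=
  boolP [exists i : 'I_(size p).+1, exists j : 'I_(size p).+1,
    (i < j) && (nth x (x :: p) i == nth x (x :: p) j)].
  have := ltn_ord i; have := ltn_ord j; rewrite !ltnS => jp ip.
  apply: (IH (take i p ++ drop j p)).
  - by rewrite size_cat size_takel // size_drop; lia.
  - by rewrite cat_path path_take //= last_take // (eqP E) path_drop.
  - by apply: sub => y; rewrite mem_cat => /orP[/mem_take|/mem_drop].
  - by rewrite last_cat last_take // (eqP E) last_drop.
have [/existsP[i /existsP[j /andP[ij E]]]|/existsPn cho] :=
  boolP [exists i : 'I_(size p).+1, exists j : 'I_(size p).+1,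
    (i.+1 < j) && adj (nth x (x :: p) i) (nth x (x :: p) j)].
  have := ltn_ord i; have := ltn_ord j; rewrite !ltnS => jp ip.
  (* Position [j] of [x :: p] is position [j.-1] of [p], so the part starting at the far end of the
     chord is [drop j.-1 p]. *)
  have j1 : j.-1 < size p by lia.
  have dE : drop j.-1 p = nth x (x :: p) j :: drop j p.
    by rewrite (drop_nth x) //; case: (nat_of_ord j) ij.
  apply: (IH (take i p ++ drop j.-1 p)).
  - by rewrite size_cat size_takel // size_drop; lia.
  - by rewrite cat_path path_take //= last_take // dE /= E path_drop.
  - by apply: sub => y; rewrite mem_cat => /orP[/mem_take|/mem_drop].
  - by rewrite last_cat last_take // dE /= last_drop.
have uni' i j : i < j -> j <= size p -> nth x (x :: p) i != nth x (x :: p) j.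
  move=> ij jp; have ip : i < (size p).+1 by lia.
  by have /existsPn/(_ (inord j)) := uni (inord i); rewrite !inordK // ij.
have cho' i j : i.+1 < j -> j <= size p -> ~~ adj (nth x (x :: p) i) (nth x (x :: p) j).
  move=> ij jp; have ip : i < (size p).+1 by lia.
  by have /existsPn/(_ (inord j)) := cho (inord i); rewrite !inordK // ij.
have stp i : i < size p -> adj (nth x (x :: p) i) (nth x (x :: p) i.+1).
  by move=> ip; move/(pathP x): xp; apply.
exists p; split=> //.
- split=> //; apply/(uniqP x) => i j; rewrite !inE /= !ltnS => ip jp E.
  case: (ltngtP i j) => // ij; last by have := uni' _ _ ij ip; rewrite E eqxx.
  by have := uni' _ _ ij jp; rewrite E eqxx.
- by move=> i ip; apply: (nT (Ordinal ip)).
move=> x0 i j ip jp; rewrite !(set_nth_default x x0) //.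
wlog ij : i j ip jp / i <= j.
  move=> W; case: (leqP i j) => [|/ltnW] ij; first exact: W.
  by rewrite adjC consecutive_sym W.
move: ip jp; rewrite /= !ltnS => ip jp.
have [lt|ge] := ltnP i.+1 j.
  by rewrite (negbTE (cho' _ _ lt jp)) /consecutive; lia.
have [->|ne] := eqVneq i j; first by rewrite adj_irrefl /consecutive; lia.
have ji : j = i.+1 by move/eqP: ne; lia.
by rewrite ji stp ?/consecutive ?eqxx // -?ji; lia.
Qed.
End InducedPath.

(** * Maximal frontiers *)

Section Frontier.
Variable G : sgraph.
Implicit Types (x y u v : G) (s A B P H : seq G) (D : {set G}).
Hypothesis cfG : claw_free G.

(* Ha and Hb are Hamiltonian paths from u of the part u :: A1 ++ B1 of the cycle,
   ending at its frontier. If A1 were all of A, then Hb could be continued along B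
   to v and closed through D. *)
Record frontier D u A B A1 B1 Ha Hb : Prop := Frontier {
  fr_A : exists A2, A = A1 ++ A2;
  fr_B : exists B2, B = B1 ++ B2;
  fr_A0 : 0 < size A1;
  fr_B0 : 0 < size B1;
  fr_Ha : pth u (last u A1) Ha;
  fr_Hb : pth u (last u B1) Hb;
  fr_permA : perm_eq Ha (u :: A1 ++ B1);
  fr_permB : perm_eq Hb (u :: A1 ++ B1);
  fr_far : all (far D) (A1 ++ B1) }.

Definition max_frontier D u A B A1 B1 Ha Hb :=
  frontier D u A B A1 B1 Ha Hb /\
  forall A1' B1' Ha' Hb', frontier D u A B A1' B1' Ha' Hb' ->
    size A1' + size B1' <= size A1 + size B1.

Lemma frontier_swap D u A B A1 B1 Ha Hb :
  frontier D u A B A1 B1 Ha Hb -> frontier D u B A B1 A1 Hb Ha.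
Proof.
have E : perm_eq (u :: A1 ++ B1) (u :: B1 ++ A1) by rewrite perm_cons perm_catC.
case=> eA eB A0 B0 Hap Hbp pa pb far_.
split=> //; [exact: perm_trans pb E|exact: perm_trans pa E|].
by rewrite all_cat andbC -all_cat.
Qed.

Lemma max_frontier_swap D u A B A1 B1 Ha Hb :
  max_frontier D u A B A1 B1 Ha Hb -> max_frontier D u B A B1 A1 Hb Ha.
Proof.
case=> /frontier_swap fr mx; split=> // A1' B1' Ha' Hb' /frontier_swap /mx; lia.
Qed.

Lemma max_frontier_exists D u A B A1 B1 Ha Hb :
  frontier D u A B A1 B1 Ha Hb ->
  exists A1 B1 Ha Hb, max_frontier D u A B A1 B1 Ha Hb.
Proof.
have [n] := ubnP (size A + size B - (size A1 + size B1)).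
elim: n A1 B1 Ha Hb => // n IH A1 B1 Ha Hb le fr.
have [[A1' [B1' [Ha' [Hb' [fr' lt]]]]]|no] := Classical_Prop.classic (exists A1' B1' Ha' Hb',
  frontier D u A B A1' B1' Ha' Hb' /\ size A1 + size B1 < size A1' + size B1').
  apply: (IH _ _ _ _ _ fr'); case: (fr') => [[A2 EA] [B2 EB] _ _ _ _ _ _ _].
  by move: lt le; rewrite EA EB !size_cat; lia.
exists A1, B1, Ha, Hb; split=> // A1' B1' Ha' Hb' fr'; rewrite leqNgt.
by apply/negP => lt; apply: no; exists A1', B1', Ha', Hb'.
Qed.

Section OneSide.
Variables (D : {set G}) (u v : G) (A B P : seq G) (d d' a z b w : G).
Hypotheses (cf : config D u v A B) (lk : link D u v P d d')
  (eA : ends u v A a z) (eB : ends u v B b w).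

Lemma frontier_start : exists A1 B1 Ha Hb, frontier D u A B A1 B1 Ha Hb.
Proof.
have ab := claw_first cfG cf lk eA eB.
have fa := first_far cf lk eA; have fb := first_far (config_swap cf) lk eB.
case: eA eB => [[A' [EA _ _]] ua _] [[B' [EB _ _]] ub _].
exists [:: a], [:: b], [:: u; b; a], [:: u; a; b]; split=> //=.
- by exists A'.
- by exists B'.
- by exists [:: b; a]; rewrite /= ub adjC ab.
- by exists [:: a; b]; rewrite /= ua ab.
- by apply/permP => c /=; lia.
- by rewrite fa fb.
Qed.

Variables (A1 B1 Ha Hb : seq G).
Hypothesis mf : max_frontier D u A B A1 B1 Ha Hb.

Lemma frontier_rest : exists x A2, A = A1 ++ x :: A2.
Proof.
case: mf => [[[A2 EA] [B2 EB] A0 B0 Hap Hbp pa pb fr] _].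
case: A2 EA => [|x A2] EA; last by exists x, A2.
case: lk => Pp ud dv Pu PD; have P0 := pth_size Pp.
have := config_pathB cf; rewrite EB rcons_cat cat_path => /andP[_].
rewrite cats0 in EA; move: cf; rewrite EA EB => cf'.
(* The vertex [y] after the end of [B1] is [v] itself when nothing of [B] is left. *)
case E : (rcons B2 v) (last_rcons v B2 v) => [|y s] ly; first by case: B2 E {EB cf'}.
case/andP=> by_ ys; have yv : pth y v (rcons B2 v) by rewrite E; exists s.
by cyc cf' Pu PD (Hb ++ rcons B2 v ++ rev P) (Nil G).
Qed.

Variables (xA : G) (A3 : seq G) (xB : G) (B3 : seq G).
Hypotheses (EA : A = A1 ++ xA :: A3) (EB : B = B1 ++ xB :: B3).

Let cf' : config D u v (A1 ++ xA :: A3) (B1 ++ xB :: B3).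
Proof. by rewrite -EA -EB. Qed.

Lemma rest_pathA : [/\ adj (last u A1) xA, pth xA z (xA :: A3) & pth xA v (rcons (xA :: A3) v)].
Proof.
case: eA => Ap _ _; move: (Ap); rewrite {1}EA => /pth_split[_ p2].
have := config_pathA cf; rewrite EA rcons_cat cat_path => /andP[_ /= /andP[ax xv]].
by split=> //; exists (rcons A3 v); rewrite last_rcons.
Qed.

Lemma rest_pathB : [/\ adj (last u B1) xB, pth xB w (xB :: B3) & pth xB v (rcons (xB :: B3) v)].
Proof.
case: eB => Bp _ _; move: (Bp); rewrite {1}EB => /pth_split[_ p2].
have := config_pathB cf; rewrite EB rcons_cat cat_path => /andP[_ /= /andP[ax xv]].
by split=> //; exists (rcons B3 v); rewrite last_rcons.
Qed.

(** [Hb] leaves the covered part on the side of [B]. So a cycle could follow [Hb], then [B] to [v],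
    then [A] backwards to [xA], and return to [u] through [D]. *)
Lemma frontier_far : far D xA.
Proof.
rewrite /far (config_inA cf) ?EA ?mem_cat ?inE ?eqxx ?orbT //=.
apply/attP => -[e eD xe]; case: (mf) => [[_ _ _ _ Hap Hbp pa pb fr] _].
have [ax xz xv] := rest_pathA; have [bx xw xBv] := rest_pathB.
case: lk eA => Pp ud dv Pu PD [_ _ zv]; have dD := PD _ (pth_head Pp).
have [Q [Qp Qu QD]] := config_conn cf dD eD; have Q0 := pth_size Qp.
cyc cf' Qu QD (Hb ++ rcons (xB :: B3) v ++ rev (xA :: A3) ++ rev Q) (Nil G).
Qed.

Lemma frontier_nadj_v : ~~ adj v xA.
Proof.
apply/negP => vx; case: (mf) => [[_ _ _ _ Hap Hbp pa pb fr] _].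
have [ax xz xv] := rest_pathA; have [bx xw xBv] := rest_pathB.
have zw := claw_last cfG cf lk eA eB.
case: lk => Pp ud dv Pu PD; have P0 := pth_size Pp.
cyc cf' Pu PD (Hb ++ (xB :: B3) ++ rev (xA :: A3) ++ [:: v] ++ rev P) (Nil G).
Qed.

Lemma frontier_nadj_last : ~~ adj xA w.
Proof.
apply/negP => xw0; case: (mf) => [[_ _ _ _ Hap Hbp pa pb fr] _].
have [ax xz xv] := rest_pathA; have [bx xw xBv] := rest_pathB.
case: lk eA => Pp ud dv Pu PD [_ _ zv]; have P0 := pth_size Pp.
cyc cf' Pu PD (Hb ++ (xB :: B3) ++ (xA :: A3) ++ [:: v] ++ rev P) (Nil G).
Qed.
End OneSide.

Section Maximal.
Variables (D : {set G}) (u v : G) (A B P : seq G) (d d' a z b w : G).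
Hypotheses (cf : config D u v A B) (lk : link D u v P d d')
  (eA : ends u v A a z) (eB : ends u v B b w).
Variables (A1 B1 Ha Hb : seq G).
Hypothesis mf : max_frontier D u A B A1 B1 Ha Hb.
Variables (xA : G) (A3 : seq G) (xB : G) (B3 : seq G).
Hypotheses (EA : A = A1 ++ xA :: A3) (EB : B = B1 ++ xB :: B3).
Let mfs := max_frontier_swap mf.

Let farA : far D xA.
Proof. exact: (frontier_far cf lk eA eB mf EA EB). Qed.
Let farB : far D xB.
Proof. exact: (frontier_far (config_swap cf) lk eB eA mfs EB EA). Qed.

Lemma extend_both Ha' Hb' :
  pth u xA Ha' -> perm_eq Ha' (u :: rcons A1 xA ++ rcons B1 xB) ->
  pth u xB Hb' -> perm_eq Hb' (u :: rcons A1 xA ++ rcons B1 xB) -> False.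
Proof.
move=> Hap pa Hbp pb; case: (mf) => [[_ _ _ _ _ _ _ _ fr] mx].
have : size (rcons A1 xA) + size (rcons B1 xB) <= size A1 + size B1.
  apply: (mx _ _ Ha' Hb'); split; rewrite ?size_rcons ?last_rcons //.
  - by exists A3; rewrite cat_rcons.
  - by exists B3; rewrite cat_rcons.
  - by move: fr; rewrite !all_cat !all_rcons farA farB.
by rewrite !size_rcons; lia.
Qed.

Lemma frontier_nadj : ~~ adj xA xB.
Proof.
apply/negP => AB; case: (mf) => [[_ _ _ _ Hap Hbp pa pb fr] _].
have [ax _ _] := rest_pathA cf eA EA; have [bx _ _] := rest_pathB cf eB EB.
apply: (@extend_both (Hb ++ [:: xB] ++ [:: xA]) (Ha ++ [:: xA] ++ [:: xB])).
- pths.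
- perms.
- pths.
- perms.
Qed.

(** Putting [xA] between [g] and [x] in [Hb], and at the end of [Ha], would advance the frontier by
    [xA] alone. *)
Lemma no_insertion s g x s' : Hb = s ++ g :: x :: s' -> adj xA g -> ~~ adj xA x.
Proof.
move=> EH xg; apply/negP => xx; case: (mf) => [[_ _ _ B0 Hap Hbp pa pb fr] mx].
have [ax _ _] := rest_pathA cf eA EA.
move: Hbp; rewrite EH => /pth_split2[p1 gx p2].
have : size (rcons A1 xA) + size B1 <= size A1 + size B1.
  apply: (mx _ _ (Ha ++ [:: xA]) (rcons s g ++ [:: xA] ++ (x :: s'))).
  split; rewrite ?size_rcons ?last_rcons //.
  - by exists A3; rewrite cat_rcons.
  - by exists (xB :: B3).
  - pths.
  - pths.
  - perms.
  - move: pb; rewrite EH => pb; perms.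
  - by move: fr; rewrite !all_cat !all_rcons farA.
by rewrite !size_rcons; lia.
Qed.

Lemma left_far x : x \in A1 ++ B1 -> far D x.
Proof. by case: (mf) => [[_ _ _ _ _ _ _ _ /allP fr] _] /fr. Qed.

Lemma left_uniq : uniq ((u :: A1 ++ B1) ++ xA :: A3).
Proof.
have := config_uniq cf; rewrite EA EB => un.
apply: (subseq_uniq _ (_ : uniq ((u :: A1 ++ B1) ++ (xA :: A3) ++ v :: xB :: B3))).
  by rewrite catA prefix_subseq.
move: un; rewrite (perm_uniq (_ : perm_eq _ ((u :: A1 ++ B1) ++ (xA :: A3) ++ v :: xB :: B3))) //.
perms.
Qed.

Lemma left_neq x : x \in u :: A1 ++ B1 -> x != xA.
Proof.
apply: contraTneq => ->; have := left_uniq.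
by rewrite cat_uniq => /and3P[_ /= /norP[]].
Qed.

Lemma memHb x : (x \in Hb) = (x \in u :: A1 ++ B1).
Proof. by case: (mf) => [[_ _ _ _ _ _ _ pb _] _]; rewrite (perm_mem pb). Qed.

(** If [u] saw [xA], then among [d], [xA] and the second vertex [h] of [Hb] only [xA] and [h] could
    be adjacent; claw-freeness would make them so, and [xA] could be inserted between [u] and
    [h]. *)
Lemma frontier_nadj_u : ~~ adj xA u.
Proof.
apply/negP => xu; case: (mf) => [[_ _ A0 _ _ [s [EH us ls]] _ pb _] _].
have := perm_size pb; rewrite EH /= size_cat.
case: s EH us ls => [|h s] EH us ls /= sz; first by lia.
have /negP[] := @no_insertion [::] u h s EH xu.
have hL : h \in A1 ++ B1.
  have := perm_mem pb h; rewrite EH !inE eqxx orbT => /esym/orP[/eqP hu|//].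
  by move: us; rewrite /= hu adj_irrefl.
case: lk => Pp ud _ _ PD; case/andP: us => uh _.
apply: (claw_far cfG ud (PD _ (pth_head Pp)) _ uh farA (left_far hL)).
  by rewrite adjC.
by rewrite eq_sym left_neq // inE hL orbT.
Qed.

(** By [no_insertion], [xA] misses both neighbours of [x] on [Hb], so claw-freeness at [x] joins
    them: [x] can be cut out of [Hb] and used elsewhere. *)
Lemma skip_vertex x : x \in u :: A1 ++ B1 -> adj xA x -> x != last u B1 ->
  exists s g g' s', [/\ Hb = s ++ g :: x :: g' :: s', adj g g',
    pth u g (rcons s g) & pth g' (last u B1) (g' :: s')].
Proof.
move=> xL xx xl; case: (mf) => [[_ _ _ _ _ Hbp _ pb _] _].
have xu : x != u by apply: contraTneq xx => ->; exact: frontier_nadj_u.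
have uH : uniq Hb by rewrite (perm_uniq pb); have := left_uniq; rewrite cat_uniq => /andP[].
have [p1 [p2 E]] : exists p1 p2, Hb = p1 ++ x :: p2.
  by move: (xL); rewrite -memHb => /path.splitPr[p1 p2]; exists p1, p2.
case/lastP: p1 E => [|s g] E.
  by case: Hbp xu => p [E' _ _]; move: E; rewrite E' => -[->]; rewrite eqxx.
case: p2 E => [|g' s'] E.
  by move: Hbp xl; rewrite E cats1 => /pth_rconsE ->; rewrite eqxx.
rewrite cat_rcons in E; exists s, g, g', s'; split=> //.
- have [_ gx _] : [/\ pth u g (rcons s g), adj g x & pth x (last u B1) (x :: g' :: s')].
    by apply: pth_split2; rewrite -E.
  have xg' : adj x g'.
    by have := Hbp; rewrite E -cat_rcons => /pth_split2[].
  apply: (cfG _ _ xg' (x := xA)); try adjs.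
  + by apply: (contraL _ xx); exact: no_insertion E.
  + by move: xx; apply: (@no_insertion (rcons s g) x g' s'); rewrite E cat_rcons.
  rewrite /= !inE negb_or !(eq_sym xA) !left_neq -?memHb ?E ?mem_cat ?inE ?eqxx ?orbT //=.
  by move: uH; rewrite E cat_uniq /= !inE !negb_or => /and3P[_ _ /andP[/and3P[_ ->]]].
- by have := Hbp; rewrite E => /pth_split2[].
- by have := Hbp; rewrite E -cat_rcons => /pth_split2[].
Qed.
End Maximal.

Section MaximalBoth.
Variables (D : {set G}) (u v : G) (A B P : seq G) (d d' a z b w : G).
Hypotheses (cf : config D u v A B) (lk : link D u v P d d')
  (eA : ends u v A a z) (eB : ends u v B b w).
Variables (A1 B1 Ha Hb : seq G).
Hypothesis mf : max_frontier D u A B A1 B1 Ha Hb.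
Variables (xA : G) (A3 : seq G) (xB : G) (B3 : seq G).
Hypotheses (EA : A = A1 ++ xA :: A3) (EB : B = B1 ++ xB :: B3).
Let mfs := max_frontier_swap mf.

Let swap_mem x : (x \in u :: B1 ++ A1) = (x \in u :: A1 ++ B1).
Proof. by rewrite !inE !mem_cat (orbC (x \in B1)). Qed.

(** Cut [x] out of [Hb] and append [xB], [x], [xA]. If [x] is itself the end of [Hb], its
    predecessor [h] sees [xB] by claw-freeness at [x], and the new path ends with [h], [xB], [x],
    [xA]. *)
Lemma extend_one x : x \in u :: A1 ++ B1 -> adj xA x -> adj xB x ->
  exists2 H, pth u xA H & perm_eq H (u :: rcons A1 xA ++ rcons B1 xB).
Proof.
move=> xL ax bx; case: (mf) => [[_ _ _ B0 Hap Hbp pa pb _] _].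
have [Bl _ _] := rest_pathB cf eB EB.
have [xl|xl] := eqVneq x (last u B1); last first.
  have [s [g [g' [s' [E gg p1 p2]]]]] := skip_vertex cf lk eA eB mf EA EB xL ax xl.
  exists (rcons s g ++ (g' :: s') ++ [:: xB] ++ [:: x] ++ [:: xA]); first by pths.
  by move: pb; rewrite E => pb; perms.
have [s E] : exists s, Hb = rcons s x.
  case/lastP: (Hb) Hbp => [|s y]; first by case=> ? [].
  by move/pth_rconsE => yl; exists s; rewrite xl yl.
case/lastP: s E => [|s h] E.
  have := perm_size pb; rewrite E /= size_cat; case: (mf) => [[_ _ A0 _ _ _ _ _ _] _]; lia.
rewrite -[rcons (rcons _ _) _]cats1 cat_rcons in E.
have [p1 hx _] : [/\ pth u h (rcons s h), adj h x & pth x x [:: x]].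
  by apply: pth_split2; rewrite -E xl.
have hL : h \in u :: A1 ++ B1.
  by rewrite -(memHb mf) E mem_cat !inE eqxx !orbT.
have ah : ~~ adj xA h by apply: (contraL _ ax); exact: (no_insertion cf lk eA eB mf EA EB E).
have bh : adj xB h.
  apply: (cfG (c := x) (x := xA)); try adjs.
  - exact: (frontier_nadj cf lk eA eB mf EA EB).
  have n1 := left_neq cf EA EB hL.
  have n2 : h != xB by apply: (left_neq (config_swap cf) EB EA); rewrite swap_mem.
  have n3 : xA != xB.
    by apply: (config_neqAB cf); rewrite ?EA ?EB mem_cat inE eqxx orbT.
  by rewrite /= !inE negb_or (eq_sym xA h) (eq_sym xB h) n1 n2 n3.
exists (rcons s h ++ [:: xB] ++ [:: x] ++ [:: xA]); first by pths.
by move: pb; rewrite E => pb; perms.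
Qed.
End MaximalBoth.

Section MaximalMeet.
Variables (D : {set G}) (u v : G) (A B P : seq G) (d d' a z b w : G).
Hypotheses (cf : config D u v A B) (lk : link D u v P d d')
  (eA : ends u v A a z) (eB : ends u v B b w).
Variables (A1 B1 Ha Hb : seq G).
Hypothesis mf : max_frontier D u A B A1 B1 Ha Hb.
Variables (xA : G) (A3 : seq G) (xB : G) (B3 : seq G).
Hypotheses (EA : A = A1 ++ xA :: A3) (EB : B = B1 ++ xB :: B3).
Let mfs := max_frontier_swap mf.

(** For a common neighbour, [extend_one] and its mirror image produce the two paths that
    [extend_both] excludes. *)
Lemma no_meet x : x \in u :: A1 ++ B1 -> adj xA x -> ~~ adj xB x.
Proof.
move=> xL ax; apply/negP => bx.
have [Ha' pa Ea] := extend_one cf lk eA eB mf EA EB xL ax bx.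
have [|Hb' pb Eb] := extend_one (config_swap cf) lk eB eA mfs EB EA _ bx ax.
  by move: xL; rewrite !inE !mem_cat (orbC (x \in B1)).
apply: (extend_both cf lk eA eB mf EA EB pa Ea pb).
by perms.
Qed.

Lemma lastB_nadj : ~~ adj xA (last u B1).
Proof.
case: (mf) => [[_ _ _ _ _ Hbp _ _ _] _]; have [Bl _ _] := rest_pathB cf eB EB.
have lL : last u B1 \in u :: A1 ++ B1 by rewrite -(memHb mf) (pth_last Hbp).
by apply/negP => /(no_meet lL); rewrite adjC Bl.
Qed.

Lemma skip_X x : x \in u :: A1 ++ B1 -> adj xA x ->
  exists s g g' s', [/\ Hb = s ++ g :: x :: g' :: s', adj g g',
    pth u g (rcons s g) & pth g' (last u B1) (g' :: s')].
Proof.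
move=> xL xx; apply: (skip_vertex cf lk eA eB mf EA EB xL xx).
by apply: contraTneq xx => ->; exact: lastB_nadj.
Qed.

(** The vertex cut out of [Hb] would serve as a bridge from [xA] to [v]: follow [Hb] without [x],
    the rest of [B], the rest of [A] backwards, then [x], [v] and [D]. *)
Lemma X_nadj_v x : x \in u :: A1 ++ B1 -> adj xA x -> ~~ adj v x.
Proof.
move=> xL xx; apply/negP => vx; case: (mf) => [[_ _ _ _ Hap Hbp pa pb fr] _].
have [s [g [g' [s' [E gg p1 p2]]]]] := skip_X xL xx.
have [ax xz xv] := rest_pathA cf eA EA; have [bx xw xBv] := rest_pathB cf eB EB.
have zw := claw_last cfG cf lk eA eB.
have cf' : config D u v (A1 ++ xA :: A3) (B1 ++ xB :: B3) by rewrite -EA -EB.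
case: lk => Pp ud dv Pu PD; have P0 := pth_size Pp; rewrite E in pb.
cyc cf' Pu PD (rcons s g ++ (g' :: s') ++ (xB :: B3) ++ rev (xA :: A3) ++ [:: x] ++ [:: v] ++ rev P) (Nil G).
Qed.

Lemma X_nadj_last x : x \in u :: A1 ++ B1 -> adj xA x -> ~~ adj x w.
Proof.
move=> xL xx; apply/negP => vx; case: (mf) => [[_ _ _ _ Hap Hbp pa pb fr] _].
have [s [g [g' [s' [E gg p1 p2]]]]] := skip_X xL xx.
have [ax xz xv] := rest_pathA cf eA EA; have [bx xw xBv] := rest_pathB cf eB EB.
have cf' : config D u v (A1 ++ xA :: A3) (B1 ++ xB :: B3) by rewrite -EA -EB.
case: lk eA => Pp ud dv Pu PD [_ _ zv]; have P0 := pth_size Pp; rewrite E in pb.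
cyc cf' Pu PD (rcons s g ++ (g' :: s') ++ (xB :: B3) ++ [:: x] ++ (xA :: A3) ++ [:: v] ++ rev P) (Nil G).
Qed.
End MaximalMeet.
End Frontier.

(** * Induced paths and attachments to them in claw-free graphs *)

Section InducedPathTheory.
Variable G : sgraph.
Implicit Types (x y u v : G) (s e q : seq G).

Lemma induced_path_cons y x s : induced_path (x :: s) -> adj y x ->
  all (fun c => ~~ adj y c) s -> induced_path (y :: x :: s).
Proof.
move=> ip yx /allP ns x0.
have K j : j < size s -> adj y (nth x0 s j) = false.
  by move=> js; apply/negbTE/ns/mem_nth.
move=> [|i] [|j] /=; rewrite ?ltnS => il jl.
- by rewrite adj_irrefl /consecutive; slia.
- case: j jl => [|j] jl; first by rewrite /= yx.
  by rewrite /= K // /consecutive; slia.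
- case: i il => [|i] il; first by rewrite /= adjC yx.
  by rewrite /= adjC K // /consecutive; slia.
- by rewrite (ip x0) // /consecutive; slia.
Qed.

Lemma induced_path_rev e : induced_path e -> induced_path (rev e).
Proof.
move=> ip x i j; rewrite size_rev => il jl; rewrite !nth_rev // ip; try slia.
rewrite /consecutive; slia.
Qed.

Lemma induced_path_rcons y x s : induced_path (rcons s x) -> adj x y ->
  all (fun c => ~~ adj c y) s -> induced_path (rcons (rcons s x) y).
Proof.
move=> ip xy ns; rewrite -[rcons _ y]revK; apply: induced_path_rev.
rewrite !rev_rcons; apply: induced_path_cons; rewrite 1?adjC //.
  by rewrite -rev_rcons; apply: induced_path_rev.
by rewrite all_rev; apply: sub_all ns => c; rewrite adjC.
Qed.

(** Vertices of [X] are never consecutive and can each be bypassed, so all of them can be deleted at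
    once. It is meant for [Hb] and the neighbours of [xA]. *)
Lemma filter_path (X : pred G) x s : path adj x s -> ~~ X x -> ~~ X (last x s) ->
  (forall s1 g y s2, x :: s = s1 ++ g :: y :: s2 -> X g -> ~~ X y) ->
  (forall s1 g y g' s2, x :: s = s1 ++ g :: y :: g' :: s2 -> X y -> adj g g') ->
  path adj x (filter (predC X) s) /\ last x (filter (predC X) s) = last x s.
Proof.
have [n] := ubnP (size s); elim: n x s => // n IH x [|y s] //=.
rewrite ltnS => sn /andP[xy ys] Xx Xl cons skip.
have [Xy|Xy] := boolP (X y); last first.
  have [|||p l] := IH y s _ ys Xy Xl; first by slia.
  - by move=> s1 g t s2 E; apply: (cons (x :: s1) g t s2); rewrite E.
  - by move=> s1 g t g' s2 E; apply: (skip (x :: s1) g t g' s2); rewrite E.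
  by rewrite /= xy p l.
case: s sn ys Xl cons skip => [|t s] /= sn ys Xl cons skip; first by rewrite Xy in Xl.
have Xt := cons [:: x] y t s erefl Xy.
have xt := skip [::] x y t s erefl Xy.
case/andP: ys => _ ts.
have [|||p l] := IH t s _ ts Xt Xl; first by slia.
- by move=> s1 g z s2 E; apply: (cons (x :: y :: s1) g z s2); rewrite E.
- by move=> s1 g z g' s2 E; apply: (skip (x :: y :: s1) g z g' s2); rewrite E.
by rewrite /= Xt /= xt p l.
Qed.

(** At the first neighbour of [w] on [e], claw-freeness forces the next vertex of [e] too; any later
    neighbour would form a claw at [w] with the first one and [w']. So [w] spans a triangle with
    exactly one edge of [e]. *)
Lemma claw_path_attach e x0 w w' : claw_free G -> induced_path e -> uniq e ->
  w \notin e -> has (adj w) e -> ~~ adj w (head x0 e) -> ~~ adj w (last x0 e) ->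
  adj w w' -> all (fun c => ~~ adj w' c) e -> w' \notin e ->
  exists h, [/\ 0 < h, h.+2 < size e, adj w (nth x0 e h), adj w (nth x0 e h.+1) &
    forall i, i < size e -> i != h -> i != h.+1 -> ~~ adj w (nth x0 e i)].
Proof.
move=> cfG ip ue we wN wh wl ww' /allP nw' w'e.
pose h := find (adj w) e; have he : h < size e by rewrite -has_find.
have wh' : adj w (nth x0 e h) by apply: nth_find.
have hmin i : i < h -> ~~ adj w (nth x0 e i) by move=> ih; apply/negbT/before_find.
have h0 : 0 < h by rewrite lt0n; apply: contraNneq wh => h0; rewrite -nth0 -h0.
have h1 : h.+1 < size e.
  rewrite ltn_neqAle he andbT; apply: contraNneq wl => E.
  by rewrite -nth_last -E.
have nthe i : i < size e -> nth x0 e i \in e by apply: mem_nth.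
have nthN i j : i < size e -> j < size e -> i != j -> nth x0 e i != nth x0 e j.
  by move=> il jl; rewrite nth_uniq.
have nwe i : i < size e -> nth x0 e i != w by move=> /nthe; apply: contraTneq => ->.
have nwe' i : i < size e -> nth x0 e i != w' by move=> /nthe; apply: contraTneq => ->.
have wh1 : adj w (nth x0 e h.+1).
  rewrite adjC; apply: (cfG (nth x0 e h) (nth x0 e h.-1)).
  - by rewrite ip ?/consecutive; slia.
  - by rewrite ip ?/consecutive; slia.
  - by rewrite adjC.
  - by rewrite ip ?/consecutive; slia.
  - by rewrite adjC hmin //; slia.
  rewrite /= !inE negb_or !nwe ?nthN //; slia.
have rest i : i < size e -> i != h -> i != h.+1 -> ~~ adj w (nth x0 e i).
  move=> il ih ih1; have [lt|ge] := ltnP i h; first exact: hmin.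
  apply/negP => wi; suff : adj (nth x0 e h) (nth x0 e i).
    by rewrite ip ?/consecutive //; slia.
  apply: (cfG w w') => //; rewrite ?nw' ?nthe //.
  by rewrite /= !inE negb_or !(eq_sym w') !nwe' ?nthN //; slia.
exists h; split=> //; rewrite ltn_neqAle h1 andbT.
by apply: contraNneq wl => E; rewrite -nth_last -E.
Qed.
End InducedPathTheory.

(** * A triangle with three legs, ending in [D] and at the two next vertices *)

Section FrontierNets.
Variable G : sgraph.
Implicit Types (x y u v : G) (s A B P H : seq G) (D : {set G}).
Hypothesis cfG : claw_free G.

Section Reach.
Variables (D : {set G}) (u v : G) (A B P : seq G) (d d' a z b w : G).
Hypotheses (cf : config D u v A B) (lk : link D u v P d d')
  (eA : ends u v A a z) (eB : ends u v B b w).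
Variables (A1 B1 Ha Hb : seq G).
Hypothesis mf : max_frontier D u A B A1 B1 Ha Hb.
Variables (xA : G) (A3 : seq G) (xB : G) (B3 : seq G).
Hypotheses (EA : A = A1 ++ xA :: A3) (EB : B = B1 ++ xB :: B3).

(** This is [Hb] with the neighbours of [xA] cut out. *)
Lemma reach_lastB : exists p, [/\ path adj u p, last u p = last u B1 &
  {subset p <= [pred c in A1 ++ B1 | ~~ adj xA c]}].
Proof.
case: (mf) => [[_ _ _ B0 _ Hbp _ pb _] _].
have [s [EH us ls]] := Hbp.
have uu : ~~ adj xA u := frontier_nadj_u cfG cf lk eA eB mf EA EB.
have ul : ~~ adj xA (last u s) by rewrite ls; apply: (lastB_nadj cfG cf lk eA eB mf EA EB).
have [||p l] := filter_path us uu ul.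
- move=> s1 g y s2 E; have EH' : Hb = s1 ++ g :: y :: s2 by rewrite EH.
  exact: (no_insertion cf lk eA eB mf EA EB EH').
- move=> s1 g y g' s2 E xy.
  have yL : y \in u :: A1 ++ B1.
    by rewrite -(memHb mf) EH E mem_cat !inE eqxx !orbT.
  have := left_uniq cf EA EB; rewrite cat_uniq => /and3P[uL _ _].
  have uH : uniq Hb by rewrite (perm_uniq pb).
  have [s3 [h [h' [s4 [E2 hh _ _]]]]] := skip_X cfG cf lk eA eB mf EA EB yL xy.
  (* [Hb] has no repetition, so [y] determines where it is split, and the vertices [h], [h'] from
     [skip_X] are [g], [g']. *)
  have E3 : rcons s1 g ++ y :: g' :: s2 = rcons s3 h ++ y :: h' :: s4.
    by rewrite !cat_rcons -E -EH.
  have ny (r r' : seq G) : Hb = r ++ y :: r' -> size r = index y Hb.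
    move=> E'; rewrite E' index_cat /= eqxx addn0.
    by have := uH; rewrite E' cat_uniq => /and3P[_ /norP[/negbTE -> _] _].
  have /eqP := E3; rewrite eqseq_cat; last first.
    by rewrite (ny _ (g' :: s2)) ?(ny _ (h' :: s4)) // ?cat_rcons // EH E.
  by rewrite eqseq_rcons => /andP[/andP[_ /eqP ->] /eqP[-> _]].
exists (filter (predC (adj xA)) s); split=> //; first by rewrite l ls.
move=> c; rewrite mem_filter => /andP[/= xc cs]; rewrite inE /= xc andbT.
have := perm_mem pb c; rewrite EH !inE cs orbT => /esym/orP[/eqP cu|//].
have := left_uniq cf EA EB; rewrite cat_uniq => /and3P[uL _ _].
move: uL; rewrite -(perm_uniq pb) EH /= -cu cs.
by [].
Qed.
End Reach.

Section Net.
Variables (D : {set G}) (u v : G) (A B P : seq G) (d d' a z b w : G).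
Hypotheses (cf : config D u v A B) (lk : link D u v P d d')
  (eA : ends u v A a z) (eB : ends u v B b w).
Variables (A1 B1 Ha Hb : seq G).
Hypothesis mf : max_frontier D u A B A1 B1 Ha Hb.
Variables (xA : G) (A3 : seq G) (xB : G) (B3 : seq G).
Hypotheses (EA : A = A1 ++ xA :: A3) (EB : B = B1 ++ xB :: B3).
Let mfs := max_frontier_swap mf.
Let scf := config_swap cf.

Let memsw x : (x \in B1 ++ A1) = (x \in A1 ++ B1).
Proof. by rewrite !mem_cat orbC. Qed.

(** [e] runs from [D] through [u] to [xA], and [r] leads from [xB] to the first vertex [y] that sees
    [e]. Since [q] avoids the neighbours of [xB] and [r] those of [xA], [claw_path_attach] applies
    to [y] and gives a triangle on an inner edge of [e]; the rest of [e] and [r] are its legs. *)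
Lemma frontier_net : exists q r h, let e := d :: u :: rcons q xA in
  let y := last xB r in
  [/\ induced_path e /\ 0 < size q,
      induced_path (xB :: r) /\ 0 < size r,
      (forall c, c \in q -> c \in A1 ++ B1) /\ (forall c, c \in r -> c \in A1 ++ B1),
      (forall i, i < size r -> forall c, c \in e -> ~~ adj (nth xB (xB :: r) i) c) &
      [/\ 0 < h, h.+2 < size e, adj y (nth u e h), adj y (nth u e h.+1) &
      forall i, i < size e -> i != h -> i != h.+1 -> ~~ adj y (nth u e i)]].
Proof.
have farA : far D xA by exact: (frontier_far cf lk eA eB mf EA EB).
have farB : far D xB by exact: (frontier_far scf lk eB eA mfs EB EA).
have nAB : ~~ adj xA xB := frontier_nadj cf lk eA eB mf EA EB.
have nAu := frontier_nadj_u cfG cf lk eA eB mf EA EB.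
have nBu := frontier_nadj_u cfG scf lk eB eA mfs EB EA.
have [Al _ _] := rest_pathA cf eA EA; have [Bl _ _] := rest_pathB cf eB EB.
have dD : d \in D by case: lk => Pp _ _ _ PD; apply: PD (pth_head Pp).
have ud : adj u d by case: lk.
have fL c : c \in A1 ++ B1 -> far D c by exact: (left_far mf).
have uL : u \notin A1 ++ B1.
  by have := left_uniq cf EA EB; rewrite cat_uniq => /andP[/andP[]].
have nA c : c \in A1 ++ B1 -> c != xA.
  by move=> cL; apply: (left_neq cf EA EB); rewrite inE cL orbT.
have nB c : c \in A1 ++ B1 -> c != xB.
  by move=> cL; apply: (left_neq scf EB EA); rewrite inE memsw cL orbT.
have uA : u != xA by apply: (left_neq cf EA EB); rewrite inE eqxx.
have uB : u != xB by apply: (left_neq scf EB EA); rewrite inE eqxx.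
have xAB : xA != xB.
  by apply: (config_neqAB cf); rewrite ?EA ?EB mem_cat inE eqxx orbT.
have [p [up lp ps]] := reach_lastB scf lk eB eA mfs EB EA.
have [||q [[uq uqq] qs ql qmin qi]] := @shortest_path G
  [pred c in A1 ++ B1 | ~~ adj xB c] (adj xA) u p up.
- by apply/allP => c /ps; rewrite !inE memsw.
- by rewrite lp adjC.
have qL c : c \in q -> c \in A1 ++ B1 by move/(allP qs) => /andP[].
have qB c : c \in q -> ~~ adj xB c by move/(allP qs) => /andP[].
have q0 : 0 < size q by case: (q) ql => //=; rewrite (negbTE nAu).
have nqA c : c \in belast u q -> ~~ adj c xA.
  move=> /(nthP u)[i]; rewrite size_belast => iq <-; rewrite adjC.
  suff -> : nth u (belast u q) i = nth u (u :: q) i by apply: qmin.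
  by rewrite [in RHS]lastI nth_rcons size_belast iq.
have ie : induced_path (d :: u :: rcons q xA).
  have E : u :: rcons q xA = rcons (rcons (belast u q) (last u q)) xA.
    by rewrite -lastI.
  apply: induced_path_cons; rewrite 1?adjC //.
    rewrite E; apply: induced_path_rcons; rewrite -?lastI //; first by rewrite adjC.
    by apply/allP.
  rewrite all_rcons (far_adjC farA) //; apply/allP => c /qL /fL fc; exact: far_adjC fc _.
have [p' [up' lp' ps']] := reach_lastB cf lk eA eB mf EA EB.
(* [t] continues from [xB] back to [u]. It is cut at the first vertex that sees [u :: q]; one exists
   because [u] sees the first vertex of [q]. *)
pose T c := has (adj c) (u :: q).
pose t := rev (u :: p').
have tp : path adj xB t.
  have := rev_path adj u p'; rewrite lp' => pr.
  rewrite /t lastI rev_rcons lp' /= adjC Bl /= pr.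
  by apply: sub_path up' => c c' /=; rewrite adjC.
have qu : adj u (head u q).
  by case: (q) uq q0 => //= c q' /andP[].
have Tu : T u.
  by apply/hasP; exists (head u q) => //; rewrite inE; case: (q) q0 => //= *; rewrite inE eqxx orbT.
have TB : ~~ T xB by rewrite /T /= negb_or nBu; apply/hasPn.
have ht : has T t by apply/hasP; exists u => //; rewrite mem_rev inE eqxx.
pose k := find T t; have kt : k < size t by rewrite -has_find.
have [|||r [[xr ur] rs rl rmin ri]] := @shortest_path G
  [pred c in A1 ++ B1 | ~~ adj xA c && (c \notin u :: q)] T xB (take k.+1 t).
- exact: path_take.
- apply/(all_nthP u) => i; rewrite size_takel // ltnS => ik.
  rewrite nth_take //; set c := nth u t i.
  (* A vertex of [t] on [u :: q] would make the vertex before it, or [xB], satisfy [T] already. *)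
  have cq : c \notin u :: q.
    case: i ik @c => [|i] ik c.
      apply: contra TB => cq; apply/hasP; exists c => //.
      by move: tp; rewrite /c; case: (t) kt => //= y0 t' _ /andP[].
    have := before_find u (ik : i < find T t); apply: contraFN => cq.
    apply/hasP; exists c => //.
    by move/(pathP u): tp => /(_ i.+1); rewrite /= /c; apply; slia.
  have : c \in t by apply: mem_nth; apply: leq_ltn_trans ik kt.
  rewrite mem_rev in_cons; move: (cq); rewrite in_cons => /norP[/negbTE -> _] /= cp'.
  have := ps' _ cp'; rewrite inE => /andP[c1 c2].
  by rewrite inE; apply/and3P; split.
- by rewrite last_take //= nth_find.
have rL c : c \in r -> c \in A1 ++ B1 by move/(allP rs) => /andP[].
have rA c : c \in r -> ~~ adj xA c by move/(allP rs) => /and3P[].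
have rq c : c \in r -> c \notin u :: q by move/(allP rs) => /and3P[].
have r0 : 0 < size r by case: (r) rl => //=; rewrite (negbTE TB).
have ce i : i < size r -> forall c, c \in d :: u :: rcons q xA ->
    ~~ adj (nth xB (xB :: r) i) c.
  move=> ir; have nT := rmin i ir; set y := nth xB (xB :: r) i in nT *.
  have [yf yA] : far D y /\ ~~ adj y xA.
    case: i ir @y nT => [|i] ir y nT; first by rewrite adjC.
    have yr : y \in r by apply: mem_nth; apply: ltnW.
    by split; [apply/fL/rL|rewrite adjC rA].
  move=> c; rewrite !inE mem_rcons inE => /or4P[/eqP->|/eqP->|/eqP->|cq] //.
  - exact: far_adj yf _.
  - by apply: contra nT => yu; rewrite /T /= yu.
  - by apply: contra nT => yc; apply/hasP; exists c => //; rewrite inE cq orbT.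
pose y := last xB r; pose y' := nth xB (xB :: r) (size r).-1.
have yr : y \in r by rewrite /y; case: (r) r0 => //= *; rewrite mem_last.
have yy' : adj y y'.
  rewrite /y (last_nth xB) ri /= ?ltnS ?leqnn //; last by slia.
  by rewrite /consecutive; slia.
have y'L : (y' == xB) || (y' \in r).
  by rewrite -in_cons; apply: mem_nth; rewrite /= ltnS; apply: leq_pred.
have y'e : y' \notin d :: u :: rcons q xA.
  rewrite !inE mem_rcons inE !negb_or; case/orP: y'L => [/eqP ->|y'r].
    rewrite !(eq_sym xB) (far_neq farB) // uB xAB /=.
    by apply/negP => /qL /nB; rewrite eqxx.
  have := rq _ y'r; rewrite inE negb_or => /andP[-> ->].
  by rewrite eq_sym (far_neq (fL _ (rL _ y'r))) // nA // rL.
have ye : y \notin d :: u :: rcons q xA.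
  have := rq _ yr; rewrite !inE mem_rcons inE !negb_or => /andP[-> ->].
  by rewrite eq_sym (far_neq (fL _ (rL _ yr))) // nA // rL.
have ue : uniq (d :: u :: rcons q xA).
  rewrite cons_uniq -rcons_cons rcons_uniq uqq andbT.
  rewrite mem_rcons !inE !negb_or (far_neq farA) // (eq_sym xA) uA.
  have -> : d != u by apply: contraTneq ud => ->; rewrite adj_irrefl.
  have -> : d \notin q.
    by apply/negP => /qL /fL /andP[]; rewrite dD.
  by apply/negP => /qL /nA; rewrite eqxx.
have hy : has (adj y) (d :: u :: rcons q xA).
  have /hasP[c cq yc] := rl; apply/hasP; exists c => //.
  by move: cq; rewrite !inE mem_rcons inE => /orP[->|->]; rewrite !orbT.
have yd : ~~ adj y d by apply: far_adj dD; apply/fL/rL.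
have yA : ~~ adj y (last u (d :: u :: rcons q xA)).
  by rewrite /= last_rcons adjC rA.
have y'N : all (fun c => ~~ adj y' c) (d :: u :: rcons q xA).
  by apply/allP => c cL; apply: ce cL; slia.
have [h [h0 h2 yh yh1 hrest]] := claw_path_attach (x0 := u) cfG ie ue ye hy yd yA yy' y'N y'e.
by exists q, r, h; split=> //; split.
Qed.
End Net.
End FrontierNets.

(** * The nets N(1,1,1) and B(1,2) *)

Section NetTheorems.
Variable G : sgraph.
Implicit Types (x y u v : G) (s A B P H : seq G) (D : {set G}).
Hypothesis cfG : claw_free G.

Lemma max_frontier_config D u v A B P d d' a z b w :
  config D u v A B -> link D u v P d d' -> ends u v A a z -> ends u v B b w ->
  exists A1 B1 Ha Hb xA A3 xB B3, [/\ max_frontier D u A B A1 B1 Ha Hb,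
    A = A1 ++ xA :: A3 & B = B1 ++ xB :: B3].
Proof.
move=> cf lk eA eB; have [A1 [B1 [Ha [Hb fr]]]] := frontier_start cfG cf lk eA eB.
have {A1 B1 Ha Hb fr} [A1 [B1 [Ha [Hb mf]]]] := max_frontier_exists fr.
have [xA [A3 EA]] := frontier_rest cf lk mf.
have [xB [B3 EB]] := frontier_rest (config_swap cf) lk (max_frontier_swap mf).
by exists A1, B1, Ha, Hb, xA, A3, xB, B3.
Qed.

Lemma config_N111 D u v A B P d d' : config D u v A B -> link D u v P d d' ->
  contains_induced G (N_graph 1 1 1).
Proof.
move=> cf lk; have [a [z eA]] := config_endsA cf lk; have [b [w eB]] := config_endsB cf lk.
have [A1 [B1 [Ha [Hb [xA [A3 [xB [B3 [mf EA EB]]]]]]]]] := max_frontier_config cf lk eA eB.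
have [q [r [h [[ie q0] [ir r0] _ rN [h0 h2 yh yh1 yN]]]]] := frontier_net cfG cf lk eA eB mf EA EB.
move: ie rN h2 yh yh1 yN; set e := d :: _; set y := last xB r => ie rN h2 yh yh1 yN.
have e1 : h < size e by slia.
have e2 : h.+1 < size e by slia.
have e3 : h.-1 < size e by slia.
have adjE i j : i < size e -> j < size e ->
  adj (nth u e i) (nth u e j) = consecutive i j by move=> *; apply: ie.
have rN' i : i < size e -> ~~ adj (nth xB (xB :: r) (size r).-1) (nth u e i).
  by move=> ie'; apply: rN; [slia|apply: mem_nth].
apply: (contains_N111 (a := nth u e h) (b := nth u e h.+1) (c := y)
  (p := nth u e h.-1) (q := nth u e h.+2) (r := nth xB (xB :: r) (size r).-1)).
- by rewrite adjE // /consecutive; slia.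
- by rewrite adjC.
- by rewrite adjC.
- by rewrite adjE // /consecutive; slia.
- by rewrite adjE // /consecutive; slia.
- by rewrite /y (last_nth xB) ir /= ?/consecutive; slia.
- by rewrite adjE // /consecutive; slia.
- by rewrite adjC rN'.
- by rewrite adjE // /consecutive; slia.
- by rewrite adjC rN'.
- by rewrite yN //; slia.
- by rewrite yN //; slia.
- by rewrite adjE // /consecutive; slia.
- by rewrite adjC rN'.
- by rewrite adjC rN'.
Qed.

Lemma config_neqA D u v A B x : config D u v A B -> x \in A -> (x != u) && (x != v).
Proof.
move=> cf xA; have := config_uniq cf; rewrite !cons_uniq !inE !mem_cat !negb_or.
case/and3P=> /and3P[_ uA _] /andP[vA _] _.
apply/andP; split; first by apply: contraNneq uA => <-.
by apply: contraNneq vA => <-.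
Qed.

Lemma config_notin D u v A B : config D u v A B -> (u \notin D) && (v \notin D).
Proof.
move=> cf; apply/andP; split; apply/negP => /(config_disj cf);
  by rewrite !inE eqxx ?orbT.
Qed.

(** Among the neighbours [a], [v] and [e] of [u], the vertex [a] sees neither of the others. *)
Lemma claw_common D u v A B P d d' : config D u v A B -> link D u v P d d' ->
  adj u v -> forall e, e \in D -> adj u e -> adj v e.
Proof.
move=> cf lk uv e eD ue.
have [a [z eA]] := config_endsA cf lk; have [b [w eB]] := config_endsB cf lk.
have va : ~~ adj v a.
  exact: (claw_far_end cfG (config_swap (config_flip cf)) (link_flip lk)
    (ends_rev eB) (ends_rev eA)).
have fa := first_far cf lk eA; have /andP[_ av] := config_neqA cf (pth_head (ends_pth eA)).
have /andP[_ vD] := config_notin cf.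
case: eA => _ ua _; apply: (cfG ua uv ue) => //; first by rewrite adjC.
  exact: far_adj fa eD.
rewrite /= !inE negb_or (eq_sym a e) (far_neq fa eD) av /= andbT.
by apply: contraNneq vD => ->.
Qed.

Lemma link_induced D u v A B P d d' : config D u v A B -> link D u v P d d' -> u != v ->
  exists q, [/\ induced_path (u :: q), uniq (u :: q), 0 < size q, last u q = v &
    forall i, i.+1 < size q -> nth u q i \in D].
Proof.
move=> cf [Pp ud dv Pu PD] uv.
have up : path adj u (rcons P v).
  by case: Pp dv => p [-> dp <-] dv /=; rewrite ud rcons_path dp dv.
have [||q [[uq uqq] qS /eqP ql qm qi]] := @shortest_path G
  [pred c | (c \in D) || (c == v)] (pred1 v) u (rcons P v) up.
- by apply/allP => c; rewrite mem_rcons inE => /orP[/eqP ->|/PD cD]; rewrite inE ?eqxx ?orbT ?cD.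
- by rewrite last_rcons /=.
exists q; split=> //; first by case: (q) ql => //= /eqP; rewrite (negbTE uv).
move=> i iq; have := qm i.+1 iq; rewrite /= => nv.
by have /allP/(_ _ (mem_nth u (ltnW iq))) := qS; rewrite inE (negbTE nv) orbF.
Qed.

(** A leg with two vertices already gives the graph. If all legs are single vertices, the triangle
    is [u], [x], [y0] with pendant vertices [d], [xA], [xB], and a longer leg at [u] has to be found
    through [D] towards [v]. *)
Lemma config_B12 D u v A B P d d' : config D u v A B -> link D u v P d d' ->
  contains_induced G (B_graph 1 2).
Proof.
move=> cf lk; have [a [z eA]] := config_endsA cf lk; have [b [w eB]] := config_endsB cf lk.
have [A1 [B1 [Ha [Hb [xA [A3 [xB [B3 [mf EA EB]]]]]]]]] := max_frontier_config cf lk eA eB.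
have mfs := max_frontier_swap mf; have scf := config_swap cf.
have [q [r [h [[ie q0] [ir r0] [qL rL] rN [h0 h2 yh yh1 yN]]]]] :=
  frontier_net cfG cf lk eA eB mf EA EB.
move: ie rN h2 yh yh1 yN; set e := d :: _; set y := last xB r => ie rN h2 yh yh1 yN.
have se : size e = (size q).+3 by rewrite /= size_rcons.
have e1 : h < size e by slia.
have e2 : h.+1 < size e by slia.
have e3 : h.-1 < size e by slia.
have e4 : h.-2 < size e by slia.
have adjE i j : i < size e -> j < size e ->
  adj (nth u e i) (nth u e j) = consecutive i j by move=> *; apply: ie.
have rN' j i : j < size r -> i < size e -> ~~ adj (nth xB (xB :: r) j) (nth u e i).
  by move=> jr ie'; apply: rN => //; apply: mem_nth.
have yy1 : adj y (nth xB (xB :: r) (size r).-1).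
  by rewrite /y (last_nth xB) ir /= ?/consecutive; slia.
have r1 : (size r).-1 < size r by slia.
have r2 : (size r).-2 < size r by slia.
have [hh|hh] := ltnP 1 h.
  apply: (contains_B12 (a := nth u e h.+1) (b := nth u e h) (c := y)
    (p := nth u e h.+2) (q1 := nth u e h.-1) (q2 := nth u e h.-2));
  try (by rewrite adjE // /consecutive; slia).
  - by rewrite adjC.
  - by rewrite adjC.
  - by rewrite yN //; slia.
  - by rewrite yN //; slia.
  - by rewrite yN //; slia.
have [hs|hs] := ltnP h.+3 (size e).
  apply: (contains_B12 (a := nth u e h) (b := nth u e h.+1) (c := y)
    (p := nth u e h.-1) (q1 := nth u e h.+2) (q2 := nth u e h.+3));
  try (by rewrite adjE // /consecutive; slia).
  - by rewrite adjC.
  - by rewrite adjC.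
  - by rewrite yN //; slia.
  - by rewrite yN //; slia.
  - by rewrite yN //; slia.
have [rs|rs] := ltnP 1 (size r).
  apply: (contains_B12 (a := nth u e h) (b := y) (c := nth u e h.+1)
    (p := nth u e h.-1) (q1 := nth xB (xB :: r) (size r).-1)
    (q2 := nth xB (xB :: r) (size r).-2));
  try (by rewrite adjE // /consecutive; slia); try (by rewrite adjC rN').
  - by rewrite adjC.
  - by [].
  - by [].
  - by rewrite ir /= ?/consecutive; slia.
  - by rewrite yN //; slia.
  - by rewrite /y (last_nth xB) ir /= ?/consecutive; slia.
have h1 : h = 1 by slia.
have q1 : size q = 1 by slia.
have rs1 : size r = 1 by slia.
case: q q1 {q0} @e se ie qL rN h2 yh yh1 yN e1 e2 e3 e4 adjE rN' hs => [//|x [|//]] _ e se ie qL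
  rN h2 yh yh1 yN e1 e2 e3 e4 adjE rN' hs.
case: r rs1 @y {r0 rs r1 r2} ir rL rN yh yh1 yN rN' yy1 => [//|y0 [|//]] _ y ir rL rN yh yh1 yN rN' yy1.
rewrite {}/y /= in yh yh1 yN yy1; rewrite h1 /= in yh yh1.
have xL : x \in A1 ++ B1 by apply: qL; rewrite inE eqxx.
have yL : y0 \in A1 ++ B1 by apply: rL; rewrite inE eqxx.
have ux : adj u x by have := adjE 1 2 isT isT.
have xxA : adj xA x by have := adjE 3 2 isT isT.
have uxA : ~~ adj u xA by have := adjE 1 3 isT isT => /= ->.
have yxB : adj xB y0 by rewrite adjC.
have yxA : ~~ adj y0 xA by have := yN 3 isT; rewrite h1 /= => ->.
have xL' : x \in u :: A1 ++ B1 by rewrite inE xL orbT.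
have yL' : y0 \in u :: B1 ++ A1 by move: yL; rewrite inE !mem_cat orbC => ->; rewrite orbT.
have vx := X_nadj_v cfG cf lk eA eB mf EA EB xL' xxA.
have vy := X_nadj_v cfG scf lk eB eA mfs EB EA yL' yxB.
have xw := X_nadj_last cfG cf lk eA eB mf EA EB xL' xxA.
have vxA := frontier_nadj_v cfG cf lk eA eB mf EA EB.
have xAw := frontier_nadj_last cf lk eA eB mf EA EB.
have farA : far D xA by exact: (frontier_far cf lk eA eB mf EA EB).
have dD : d \in D by case: lk => Pp _ _ _ PD; apply: PD (pth_head Pp).
have fx : far D x := left_far mf xL.
have fy : far D y0 := left_far mf yL.
have fw := last_far scf lk eB.
have uw := claw_far_end cfG cf lk eA eB.
have ud : adj u d by case: lk.
have wv : adj w v by case: eB.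
(* With the edge [u v] the triangle becomes [v], [u], [d], with [w] at [v] and the leg [x], [xA] at
   [u]. *)
have [uv|nuv] := boolP (adj u v).
  have vd := claw_common cf lk uv dD ud.
  apply: (contains_B12 (a := v) (b := u) (c := d) (p := w) (q1 := x) (q2 := xA)) => //;
    try adjs; by [apply: far_adjC dD|rewrite adjC; apply: far_adjC dD].
have uv : u != v by have := config_uniq cf; rewrite cons_uniq inE => /andP[/norP[]].
have [q' [qi qu q'0 ql qD]] := link_induced cf lk uv.
have qE i j : i <= size q' -> j <= size q' ->
  adj (nth u (u :: q') i) (nth u (u :: q') j) = consecutive i j by move=> *; apply: qi.
have q2 : 1 < size q'.
  rewrite ltn_neqAle q'0 andbT; apply: contraNneq nuv => q1.
  by have := qE 0 1 isT q'0; move: q1 ql; case: (q') => [|? [|]] //= _ ->.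
have c0 : nth u q' 0 \in D by apply: qD.
have u0 : adj u (nth u q' 0) by have := qE 0 1 isT q'0.
have u1 : ~~ adj u (nth u q' 1) by have := qE 0 2 isT q2 => /= ->.
have c01 : adj (nth u q' 0) (nth u q' 1) by have := qE 1 2 q'0 q2.
(* The second vertex of the new leg may be [v]; this is where the nonadjacencies to [v] enter. *)
have c1 : (nth u q' 1 \in D) || (nth u q' 1 == v).
  have [lt|ge] := ltnP 2 (size q'); first by rewrite qD.
  have E : size q' = 2 by slia.
  by rewrite -ql (last_nth u) E /= eqxx orbT.
have far1 c : far D c -> ~~ adj v c -> ~~ adj c (nth u q' 1).
  by move=> fc vc; case/orP: c1 => [cD|/eqP ->]; [exact: far_adj fc cD|rewrite adjC].
apply: (contains_B12 (a := x) (b := u) (c := y0) (p := xA)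
  (q1 := nth u q' 0) (q2 := nth u q' 1)) => //; try adjs; try (by apply: far1); exact: far_adj c0.
Qed.
End NetTheorems.

(** * Configurations with a shortest side *)

Lemma last_split (T : Type) (p : pred T) s : has p s ->
  exists s1 x s2, [/\ s = s1 ++ x :: s2, p x & all (predC p) s2].
Proof.
elim: s => //= y s IH; have [hs _|] := boolP (has p s).
  by have [s1 [x [s2 [-> px ps2]]]] := IH hs; exists (y :: s1), x, s2.
by rewrite -all_predC orbF => ns py; exists [::], y, s.
Qed.

Section MinConfig.
Variable G : sgraph.
Implicit Types (x y u v e g : G) (s A B P H : seq G) (D : {set G}).

Lemma config_uniqA D u v A B : config D u v A B -> uniq A.
Proof.
by move/config_uniq; rewrite !cons_uniq cat_uniq => /and3P[_ _ /andP[]].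
Qed.

Lemma uniq_across s s' g x g' : uniq (s ++ [:: g, x, g' & s']) -> g != g'.
Proof. by rewrite cat_uniq /= !inE !negb_or => /and3P[_ _ /andP[/and3P[_ -> _] _]]. Qed.

Lemma pth_path x y s s' : pth x y s -> s = x :: rcons s' y -> path adj x (rcons s' y).
Proof. by case=> p [-> xp _] [<-]. Qed.

Lemma config_perm D u v A B u' v' A' B' : config D u v A B ->
  perm_eq (u' :: v' :: A' ++ B') (u :: v :: A ++ B) ->
  path adj u' (rcons A' v') -> path adj u' (rcons B' v') ->
  config D u' v' A' B'.
Proof.
move=> [pA pB un dj cn cl lg] E pA' pB'; split=> //.
- by rewrite (perm_uniq E).
- by move=> d; rewrite (perm_mem E); apply: dj.
- by move=> d w; rewrite (perm_mem E); apply: cl.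
move=> x y s xys us yx s2; apply: leq_trans (lg x y s xys us yx s2) _.
by have := perm_size E; rewrite /= !size_cat; slia.
Qed.

(** The minimum ranges over all longest cycles with [D] as a component of the rest, not only over
    pairs on one cycle, so that rerouting can be used to shorten [B]. *)
Record min_config D u v A B P d d' : Prop := MinConfig {
  mc_config : config D u v A B;
  mc_link : link D u v P d d';
  mc_size : 1 < size P;
  mc_min : forall u' v' A' B' P' e e', config D u' v' A' B' ->
    link D u' v' P' e e' -> 1 < size P' -> size B <= size B' }.

Lemma min_config_exists D u v A B P d d' : config D u v A B ->
  link D u v P d d' -> 1 < size P ->
  exists u v A B P d d', min_config D u v A B P d d'.
Proof.
have [n] := ubnP (size B); elim: n u v A B P d d' => // n IH u v A B P d d' le cf lk P1.
have [[u' [v' [A' [B' [P' [e [e' [cf' lk' P1' lt]]]]]]]]|no] :=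
  Classical_Prop.classic (exists u' v' A' B' P' e e', [/\ config D u' v' A' B',
    link D u' v' P' e e', 1 < size P' & size B' < size B]).
  by apply: (IH _ _ _ _ _ _ _ _ cf' lk' P1'); slia.
exists u, v, A, B, P, d, d'; split=> // u' v' A' B' P' e e' cf' lk' P1'.
by rewrite leqNgt; apply/negP => lt; apply: no; exists u', v', A', B', P', e, e'.
Qed.

Lemma min_config_flip D u v A B P d d' : min_config D u v A B P d d' ->
  min_config D v u (rev A) (rev B) (rev P) d' d.
Proof.
case=> cf lk P1 mn; split; rewrite ?size_rev //; first exact: config_flip.
  exact: link_flip.
Qed.

Lemma link_far D x y d e : d \in D -> e \in D -> adj x d -> adj y e -> d != e ->
  (forall d d', d \in D -> d' \in D ->
    exists Q, [/\ pth d d' Q, uniq Q & {subset Q <= D}]) ->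
  exists2 Q, link D x y Q d e & 1 < size Q.
Proof.
move=> dD eD xd ye de cn; have [Q [Qp Qu QD]] := cn _ _ dD eD.
exists Q; first by split=> //; rewrite adjC.
case: Qp de => [[|q s] [-> _ <-]] //=; by rewrite eqxx.
Qed.

Section Facts.
Variables (D : {set G}) (u v : G) (A B P : seq G) (d d' a z b w : G).
Hypotheses (mc : min_config D u v A B P d d')
  (eA : ends u v A a z) (eB : ends u v B b w).
Let cf := mc_config mc.
Let lk := mc_link mc.

(** A neighbour [e] of [x] in [D] differs from [d] or from [d']; accordingly [u], [x] or [x], [v]
    has a link with two vertices and a shorter side. *)
Lemma min_config_far x : x \in B -> far D x.
Proof.
move=> xB; rewrite /far (config_inA (config_swap cf) xB) /=.
apply/attP => -[e eD xe].
have [s1 [s2 EB]] : exists s1 s2, B = s1 ++ x :: s2.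
  by case/path.splitPr: xB => s1 s2; exists s1, s2.
have cf' := cf; rewrite EB in cf'.
case: (eA) => Ap ua zv; case: (lk) => Pp ud dv Pu PD.
have dD := PD _ (pth_head Pp); have d'D := PD _ (pth_last Pp).
have dd' : d != d'.
  have := mc_size mc; case: Pp Pu => [[|q s] [-> _ <-]] //= /andP[dq _] _.
  by apply: contraNneq dq => {1}->; rewrite mem_last.
have := config_pth (config_swap cf'); rewrite rcons_cat -cat_cons.
move=> /(@pth_split _ _ _ x (u :: s1))[p1 p2].
have [ed|ed] := eqVneq d e; last first.
  have [Q lQ Q1] := link_far dD eD ud xe ed (config_conn cf).
  have cfn : config D u x (A ++ v :: rev s2) s1.
    apply: (config_perm cf'); first by perms.
      have pp : pth u x ([:: u] ++ A ++ rev (x :: rcons s2 v)) by pths.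
      by apply: (pth_path pp); rewrite rev_cons rev_rcons -rcons_cat.
    by apply: (pth_path p1).
  by have := mc_min mc cfn lQ Q1; rewrite EB size_cat /=; slia.
have vd' : adj v d' by rewrite adjC.
have [Q lQ Q1] : exists2 Q, link D x v Q e d' & 1 < size Q.
  by apply: link_far => //; [rewrite -ed|exact: config_conn cf].
have cfn : config D x v (rev s1 ++ u :: A) s2.
  apply: (config_perm cf'); first by perms.
    have pp : pth x v (rev (rcons (u :: s1) x) ++ A ++ [:: v]) by pths.
    by apply: (pth_path pp); rewrite rev_rcons rev_cons /= cat_rcons rcons_cat /= cats1.
  exact: (pth_path p2).
by have := mc_min mc cfn lQ Q1; rewrite EB size_cat /=; slia.
Qed.

Section ClawFree.
Hypothesis cfG : claw_free G.

(* Otherwise x, or u together with an initial part of B, can be moved to the side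
   of A, which shortens B. *)
Lemma min_config_nadj x : x \in B -> x != b -> ~~ adj u x.
Proof.
move=> xB xb; apply/negP => ux.
have uw := claw_far_end cfG cf lk eA eB; have ab := claw_first cfG cf lk eA eB.
have fx := min_config_far xB; have fa := first_far cf lk eA.
have xw : x != w by apply: contraNneq uw => <-.
have [s1 [s2 EB]] : exists s1 s2, B = s1 ++ x :: s2.
  by case/path.splitPr: xB => s1 s2; exists s1, s2.
case: eB => Bp ub wv; case/lastP: s1 EB => [|s1 g] EB.
  by have := Bp; rewrite EB => /pth_consE bx; rewrite bx eqxx in xb.
case: s2 EB => [|g' s2] EB.
  by have := Bp; rewrite EB cats1 => /pth_rconsE wx; rewrite wx eqxx in xw.
rewrite cat_rcons in EB; have cf' := cf; rewrite EB in cf'.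
case: (eA) (lk) => Ap ua zv [Pp ud dv Pu PD].
have := Bp; rewrite EB => /pth_split2[p1 gx p2].
have := Bp; rewrite EB -cat_rcons => /pth_split2[p3 xg' p4].
have le (A' B' : seq G) : perm_eq (u :: v :: A' ++ B') (u :: v :: A ++ s1 ++ [:: g, x, g' & s2]) ->
    pth u v ([:: u] ++ A' ++ [:: v]) -> pth u v ([:: u] ++ B' ++ [:: v]) -> size B <= size B'.
  move=> E pA pB; apply: (mc_min mc (A' := A') _ lk (mc_size mc)).
  by apply: (config_perm cf' E); [apply: (pth_path pA)|apply: (pth_path pB)]; rewrite -cats1.
have sB : size B = (size s1 + size s2).+3 by rewrite EB size_cat /=; slia.
have [ug'|ug'] := boolP (adj u g').
  have : size B <= size (g' :: s2).
    apply: (le (rev (rcons (rcons s1 g) x) ++ A)); [by perms| |by pths].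
    by rewrite -!catA; pths.
  by rewrite sB /=; slia.
have [ug|ug] := boolP (adj u g).
  have : size B <= size [:: x, g' & s2].
    apply: (le (rev (rcons s1 g) ++ A)); [by perms| |by pths].
    by rewrite -!catA; pths.
  by rewrite sB /=; slia.
have gg' : adj g g'.
  apply: (cfG (c := x) (x := u)); try adjs.
  have /andP[gu _] : (g != u) && (g != v).
    by apply: (config_neqA (config_swap cf)); rewrite EB mem_cat inE eqxx orbT.
  have /andP[g'u _] : (g' != u) && (g' != v).
    by apply: (config_neqA (config_swap cf)); rewrite EB mem_cat !inE eqxx !orbT.
  have gg' : g != g' by have := config_uniqA (config_swap cf); rewrite EB => /uniq_across.
  by rewrite /= !inE negb_or !(eq_sym u) gu g'u gg'.
have xa : adj x a.
  have dD : d \in D by apply: PD (pth_head Pp).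
  apply: (claw_far cfG ud dD ux ua fx fa).
  by rewrite eq_sym (config_neqAB cf (pth_head Ap) xB).
have : size B <= size (rcons s1 g ++ g' :: s2).
  apply: (le (x :: A)); first by perms.
    by rewrite -[x :: A]/([:: x] ++ A) -!catA; pths.
  by rewrite -!catA; pths.
by rewrite sB size_cat size_rcons /=; slia.
Qed.
End ClawFree.
End Facts.
End MinConfig.

(** * The claw and Z(4): the structure of the shortest side *)

Section Z4.
Variable G : sgraph.
Implicit Types (x y t u v e g : G) (s A B P H : seq G) (D : {set G}).
Hypothesis cfG : claw_free G.

Record inner D u v A B P d d' a z b w M b2 c2 : Prop := Inner {
  in_mc : min_config D u v A B P d d';
  in_A : ends u v A a z;
  in_B : ends u v B b w;
  in_EB : B = b :: rcons M w;
  in_M : ends b w M b2 c2;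
  in_neq : b2 != c2;
  in_bw : b != w }.

Lemma inner_exists D u v A B P d d' : min_config D u v A B P d d' ->
  exists a z b w M b2 c2, inner D u v A B P d d' a z b w M b2 c2.
Proof.
move=> mc; have cf := mc_config mc; have lk := mc_link mc.
have [a [z eA]] := config_endsA cf lk; have [b [w eB]] := config_endsB cf lk.
have ab := claw_first cfG cf lk eA eB; have zw := claw_last cfG cf lk eA eB.
have aw := cross_first_last cf lk eA eB.
have bw : b != w by apply: contraNneq aw => <-.
case: (eA) (eB) (lk) => Ap ua zv [Bp ub wv] [Pp ud dv Pu PD].
have [M EB] : exists M, B = b :: rcons M w.
  case: Bp bw => [[|y s] [-> _ <-]]; first by rewrite eqxx.
  by exists (belast y s); rewrite -lastI.
have cf' := cf; rewrite EB in cf'.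
(* Otherwise the edges [a b] and [z w] bypass [M], losing at most one vertex, while [P] brings two
   or more. *)
have M2 : 1 < size M.
  rewrite ltnNge; apply/negP => M1.
  have P1 := mc_size mc.
  cyc cf' Pu PD (P ++ [:: v] ++ [:: w] ++ rev A ++ [:: b] ++ [:: u]) M.
have pM : path adj b (rcons M w) by case: Bp => p [E bp _]; move: E bp; rewrite EB => -[<-].
have [b2 [c2 [Mp bb2 cw]]] := path_pth pM (ltnW M2).
exists a, z, b, w, M, b2, c2; split=> //.
have uM : uniq M.
  have := config_uniqA (config_swap cf); rewrite EB cons_uniq rcons_uniq.
  by case/and3P.
case: Mp M2 uM => [[|y s] [-> _ <-]] //= _ /andP[].
by move=> by_ _; apply: contraNneq by_ => ->; apply: mem_last.
Qed.

Lemma inner_flip D u v A B P d d' a z b w M b2 c2 :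
  inner D u v A B P d d' a z b w M b2 c2 ->
  inner D v u (rev A) (rev B) (rev P) d' d z a w b (rev M) c2 b2.
Proof.
case=> mc eA eB EB eM ne bw; split; try exact: ends_rev.
- exact: min_config_flip.
- by rewrite EB rev_cons rev_rcons rcons_cons.
- by rewrite eq_sym.
- by rewrite eq_sym.
Qed.

Section Inner.
Variables (D : {set G}) (u v : G) (A B P : seq G) (d d' a z b w : G).
Variables (M : seq G) (b2 c2 : G).
Hypothesis inn : inner D u v A B P d d' a z b w M b2 c2.
Let mc := in_mc inn.
Let cf := mc_config mc.
Let lk := mc_link mc.
Let eA := in_A inn.
Let eB := in_B inn.
Let eM := in_M inn.

Lemma inner_config : config D u v A (b :: rcons M w).
Proof. by have := cf; rewrite (in_EB inn). Qed.

Lemma memM x : x \in M -> (x \in B) && (x != b) && (x != w).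
Proof.
move=> xM; rewrite (in_EB inn) inE mem_rcons inE xM !orbT /=.
have := config_uniqA (config_swap inner_config).
rewrite cons_uniq rcons_uniq mem_rcons inE negb_or => /andP[/andP[_ bM] /andP[wM _]].
by apply/andP; split; [apply: contraNneq bM|apply: contraNneq wM]; move=> <-.
Qed.

Lemma u_nadj_M x : x \in M -> ~~ adj u x.
Proof.
by move/memM => /andP[/andP[xB xb] _]; apply: (min_config_nadj mc eA eB cfG xB xb).
Qed.

Lemma far_M x : x \in M -> far D x.
Proof. by move/memM => /andP[/andP[xB _] _]; apply: (min_config_far mc eA). Qed.

Lemma b2M : b2 \in M. Proof. exact: pth_head (ends_pth eM). Qed.
Lemma c2M : c2 \in M. Proof. exact: pth_last (ends_pth eM). Qed.

Lemma a_nadj_c2 : ~~ adj a c2.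
Proof.
apply/negP => ac; have zw := claw_last cfG cf lk eA eB; have cf' := inner_config.
case: (eA) (eB) (eM) (lk) => Ap ua zv [Bp ub wv] [Mp bb cw] [Pp ud dv Pu PD].
have P0 := pth_size Pp.
cyc cf' Pu PD (P ++ [:: v] ++ [:: w] ++ rev A ++ rev M ++ [:: b] ++ [:: u]) (Nil G).
Qed.

(* y is the successor of u on the cycle after u has been moved past an initial
   part of A; then W is the rest of A, and U goes from u back to b. *)
Lemma around y W U : pth y z W -> pth u b U -> perm_eq (U ++ W) (u :: b :: A) ->
  [/\ adj b c2 -> ~~ adj b2 y, ~~ adj c2 y, ~~ adj w y & ~~ adj v y].
Proof.
move=> Wp Up E; have zw := claw_last cfG cf lk eA eB; have cf' := inner_config.
case: (eA) (eB) (eM) (lk) => Ap ua zv [Bp ub wv] [Mp bb cw] [Pp ud dv Pu PD].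
have P0 := pth_size Pp.
split; [move=> bc| | |]; apply/negP => yy.
- cyc cf' Pu PD (W ++ [:: w] ++ [:: v] ++ rev P ++ U ++ rev M) (Nil G).
- cyc cf' Pu PD (P ++ [:: v] ++ [:: w] ++ rev W ++ rev M ++ rev U) (Nil G).
- cyc cf' Pu PD (P ++ [:: v] ++ rev W ++ [:: w] ++ rev M ++ rev U) (Nil G).
- cyc cf' Pu PD (P ++ [:: v] ++ W ++ [:: w] ++ rev M ++ rev U) (Nil G).
Qed.

Lemma chord_first : adj b w -> adj b2 w.
Proof.
case: (eB) (eM) => _ ub _ [_ bb _] bw.
have /andP[/andP[b2B b2b] b2w] := memM b2M.
apply: (cfG (c := b) (x := u)); try adjs; first exact: u_nadj_M b2M.
  exact: (claw_far_end cfG cf lk eA eB).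
have /andP[b2u _] := config_neqA (config_swap cf) b2B.
have /andP[wu _] := config_neqA (config_swap cf) (pth_last (ends_pth eB)).
by rewrite /= !inE negb_or !(eq_sym u) b2u wu b2w.
Qed.
End Inner.

Section InnerMain.
Variables (D : {set G}) (u v : G) (A B P : seq G) (d d' a z b w : G).
Variables (M : seq G) (b2 c2 : G).
Hypothesis inn : inner D u v A B P d d' a z b w M b2 c2.
Let inf := inner_flip inn.
Let mc := in_mc inn.
Let cf := mc_config mc.
Let lk := mc_link mc.
Let eA := in_A inn.
Let eB := in_B inn.
Let eM := in_M inn.

Lemma v_nadj_M x : x \in M -> ~~ adj v x.
Proof. by rewrite -mem_rev; apply: (u_nadj_M inf). Qed.

Lemma z_nadj_b2 : ~~ adj z b2.
Proof. exact: (a_nadj_c2 inf). Qed.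

Lemma chord_last : adj b w -> adj b c2.
Proof. by move=> bw; rewrite adjC; apply: (chord_first inf); rewrite adjC. Qed.

Lemma close_M : adj b2 w -> adj b2 c2.
Proof.
move=> b2w; case: (eB) (eM) => _ _ wv [_ _ cw].
apply: (cfG (c := w) (x := v)); try adjs.
- exact: v_nadj_M (b2M inn).
- exact: v_nadj_M (c2M inn).
have /andP[/andP[b2B _] _] := memM inn (b2M inn).
have /andP[/andP[c2B _] _] := memM inn (c2M inn).
have /andP[_ b2v] := config_neqA (config_swap cf) b2B.
have /andP[_ c2v] := config_neqA (config_swap cf) c2B.
by rewrite /= !inE negb_or !(eq_sym v) b2v c2v (in_neq inn).
Qed.
End InnerMain.
End Z4.

Lemma first_split (T : Type) (p : pred T) s : has p s ->
  exists s1 x s2, [/\ s = s1 ++ x :: s2, p x & all (predC p) s1].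
Proof.
elim: s => //= y s IH; have [py _|npy /=] := boolP (p y).
  by exists [::], y, s.
by case/IH=> s1 [x [s2 [-> px ps1]]]; exists (y :: s1), x, s2; rewrite /= npy.
Qed.

Section Z4Main.
Variable G : sgraph.
Implicit Types (x y t u v e g : G) (s A B P H : seq G) (D : {set G}).
Hypothesis cfG : claw_free G.
Notation Z4 := (contains_induced G (Z_graph 4)).

Section Inner.
Variables (D : {set G}) (u v : G) (A B P : seq G) (d d' a z b w : G).
Variables (M : seq G) (b2 c2 : G).
Hypothesis inn : inner D u v A B P d d' a z b w M b2 c2.
Let inf := inner_flip inn.
Let mc := in_mc inn.
Let cf := mc_config mc.
Let lk := mc_link mc.
Let eA := in_A inn.
Let eB := in_B inn.
Let eM := in_M inn.

Lemma inner_edges : [/\ [/\ adj u a, adj u b, adj z v & adj w v],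
  [/\ adj a b, adj z w, adj b b2 & adj c2 w],
  [/\ ~~ adj u w, ~~ adj u z, ~~ adj v a & ~~ adj v b],
  [/\ ~~ adj a w, ~~ adj b z, ~~ adj a c2 & ~~ adj z b2] &
  [/\ ~~ adj u b2, ~~ adj u c2, ~~ adj v b2 & ~~ adj v c2]].
Proof.
have b2M := b2M inn; have c2M := c2M inn.
have ab := claw_first cfG cf lk eA eB; have zw := claw_last cfG cf lk eA eB.
split; split=> //; try solve [by case: eA|by case: eB|by case: eM].
- exact: (claw_far_end cfG cf lk eA eB).
- exact: (claw_far_end cfG (config_swap cf) lk eB eA).
- exact: (claw_far_end cfG (config_swap (config_flip cf)) (link_flip lk) (ends_rev eB) (ends_rev eA)).
- exact: (claw_far_end cfG (config_flip cf) (link_flip lk) (ends_rev eA) (ends_rev eB)).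
- exact: (cross_first_last cf lk eA eB).
- exact: cross_first_last (config_swap cf) lk eB eA.
- exact: (a_nadj_c2 cfG inn).
- exact: (z_nadj_b2 cfG inn).
- by apply: (u_nadj_M cfG inn).
- by apply: (u_nadj_M cfG inn).
- by apply: (v_nadj_M cfG inn).
- by apply: (v_nadj_M cfG inn).
Qed.

Lemma inner_far : [/\ far D a, far D z, far D b & far D w].
Proof.
split; [exact: first_far cf lk eA|exact: last_far cf lk eA|
  exact: first_far (config_swap cf) lk eB|exact: last_far (config_swap cf) lk eB].
Qed.
End Inner.

Ltac edges inn := have [[ua ub zv wv] [ab zw bb2 cw] [nuw nuz nva nvb]
  [naw nbz nac nzb2] [nub2 nuc2 nvb2 nvc2]] := inner_edges inn.
Ltac fars := solve [adjs | eapply far_adj; eassumption | eapply far_adjC; eassumption].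

Section InnerCases.
Variables (D : {set G}) (u v : G) (A B P : seq G) (d d' a z b w : G).
Variables (M : seq G) (b2 c2 : G).
Hypothesis inn : inner D u v A B P d d' a z b w M b2 c2.
Let inf := inner_flip inn.
Let mc := in_mc inn.
Let cf := mc_config mc.
Let lk := mc_link mc.
Let eA := in_A inn.
Let eB := in_B inn.
Let eM := in_M inn.

(** The triangle [a], [b], [u] has the tail [e], [v], [w], [c2]. Only [b] could see the tail again,
    and a chord [b w] would entail [b c2]. *)
Lemma common_tail e : e \in D -> adj u e -> adj v e -> ~~ adj u v ->
  Z4 \/ adj b c2.
Proof.
move=> eD ue ve uv; have [bc|bc] := boolP (adj b c2); [by right|left].
have bw : ~~ adj b w by apply: contra bc; exact: (chord_last cfG inn).
edges inn; have [fa fz fb fw] := inner_far inn.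
have fb2 := far_M inn (b2M inn); have fc2 := far_M inn (c2M inn).
by apply: (contains_Z4 (a := a) (b := b) (c := u) (p1 := e) (p2 := v) (p3 := w) (p4 := c2)); fars.
Qed.

Lemma b2_nadj_a : adj b c2 -> ~~ adj b2 a.
Proof.
have [_ ub _] := eB; have up : pth u b ([:: u] ++ [:: b]) by pths.
by have [] := around cfG inn (ends_pth eA) up _.
Qed.

(** An induced path from [u] to [v] through [D] now has at least two inner vertices and is a tail of
    the triangle [a], [b], [u], prolonged by [w] if necessary. If then [b] sees [w], the tail is
    read backwards from the triangle [b2], [c2], [w]. *)
Lemma long_tail : ~~ adj u v -> (forall e, e \in D -> adj u e -> ~~ adj v e) -> Z4.
Proof.
move=> nuv nc; edges inn; have [fa fz fb fw] := inner_far inn.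
have fb2 := far_M inn (b2M inn); have fc2 := far_M inn (c2M inn).
have uv : u != v by have := config_uniq cf; rewrite cons_uniq inE => /andP[/norP[]].
have [q [qi qu q0 ql qD]] := link_induced cf lk uv.
have qE i j : i <= size q -> j <= size q ->
  adj (nth u (u :: q) i) (nth u (u :: q) j) = consecutive i j by move=> *; apply: qi.
have qN i j : i <= size q -> j <= size q -> ~~ consecutive i j ->
  ~~ adj (nth u (u :: q) i) (nth u (u :: q) j) by move=> *; rewrite qE.
case: q qi qu q0 ql qD qE qN => [//|z1 q] qi qu _ ql qD qE qN.
case: q qi qu ql qD qE qN => [|z2 q] qi qu ql qD qE qN.
  by have := qE 0 1 isT isT; rewrite /= (ql : z1 = v) (negbTE nuv).
have z1D : z1 \in D by apply: (qD 0).
have uz1 : adj u z1 by have := qE 0 1 isT isT.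
have z12 : adj z1 z2 by have := qE 1 2 isT isT.
have nuz2 : ~~ adj u z2 by have := qE 0 2 isT isT => /= ->.
case: q qi qu ql qD qE qN => [|z3 q] qi qu ql qD qE qN.
  by have := nc _ z1D uz1; rewrite adjC -ql z12.
have z2D : z2 \in D by apply: (qD 1).
have z23 : adj z2 z3 by have := qE 2 3 isT isT.
have nuz3 : ~~ adj u z3 by have := qE 0 3 isT isT => /= ->.
have nz13 : ~~ adj z1 z3 by have := qE 1 3 isT isT => /= ->.
case: q qi qu ql qD qE qN => [|z4 q] qi qu ql qD qE qN; last first.
  have z3D : z3 \in D by apply: (qD 2).
  have z34 : adj z3 z4 by have := qE 3 4 isT isT.
  have nuz4 : ~~ adj u z4 by have := qE 0 4 isT isT => /= ->.
  have nz14 : ~~ adj z1 z4 by have := qE 1 4 isT isT => /= ->.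
  have nz24 : ~~ adj z2 z4 by have := qE 2 4 isT isT => /= ->.
  have [naz4 nbz4] : ~~ adj a z4 /\ ~~ adj b z4.
    case: q ql qD {qi qu qE qN} => [|z5 q] ql qD.
      by rewrite /= in ql; rewrite ql !(adjC _ v).
    by have z4D : z4 \in D; [apply: (qD 3)|split; fars].
  by apply: (contains_Z4 (a := a) (b := b) (c := u) (p1 := z1) (p2 := z2) (p3 := z3) (p4 := z4)); fars.
rewrite /= in ql; rewrite ql in z23 nuz3 nz13.
have [bw|nbw] := boolP (adj b w); last first.
  by apply: (contains_Z4 (a := a) (b := b) (c := u) (p1 := z1) (p2 := z2) (p3 := v) (p4 := w)); fars.
have bc := chord_last cfG inn bw; have b2w := chord_first cfG inn bw.
have bc2 := close_M cfG inn b2w.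
by apply: (contains_Z4 (a := b2) (b := c2) (c := w) (p1 := v) (p2 := z2) (p3 := z1) (p4 := u)); fars.
Qed.

(** The triangle [b2], [c2], [w] gets the tail [v], [u], [y], [t], where [t] is the first vertex of
    [A] not adjacent to [u] and [y] the one before. As [u] sees everything before [t], it can be
    moved along the cycle to just before [y] or [t], as [around] requires. *)
Lemma chord_case : adj u v -> adj b w -> Z4.
Proof.
move=> uv bw; edges inn.
have bc := chord_last cfG inn bw; have b2w := chord_first cfG inn bw.
have bc2 := close_M cfG inn b2w; have Ap := ends_pth eA.
have [A1 [y [t [A2 [EA uA1 ut]]]]] : exists A1 y t A2,
    [/\ A = A1 ++ y :: t :: A2, all (adj u) (rcons A1 y) & ~~ adj u t].
  have hA : has (predC (adj u)) A by apply/hasP; exists z; [exact: pth_last Ap|].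
  have [s1 [t [s2 [EA ut us1]]]] := first_split hA.
  case/lastP: s1 EA us1 => [|s1 y] EA us1.
    by have := Ap; rewrite EA => /pth_consE at_; rewrite /= -at_ ua in ut.
  exists s1, y, t, s2; split=> //; first by rewrite EA cat_rcons.
  by apply: sub_all us1 => c /=; rewrite negbK.
have := Ap; rewrite EA => /pth_split2[py yt pt].
have := Ap; rewrite EA => /pth_split[_ pyt].
have uy : adj u y by move: uA1; rewrite all_rcons => /andP[].
have U2 : pth u b ([:: u] ++ rev (rcons A1 y) ++ [:: b]) by pths.
have [|nb2t nc2t nwt nvt] := around cfG inn pt U2; first by rewrite EA; perms.
have [U Up EU] : exists2 U, pth u b U & perm_eq (U ++ y :: t :: A2) (u :: b :: A).
  case/lastP: A1 EA uA1 {py U2} => [|A1 g] EA uA1.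
    by exists ([:: u] ++ [:: b]); [pths|rewrite EA].
  have ug : adj u g by move: uA1; rewrite !all_rcons => /and3P[].
  have := Ap; rewrite EA cat_rcons => /pth_split2[pg _ _].
  by exists ([:: u] ++ rev (rcons A1 g) ++ [:: b]); [pths|perms].
have [nb2y nc2y nwy nvy] := around cfG inn pyt Up EU.
have {}nb2y := nb2y bc; have {}nb2t := nb2t bc.
by apply: (contains_Z4 (a := b2) (b := c2) (c := w) (p1 := v) (p2 := u) (p3 := y) (p4 := t)); fars.
Qed.

(** By rerouting, the cycle neighbour [g'] of [x] sees neither [b] nor [z]; with the nonadjacent [b]
    and [z] it forms a claw at [x]. *)
Lemma middle_case x : adj u v -> x \in M -> adj b x -> adj x w -> ~~ adj b w ->
  adj z x -> adj a x -> False.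
Proof.
move=> uv xM bx xw nbw zx ax; edges inn.
have /andP[/andP[xB xb] xnw] := memM inn xM.
have [s1 [s2 EB]] : exists s1 s2, B = s1 ++ x :: s2.
  by case/path.splitPr: xB => s1 s2; exists s1, s2.
case: (eA) (eB) (lk) => Ap _ _ [Bp _ _] [Pp ud dv Pu PD].
case/lastP: s1 EB => [|s1 g] EB.
  by have := Bp; rewrite EB => /pth_consE bx'; rewrite bx' eqxx in xb.
case: s2 EB => [|g' s2] EB.
  by have := Bp; rewrite EB cats1 => /pth_rconsE wx; rewrite wx eqxx in xnw.
rewrite cat_rcons in EB; have cf' := cf; rewrite EB in cf'; have P0 := pth_size Pp.
have := Bp; rewrite EB => /pth_split2[p1 gx _].
have := Bp; rewrite EB -cat_rcons => /pth_split2[_ xg' p2].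
have [bg'|bg'] := boolP (adj b g').
  cyc cf' Pu PD ([:: u] ++ A ++ [:: x] ++ rev (rcons s1 g) ++ (g' :: s2) ++ [:: v] ++ rev P) (Nil G).
have [zg'|zg'] := boolP (adj z g').
  cyc cf' Pu PD (P ++ [:: v] ++ rev (g' :: s2) ++ rev A ++ [:: x] ++ rev (rcons s1 g) ++ [:: u]) (Nil G).
have : adj b z; last by rewrite (negbTE nbz).
apply: (cfG (c := x) (x := g')); try adjs.
have g'B : g' \in B by rewrite EB mem_cat !inE eqxx !orbT.
have zb := config_neqAB cf (pth_last Ap) (pth_head Bp).
have zg := config_neqAB cf (pth_last Ap) g'B.
have bg : g' != b.
  have := config_uniqA (config_swap cf); rewrite EB -cat_rcons cat_uniq.
  case/and3P=> _ /hasPn/(_ g'); rewrite !inE eqxx !orbT => /(_ isT) H _.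
  by apply: contraNneq H => ->; exact: pth_head p1.
by rewrite /= !inE negb_or (eq_sym g' z) (eq_sym b z) zb zg bg.
Qed.


Lemma common_edge : adj u v ->
  [/\ adj u d /\ adj u d', adj v d /\ adj d d' & d \in D /\ d' \in D].
Proof.
move=> uv; edges inn; have [fa _ _ _] := inner_far inn.
case: (lk) => Pp ud d'v Pu PD.
have dD := PD _ (pth_head Pp); have d'D := PD _ (pth_last Pp).
have ud' : adj u d'.
  by apply: (claw_common cfG (config_flip cf) (link_flip lk)); rewrite 1?adjC.
have vd : adj v d by apply: (claw_common cfG cf lk).
suff dd' : adj d d' by [].
apply: (cfG (c := u) (x := a)); try fars.
rewrite /= !inE negb_or !(eq_sym a) !(far_neq fa) //=.
have := mc_size mc; case: Pp Pu => [[|q s] [-> _ <-]] //= /andP[dq _] _.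
by rewrite andbT; apply: contraNneq dq => {1}->; rewrite mem_last.
Qed.

(** The triangle [d], [d'], [u] gets the tail [b], [x], [y], [t]: [x] is the last neighbour of [b]
    in [M], [y] the last neighbour of [x] after it, and [t] follows [y]. So no chord can skip ahead.
    If [y] ends [M], then [t] is [w]. *)
Lemma greedy_case : adj u v -> ~~ adj b w ->
  (forall x, x \in M -> adj b x -> ~~ adj x w) -> Z4.
Proof.
move=> uv nbw nom; edges inn; have [fa fz fb fw] := inner_far inn.
have [[ud ud'] [vd dd'] [dD d'D]] := common_edge uv.
have Mp := ends_pth eM.
have hM : has (adj b) M by apply/hasP; exists b2 => //; exact: b2M inn.
have [M1 [x [M2 [EM bx nb2]]]] := last_split hM.
have xM : x \in M by rewrite EM mem_cat inE eqxx orbT.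
have nxw := nom x xM bx.
case: M2 EM nb2 => [|h M2] EM nb2.
  by move: Mp nxw; rewrite EM cats1 => /pth_rconsE <-; rewrite cw.
have hh : has (adj x) (h :: M2) by have := Mp; rewrite EM => /pth_split2[_ xh _]; rewrite /= xh.
have [M3 [y [M4 [EM2 xy nx4]]]] := last_split hh.
have yM2 : y \in h :: M2 by rewrite EM2 mem_cat inE eqxx orbT.
have nby : ~~ adj b y by have /allP/(_ _ yM2) := nb2.
have yM : y \in M by rewrite EM mem_cat in_cons yM2 !orbT.
have [t [yt nut ft nbt nxt]] : exists t, [/\ adj y t, ~~ adj u t, far D t,
    ~~ adj b t & ~~ adj x t].
  case: M4 EM2 nx4 => [|t M4] EM2 nx4.
    exists w; split=> //; have := Mp; rewrite EM EM2.
    by rewrite -cat_rcons catA cats1 => /pth_rconsE <-.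
  have tM2 : t \in h :: M2 by rewrite EM2 mem_cat !inE eqxx !orbT.
  have tM : t \in M by rewrite EM mem_cat in_cons tM2 !orbT.
  exists t; split.
  - by have := Mp; rewrite EM EM2 -cat_rcons catA => /pth_split2[].
  - exact: (u_nadj_M cfG inn).
  - exact: (far_M inn).
  - by have /allP/(_ _ tM2) := nb2.
  - by case/andP: nx4.
have nux : ~~ adj u x by apply: (u_nadj_M cfG inn).
have nuy : ~~ adj u y by apply: (u_nadj_M cfG inn).
have fx : far D x by apply: (far_M inn).
have fy : far D y by apply: (far_M inn).
by apply: (contains_Z4 (a := d) (b := d') (c := u) (p1 := b) (p2 := x) (p3 := y) (p4 := t)); fars.
Qed.
End InnerCases.

Lemma min_config_Z4 D u v A B P d d' : min_config D u v A B P d d' -> Z4.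
Proof.
move=> mc; have [a [z [b [w [M [b2 [c2 inn]]]]]]] := inner_exists cfG mc.
have inf := inner_flip inn; have cf := mc_config mc; have lk := mc_link mc.
edges inn; have [fa fz fb fw] := inner_far inn.
have fb2 := far_M inn (b2M inn); have fc2 := far_M inn (c2M inn).
have [uv|nuv] := boolP (adj u v).
  have [bw|nbw] := boolP (adj b w); first exact: chord_case inn uv bw.
  have [/hasP[x xM /andP[bx xw]]|/hasPn nom] := boolP (has [pred x | adj b x && adj x w] M).
    have nux : ~~ adj u x by apply: (u_nadj_M cfG inn).
    have nvx : ~~ adj v x by apply: (v_nadj_M cfG inn).
    have fx : far D x by apply: (far_M inn).
    have [[ud ud'] [vd dd'] [dD d'D]] := common_edge inn uv.
    have vd' : adj v d' by rewrite adjC; case: (lk).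
    have [zx|nzx] := boolP (adj z x); last first.
      by apply: (contains_Z4 (a := d) (b := d') (c := u) (p1 := b) (p2 := x) (p3 := w) (p4 := z)); fars.
    have [ax|nax] := boolP (adj a x); last first.
      by apply: (contains_Z4 (a := d) (b := d') (c := v) (p1 := w) (p2 := x) (p3 := b) (p4 := a)); fars.
    by case: (middle_case inn uv xM bx xw nbw zx ax).
  by apply: (greedy_case inn uv nbw) => x xM bx; have := nom x xM; rewrite /= bx.
have [/exists_inP[e eD /andP[ue ve]]|/exists_inPn nc] :=
  boolP [exists e in D, adj u e && adj v e]; last first.
  by apply: (long_tail inn nuv) => e eD ue; have := nc e eD; rewrite ue.
have [//|bc] := common_tail inn eD ue ve nuv.
have nvu : ~~ adj v u by rewrite adjC.
(* Seen from [v], the same argument leaves the edge [w b2]. Then [b2], [c2], [w] is a triangle, and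
   its tail [v], [e], [u], [a] runs the other way. *)
have [//|wb2] := common_tail inf eD ve ue nvu.
have b2w : adj b2 w by rewrite adjC.
have bc2 := close_M cfG inn b2w; have nb2a := b2_nadj_a inn bc.
by apply: (contains_Z4 (a := b2) (b := c2) (c := w) (p1 := v) (p2 := e) (p3 := u) (p4 := a)); fars.
Qed.
End Z4Main.

(** * P4 and W *)

Section P4W.
Variable G : sgraph.
Implicit Types (x y t u v e g : G) (s A B P H : seq G) (D : {set G}).

(** Two neighbours of [u] in [D] guarantee a link from [u] to [a2] with at least two vertices, which
    could replace [a]. *)
Lemma second_far D u v a a2 A B e1 e2 : config D u v [:: a, a2 & A] B -> 0 < size B ->
  e1 \in D -> e2 \in D -> e1 != e2 -> adj u e1 -> adj u e2 -> far D a2.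
Proof.
move=> cf B0 e1D e2D e12 ue1 ue2; rewrite /far (config_inA cf) ?inE ?eqxx ?orbT //=.
apply/attP => -[e eD ae].
have [f [Q [Qp uf fa Qu QD] Q1]] : exists f, exists2 Q, link D u a2 Q f e & 1 < size Q.
  have [E|ne] := eqVneq e1 e; last by exists e1; apply: link_far (config_conn cf).
  by exists e2; apply: link_far (config_conn cf); rewrite // -E eq_sym.
have [b [w [Bp ub wv]]] := path_pth (config_pathB cf) B0.
have [z [a' [Ap ua zv]]] := path_pth (config_pathA cf) isT.
have := Ap; rewrite -[[:: a, a2 & A]]/([::] ++ [:: a, a2 & A]) => /pth_split2[_ _ p2].
cyc cf Qu QD ([:: u] ++ Q ++ (a2 :: A) ++ [:: v] ++ rev B) [:: a].
Qed.

Lemma min_config_P4_W D u v A B P d d' : min_config D u v A B P d d' ->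
  contains_induced G (path_graph 4) \/ contains_induced G W_graph.
Proof.
move=> mc; have cf := mc_config mc; have lk := mc_link mc; have P1 := mc_size mc.
have [a [z eA]] := config_endsA cf lk; have [b [w eB]] := config_endsB cf lk.
have fa := first_far cf lk eA; have fb := first_far (config_swap cf) lk eB.
have sA := leq_trans P1 (config_size cf lk).
have sB := leq_trans P1 (config_size (config_swap cf) lk).
have [|noP4] := Classical_Prop.classic (contains_induced G (path_graph 4)); [by left|right].
(* Typical use: with [x] in [D] and [u] as [y], being a neighbour of [u] passes from a far vertex to
   the next one. *)
have P4 x y c t : adj x y -> adj y c -> adj c t -> ~~ adj x c -> ~~ adj x t -> adj y t.
  by move=> *; apply/negPn/negP => yt; apply: noP4; apply: (contains_P4 (x := x) (y := y) (z := c) (t := t)).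
have farB := min_config_far mc eA.
case: (lk) (eA) (eB) => Pp ud dv Pu PD [Ap ua zv] [Bp ub wv].
have [d2 [s EP]] : exists d2 s, P = [:: d, d2 & s].
  by case: Pp P1 => [[|d2 s] [-> _ _]] // _; exists d2, s.
have dd2 : adj d d2 by case: Pp => p [E]; move: E; rewrite EP => -[<-] /= /andP[].
have dD : d \in D by apply: PD; rewrite EP inE eqxx.
have d2D : d2 \in D by apply: PD; rewrite EP !inE eqxx orbT.
have ned : d != d2 by apply: contraTneq dd2 => ->; rewrite adj_irrefl.
have ud2 : adj u d2.
  by apply: (P4 a u d d2); rewrite ?(far_adj fa) // adjC.
have [a2 [A' EA]] : exists a2 A', A = [:: a, a2 & A'].
  by case: Ap sA => [[|a2 A'] [-> _ _]] // _; exists a2, A'.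
have [b2 [B' EB]] : exists b2 B', B = [:: b, b2 & B'].
  by case: Bp sB => [[|b2 B'] [-> _ _]] // _; exists b2, B'.
have cf' := cf; rewrite EA EB in cf'; have scf' := config_swap cf'.
have := Ap; rewrite EA -[[:: a, a2 & A']]/([::] ++ [:: a, a2 & A']) => /pth_split2[_ aa2 pA2].
have := Bp; rewrite EB -[[:: b, b2 & B']]/([::] ++ [:: b, b2 & B']) => /pth_split2[_ bb2 pB2].
have Ap' := Ap; rewrite EA in Ap'; have Bp' := Bp; rewrite EB in Bp'.
have fa2 : far D a2 by apply: second_far cf' _ dD d2D ned ud ud2.
have fb2 : far D b2 by apply: second_far scf' _ dD d2D ned ud ud2.
have ua2 : adj u a2 by apply: (P4 d u a a2); rewrite ?(far_adjC _ dD) // adjC.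
have uB x : x \in B -> adj u x.
  have [s' [Es bs _]] := Bp; have : all (far D) s'.
    by apply/allP => c cs; apply: farB; rewrite Es inE cs orbT.
  rewrite Es; move: (b) s' ub fb bs {Es} => y s'.
  elim: s' y => [|c s' IH] y uy fy /=.
    by rewrite inE => _ _ /eqP ->.
  case/andP=> yc cs /andP[fc fs]; rewrite inE => /orP[/eqP->//|].
  by apply: IH => //; apply: (P4 d u y c); rewrite ?(far_adjC _ dD) // adjC.
have uw := uB _ (pth_last Bp).
have ub2 : adj u b2 by apply: uB; rewrite EB !inE eqxx orbT.
(* The edge [u w], due to the choice of [B], closes the following cycles; they may miss [a] or [b]
   because [P] has two vertices. *)
have nab : ~~ adj a b.
  by apply/negP => ab; cyc cf Pu PD (P ++ [:: v] ++ rev A ++ B ++ [:: u]) (Nil G).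
have nab2 : ~~ adj a b2.
  by apply/negP => ab; cyc cf' Pu PD (P ++ [:: v] ++ rev [:: a, a2 & A'] ++ (b2 :: B') ++ [:: u]) [:: b].
have na2b : ~~ adj a2 b.
  by apply/negP => ab; cyc cf' Pu PD (P ++ [:: v] ++ rev (a2 :: A') ++ [:: b, b2 & B'] ++ [:: u]) [:: a].
have na2b2 : ~~ adj a2 b2.
  apply/negP => ab; have b2b : adj b2 b by rewrite adjC.
  by have := P4 a a2 b2 b aa2 ab b2b nab2 nab; rewrite (negbTE na2b).
apply: (contains_W (c := u) (x1 := d) (y1 := d2) (x2 := a) (y2 := a2) (x3 := b) (y3 := b2)) => //;
  by [apply: far_adjC dD|apply: far_adjC d2D].
Qed.
End P4W.

(** * Extremal cycles of 2-connected graphs *)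

Lemma max_measure (T : Type) (Q : T -> Prop) (f : T -> nat) N :
  (forall x, Q x -> f x <= N) -> (exists x, Q x) ->
  exists2 x, Q x & forall y, Q y -> f y <= f x.
Proof.
move=> bnd [x Qx]; have [n] := ubnP (N - f x); elim: n x Qx => // n IH x Qx le.
have [[y [Qy lt]]|no] := Classical_Prop.classic (exists y, Q y /\ f x < f y).
  by apply: (IH y Qy); have := bnd y Qy; slia.
by exists x => // y Qy; rewrite leqNgt; apply/negP => lt; apply: no; exists y.
Qed.

Lemma path_crossing (T : eqType) (e : rel T) (S : pred T) x p :
  path e x p -> S x -> ~~ S (last x p) -> exists a b, [/\ S a, ~~ S b & e a b].
Proof.
elim: p x => [|y p IH] x /=; first by move=> _ ->.
case/andP=> xy yp Sx Sl; have [Sy|Sy] := boolP (S y); first exact: IH yp Sy Sl.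
by exists x, y.
Qed.

Section Existence.
Variable G : sgraph.
Implicit Types (x y u v d : G) (c s A B P : seq G) (D S X : {set G}).

(** The pairs are ordered, so each edge counts twice, which does not affect comparisons. *)
Definition off_edges c :=
  #|[set e : G * G | [&& adj e.1 e.2, e.1 \notin c & e.2 \notin c]]|.

Lemma path_val S (z : induced S) q :
  path adj z q -> path adj (val z) (map val q).
Proof.
elim: q z => //= t q IH z /andP[zt /IH ->]; rewrite andbT.
exact: zt.
Qed.

Section TwoConnected.
Hypothesis G2 : k_connected 2 G.

Lemma crossing X S x y : #|X| < 2 -> x \in S -> x \notin X -> y \notin S -> y \notin X ->
  exists a b, [/\ a \in S, b \notin S, a \notin X, b \notin X & adj a b].
Proof.
move=> X2 xS xX yS yX; have [_ cn] := (snd G2) X X2.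
have xX' : x \in ~: X by rewrite inE.
have yX' : y \in ~: X by rewrite inE.
have /connectP[p pp pl] := cn (Sub x xX') (Sub y yX').
have [||a [b [aS bS ab]]] := path_crossing (S := fun z => val z \in S) pp.
- by rewrite /= ?SubK.
- by rewrite -pl /= ?SubK.
exists (val a), (val b); split=> //; [have := valP a|have := valP b];
  by rewrite inE.
Qed.

Lemma connected_G x y : connect adj x y.
Proof.
apply/negPn/negP => nc.
have [|||||a [b [aS bS _ _ ab]]] := @crossing set0 [set z | connect adj x z] x y; rewrite ?cards0 ?inE //.
move: bS; rewrite inE => /negP[]; rewrite inE in aS.
exact: connect_trans aS (connect1 ab).
Qed.

Lemma other_vertex x y : exists z, (z != x) && (z != y).
Proof.
have [G3 _] := G2; case: (pickP [pred z | (z != x) && (z != y)]) => [z zP|H].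
  by exists z.
suff : #|G| <= 2 by move: G3; slia.
apply: leq_trans (_ : #|[set x; y]| <= 2); last by rewrite cards2; case: (x != y).
apply/subset_leq_card/subsetP => z _; have /negbT := H z.
by rewrite /= negb_and !negbK !inE.
Qed.

(** Two neighbours of [x] are joined by a path in the graph without [x]. *)
Lemma cycle_exists : exists c, is_cycle c.
Proof.
have [G3 _] := G2; have /card_gt0P[x _] : 0 < #|G| by slia.
have [x1 /andP[x1x _]] := other_vertex x x.
have [|||||a [y [/set1P -> yx _ _ xy]]] := @crossing set0 [set x] x x1;
  rewrite ?cards0 ?inE ?eqxx //.
have [w /andP[wx wy]] := other_vertex x y; rewrite inE in yx.
have [|||||a' [z [/set1P -> zx _ zy xz]]] := @crossing [set y] [set x] x w;
  rewrite ?cards1 ?inE ?eqxx // 1?eq_sym //.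
rewrite !inE in zx zy.
have [_ cn] := (snd G2) [set x] (eq_leq (congr1 succn (cards1 x))).
have yX' : y \in ~: [set x] by rewrite !inE.
have zX' : z \in ~: [set x] by rewrite !inE.
have /connectP[p pp pl] := cn (Sub y yX') (Sub z zX').
case/shortenP: pp pl => p' pp' up' _ pl.
have pv : path adj y (map val p') := path_val pp'.
have lz : last y (map val p') = z.
  by rewrite (last_map val p' (Sub y yX' : induced (~: [set x]))) -pl.
exists [:: x, y & map val p']; split.
  case: p' lz {pp' up' pv pl} => [/= yz|//]; by rewrite yz eqxx in zy.
apply/andP; split; first by rewrite /= xy rcons_path pv lz adj_sym xz.
have uy : uniq (y :: map val p').
  by have := map_inj_uniq val_inj (Sub y yX' :: p'); rewrite up' => E; exact: E.
have xN : x \notin y :: map val p'.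
  apply/negP => xs; have /mapP[t _ xt] : x \in map val (Sub y yX' :: p') by exact: xs.
  by have : val t \in [set~ x] := valP t; rewrite -xt !inE eqxx.
by rewrite cons_uniq xN uy.
Qed.

Definition extremal_cycle c := is_cycle c /\
  forall c', is_cycle c' -> size c' <= size c /\
    (size c' = size c -> off_edges c <= off_edges c').

Lemma extremal_exists : exists c, extremal_cycle c.
Proof.
pose K := #|{: G * G}|; pose f c := size c * K.+1 + (K - off_edges c).
have offK c : off_edges c <= K by apply: max_card.
have bound c : is_cycle c -> f c <= #|G| * K.+1 + K.
  case=> _ /andP[_ uc]; rewrite /f leq_add ?leq_subr // leq_mul2r.
  by rewrite -(card_uniqP uc) max_card orbT.
have [c cyc_c max_c] := max_measure bound cycle_exists.
exists c; split=> // c' /max_c; rewrite /f; have := offK c; have := offK c'.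
set m := size c'; set n := size c; set k := off_edges c; set k' := off_edges c'.
move=> kK kK' le; split=> [|E]; last by rewrite E in le; slia.
rewrite leqNgt; apply/negP => mn; suff : n.+1 * K.+1 <= m * K.+1 by rewrite mulSn; slia.
by rewrite leq_mul2r mn orbT.
Qed.

Section Component.
Variable c : seq G.
Hypothesis ext : extremal_cycle c.
Variables x y : G.
Hypotheses (xy : adj x y) (xc : x \notin c) (yc : y \notin c).

Let e : rel G := fun a b => [&& adj a b, a \notin c & b \notin c].
Let D := [set w | connect e x w].

Let e_sym : connect_sym e.
Proof.
by apply: sym_connect_sym => a b; rewrite /e adj_sym [(a \notin c) && _]andbC.
Qed.

Let DC d : d \in D -> d \notin c.
Proof.
rewrite inE => /connectP[p]; elim/last_ind: p => [|p z _] /=; first by move=> _ ->.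
by rewrite rcons_path last_rcons => /andP[_ /and3P[_ _ zc]] ->.
Qed.

Let D_closed d w : d \in D -> adj d w -> w \in D \/ w \in c.
Proof.
move=> dD dw; have [wc|wc] := boolP (w \in c); [by right|left].
have dc := DC dD; move: dD; rewrite !inE => xd; apply: connect_trans xd (connect1 _).
by rewrite /e dw dc.
Qed.

Let D_conn d d' : d \in D -> d' \in D ->
  exists Q, [/\ pth d d' Q, uniq Q & {subset Q <= D}].
Proof.
move=> dD; rewrite inE => xd'.
have : connect e d d' by move: dD; rewrite inE => xd; apply: connect_trans xd'; rewrite e_sym.
case/connectP=> p pp pl; case/shortenP: pp pl => p' pp' up' _ pl.
exists (d :: p'); split=> //.
  exists p'; split=> //.
  by apply: sub_path pp' => a b /and3P[].
have sub q z : z \in D -> path e z q -> {subset z :: q <= D}.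
  elim: q z => [|t q IH] z zD /=; first by move=> _ w; rewrite inE => /eqP ->.
  case/andP=> zt tq w; rewrite inE => /orP[/eqP ->//|].
  apply: IH tq w; move: zD; rewrite !inE => xz; exact: connect_trans xz (connect1 zt).
exact: sub.
Qed.

Let xD : x \in D. Proof. by rewrite inE connect0. Qed.
Let yD : y \in D. Proof. by rewrite inE connect1 // /e xy xc yc. Qed.
Let x_neq_y : x != y. Proof. by apply: contraTneq xy => ->; rewrite adj_irrefl. Qed.

Let c_other u : exists2 w, w \in c & w != u.
Proof.
have [[c2 /andP[_ uc]] _] := ext.
case: (c) c2 uc => [|a [|b s]] //= _ /andP[]; rewrite inE negb_or => /andP[ab _] _.
have [au|au] := eqVneq a u; last by exists a => //; rewrite inE eqxx.
by exists b; rewrite ?inE ?eqxx ?orbT // -au eq_sym.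
Qed.

(** Deleting the end [u] of a first edge yields a second edge, ending in [v]. If both start in the
    same [d], deleting [d] yields a third edge, which is disjoint from one of the two. *)
Lemma two_attachments : exists u v d d', [/\ u \in c, v \in c, u != v &
  [/\ d \in D, d' \in D, d != d', adj u d & adj v d']].
Proof.
have inc a b : a \in D -> b \notin D -> adj a b -> b \in c.
  by move=> aD bD ab; case: (D_closed aD ab) => // bD'; rewrite bD' in bD.
have nD w : w \in c -> w \notin D by move=> wc; apply/negP => /DC; rewrite wc.
have [w wc _] := c_other x.
have [|||||d [u [dD uD _ _ du]]] := crossing (X := set0) (S := D) (x := x) (y := w);
  rewrite ?cards0 ?in_set0 //; first exact: nD.
have uc := inc _ _ dD uD du.
have [w' w'c w'u] := c_other u.
have [|||||d2 [v [d2D vD _ vu d2v]]] := crossing (X := [set u]) (S := D) (x := x) (y := w').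
- by rewrite cards1.
- by [].
- by rewrite inE; apply: contraTneq xD => ->.
- exact: nD.
- by rewrite inE.
have vc := inc _ _ d2D vD d2v; rewrite inE in vu.
have [dd2|dd2] := eqVneq d d2; last first.
  exists u, v, d, d2; split=> //; first by rewrite eq_sym.
  by split=> //; rewrite adjC.
have [d0 d0D d0d] : exists2 d0, d0 \in D & d0 != d.
  have [xd|xd] := eqVneq x d; last by exists x.
  by exists y; rewrite // -xd eq_sym.
have [|||||d3 [t [d3D tD d3d _ d3t]]] := crossing (X := [set d]) (S := D) (x := d0) (y := u).
- by rewrite cards1.
- by [].
- by rewrite inE.
- by [].
- by rewrite inE; apply: contraTneq dD => <-.
have tc := inc _ _ d3D tD d3t; rewrite inE in d3d.
have [tu|tu] := eqVneq t u.
  exists u, v, d3, d; split=> //; first by rewrite eq_sym.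
  by split=> //; rewrite adjC ?dd2 // -tu.
exists u, t, d, d3; split=> //; first by rewrite eq_sym.
by split=> //; rewrite 1?adjC // eq_sym.
Qed.

Lemma config_component : exists D u v A B P d d', [/\ config D u v A B,
  link D u v P d d', 1 < size P & perm_eq (u :: v :: A ++ B) c].
Proof.
have [u [v [d [d' [uc vc uv [dD d'D dd' ud vd']]]]]] := two_attachments.
have [Q lQ Q1] := link_far dD d'D ud vd' dd' D_conn.
have [[c2 /andP[cyc uniq_c]] mx] := ext.
have [i c' Ec] := rot_to uc.
have pc : perm_eq (u :: c') c by rewrite -Ec perm_rot.
have vc' : v \in c'.
  by have := perm_mem pc v; rewrite vc inE eq_sym (negbTE uv).
have [A [s Es]] : exists A s, c' = A ++ v :: s.
  by case/path.splitPr: vc' => A s; exists A, s.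
have cyc' : cycle adj (u :: c') by rewrite -Ec rot_cycle.
have pABc : perm_eq (u :: v :: A ++ rev s) c.
  by apply: perm_trans pc; rewrite Es; perms.
move: cyc'; rewrite /= Es rcons_cat cat_path /= => /and3P[uA Av vs].
exists D, u, v, A, (rev s), Q, d, d'; split=> //.
have mem w : (w \in u :: v :: A ++ rev s) = (w \in c) := perm_mem pABc w.
split=> //.
- by rewrite rcons_path uA.
- exact: path_rcons_rev.
- by rewrite (perm_uniq pABc).
- by move=> e0 /DC; rewrite mem.
- by move=> e0 w e0D /(D_closed e0D); rewrite mem.
move=> x0 y0 s0 [p [-> xp yl]] us yx s2.
have cyc_s : is_cycle (x0 :: p).
  by split=> //; apply/andP; split=> //=; rewrite rcons_path xp yl.
have [le _] := mx _ cyc_s.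
by have := perm_size pABc; rewrite /= size_cat => ->.
Qed.
End Component.

Lemma config_exists : ~ has_dominating_cycle G ->
  exists D u v A B P d d', [/\ config D u v A B, link D u v P d d', 1 < size P &
  forall c, is_cycle c -> size c = (size A + size B).+2 ->
    off_edges (u :: v :: A ++ B) <= off_edges c].
Proof.
move=> nd; have [c ext] := extremal_exists; have [cyc_c mx] := ext.
have [x [y [xy xc yc]]] : exists x y, [/\ adj x y, x \notin c & y \notin c].
  apply: Classical_Prop.NNPP => no; apply: nd; exists c; split=> // x y xy.
  apply/negPn/negP; rewrite negb_or => /andP[xc yc]; apply: no.
  by exists x, y.
have [D [u [v [A [B [P [d [d' [cf lk P1 E]]]]]]]]] := config_component ext xy xc yc.
exists D, u, v, A, B, P, d, d'; split=> // c' cyc' sc'.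
have sE : size c' = size c by rewrite sc' -(perm_size E) /= size_cat.
suff -> : off_edges (u :: v :: A ++ B) = off_edges c by have [_] := mx _ cyc'; apply.
by apply: eq_card => t; rewrite !inE -!(perm_mem E) !inE.
Qed.
End TwoConnected.
End Existence.

(** * The subdivided claw and the paw *)

Section Spider.
Variable G : sgraph.
Implicit Types (x y t u v e : G) (s A B P W : seq G) (D : {set G}).

Definition paw_free := forall a b c p : G, adj a b -> adj a c -> adj b c -> adj c p ->
  adj a p || adj b p.

Lemma att_far_nbr D u v A B P d d' t : config D u v A B -> link D u v P d d' ->
  t \in u :: v :: A ++ B -> att D t -> exists2 t', adj t t' & far D t'.
Proof.
move=> cf lk; have [a [z eA]] := config_endsA cf lk; have [b [w eB]] := config_endsB cf lk.
have onA A0 B0 a0 z0 : config D u v A0 B0 -> ends u v A0 a0 z0 -> t \in A0 -> att D t ->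
    exists2 t', adj t t' & far D t'.
  move=> cf0 eA0 tA tD; case/path.splitPr EA : A0 / tA cf0 eA0 => [A1 A2] cf0 eA0.
  have tz : t != z0.
    apply: contraTneq tD => ->; have := last_far cf0 lk eA0; by case/andP.
  case: (eA0) => Ap0 _ _; case: A2 {EA} cf0 eA0 Ap0 => [|x A2] cf0 eA0 Ap0.
    by move: Ap0 tz; rewrite cats1 => /pth_rconsE ->; rewrite eqxx.
  exists x; last exact: natt_next cf0 tD.
  by case/pth_split2: Ap0.
rewrite !inE mem_cat => /or4P[/eqP->|/eqP->|tA|tB] tD.
- by exists a; [case: eA|exact: first_far cf lk eA].
- by exists z; [case: eA => _ _; rewrite adjC|exact: last_far cf lk eA].
- exact: onA cf eA tA tD.
- exact: onA (config_swap cf) eB tB tD.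
Qed.

Lemma D_nbr D u v A B P d d' e : config D u v A B -> link D u v P d d' -> 1 < size P ->
  e \in D -> exists2 e', e' \in D & adj e e'.
Proof.
move=> cf [Pp _ _ Pu PD] P1 eD.
have [e0 e0D ee0] : exists2 e0, e0 \in D & e0 != e.
  case: P Pp Pu PD P1 => [//|p0 [//|p1 s]] _ /andP[]; rewrite inE negb_or => /andP[p01 _] _ PD _.
  have [pe|pe] := eqVneq p0 e; last by exists p0 => //; apply: PD; rewrite inE eqxx.
  by exists p1; rewrite -?pe 1?eq_sym //; apply: PD; rewrite !inE eqxx orbT.
have [Q [[q [EQ pq lq]] _ QD]] := config_conn cf eD e0D.
case: q EQ pq lq => [|e' q] EQ pq lq; first by rewrite -lq eqxx in ee0.
exists e'; last by case/andP: pq.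
by apply: QD; rewrite EQ !inE eqxx orbT.
Qed.

(** In a paw-free graph, lying in a triangle passes to neighbours, so by connectedness it suffices
    that [u] lies in none. A triangle at [u] would lead to one made of an attachment and an edge of
    [D], and a far neighbour of that attachment completes a paw. *)
Lemma triangle_free D u v A B P d d' : paw_free -> (forall x y, connect (@adj G) x y) ->
  config D u v A B -> link D u v P d d' -> 1 < size P ->
  forall x y t, adj x y -> adj y t -> ~~ adj x t.
Proof.
move=> paw conn cf lk P1.
have noDD t e e' : t \in u :: v :: A ++ B -> e \in D -> e' \in D ->
    adj t e -> adj t e' -> ~~ adj e e'.
  move=> tC eD e'D te te'; apply/negP => ee'.
  have [t' tt' ft'] := att_far_nbr cf lk tC (introT (attP D t) (ex_intro2 _ _ e eD te)).
  have := paw e e' t t' ee' _ _ tt'; rewrite 1?adjC te 1?adjC te' => /(_ isT isT).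
  by rewrite (negbTE (far_adjC ft' eD)) (negbTE (far_adjC ft' e'D)).
have uC : u \in u :: v :: A ++ B by rewrite inE eqxx.
have noD e t : e \in D -> adj u e -> adj u t -> ~~ adj e t.
  move=> eD ue ut; have [tD|tD] := boolP (t \in D); first exact: noDD uC eD tD ue ut.
  apply/negP => et; have tC : t \in u :: v :: A ++ B.
    by case: (config_closed cf eD et) => // tD'; rewrite tD' in tD.
  have [e' e'D ee'] := D_nbr cf lk P1 eD.
  have te : adj t e by rewrite adjC.
  have /orP[ue'|te'] := paw u t e e' ut ue te ee'.
    by have := noDD u e e' uC eD e'D ue ue'; rewrite ee'.
  by have := noDD t e e' tC eD e'D te te'; rewrite ee'.
have dD : d \in D by case: lk => Pp _ _ _ PD; apply: PD (pth_head Pp).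
have ud : adj u d by case: lk.
pose tri := [pred x : G | [exists y, exists t, [&& adj x y, adj y t & adj x t]]].
have triP x y t : adj x y -> adj y t -> adj x t -> tri x.
  by move=> xy yt xt; apply/existsP; exists y; apply/existsP; exists t; rewrite xy yt.
have ntu : ~~ tri u.
  apply/existsPn => s; apply/existsPn => t; apply/negP => /and3P[us st ut].
  have := paw s t u d st _ _ ud; rewrite adjC us adjC ut => /(_ isT isT)/orP[sd|td].
    by have := noD d s dD ud us; rewrite adjC sd.
  by have := noD d t dD ud ut; rewrite adjC td.
move=> x y t xy yt; apply/negP => xt.
have /connectP[p xp lp] := conn x u.
have tx : tri x := triP x y t xy yt xt.
have [|g [g' [/existsP[s /existsP[r /and3P[gs sr gr]]] ng' gg']]] := path_crossing xp tx.
  by rewrite -lp.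
have g'g : adj g' g by rewrite adjC.
have sg : adj s g by rewrite adjC.
have rg : adj r g by rewrite adjC.
case/negP: ng'; have /orP[sg'|rg'] := paw s r g g' sr sg rg gg'.
  by apply: (triP g' g s) => //; rewrite adjC.
by apply: (triP g' g r) => //; rewrite adjC.
Qed.

Section TriangleFree.
Hypothesis tf : forall x y t : G, adj x y -> adj y t -> ~~ adj x t.
Hypothesis noS : ~ contains_induced G claw_star_star.

(** Five of the ten nonadjacencies of the forbidden graph hold for lack of triangles, so one of the
    other five fails. *)
Lemma spider (c p q q' r r' : G) : adj c p -> adj c q -> adj c r -> adj q q' -> adj r r' ->
  [|| adj p q', adj p r', adj q r', adj q' r | adj q' r'].
Proof.
move=> cp cq cr qq rr; apply/negPn/negP; rewrite !negb_or => /and5P[n1 n2 n3 n4 n5].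
have [pc qc] : adj p c /\ adj q c by rewrite !(adjC _ c).
apply: noS; apply: (contains_claw_star_star (c := c) (p := p) (q := q) (q' := q')
  (r := r) (r' := r')) => //; by [exact: tf cq qq|exact: tf cr rr|exact: tf pc cq|
  exact: tf pc cr|exact: tf qc cr].
Qed.

Lemma sibling (c q q' x1 x2 y : G) : adj c q -> adj q q' -> adj c x1 -> adj c x2 -> adj x1 y ->
  ~~ adj y q -> ~~ adj y q' -> ~~ adj x1 q' -> ~~ adj x2 q' -> adj x2 y.
Proof.
move=> cq qq c1 c2 x1y nyq nyq' n1 n2.
have := spider c2 cq c1 qq x1y.
by rewrite (negbTE n2) adjC (adjC q) (negbTE nyq) (adjC q') (negbTE n1) (adjC q') (negbTE nyq') !orbF adjC.
Qed.
End TriangleFree.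
End Spider.

(** * Exchanging a cycle vertex for a common neighbour in D *)

Section CommonNeighbour.
Variable G : sgraph.
Implicit Types (x y t u v e : G) (c s A B P W : seq G) (D : {set G}).
Hypothesis tf : forall x y t : G, adj x y -> adj y t -> ~~ adj x t.
Hypothesis noS : ~ contains_induced G claw_star_star.

Definition off_minimal s := forall c : seq G, is_cycle c -> size c = size s ->
  off_edges s <= off_edges c.

Lemma off_edges_perm s s' : perm_eq s s' -> off_edges s = off_edges s'.
Proof. by move=> E; apply: eq_card => t; rewrite !inE !(perm_mem E). Qed.

Lemma off_minimal_perm s s' : perm_eq s s' -> off_minimal s -> off_minimal s'.
Proof.
by move=> E mn c cc cs; rewrite -(off_edges_perm E); apply: mn; rewrite // cs (perm_size E).
Qed.

Lemma pth_cycle x y s : pth x y s -> uniq s -> adj y x -> 2 < size s -> is_cycle s.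
Proof.
case=> p [-> xp <-] us yx s2; split=> //; apply/andP; split=> //=.
by rewrite rcons_path xp yx.
Qed.

(* Replacing a by e gives a cycle of the same length with fewer edges off it. *)
Lemma no_common_half D u v A B e a z b w : config D u v A B ->
  off_minimal (u :: v :: A ++ B) -> all (far D) A -> e \in D -> adj u e -> adj v e ->
  ends u v A a z -> ends u v B b w -> (exists2 e2, e2 \in D & adj e e2) ->
  ~~ adj w u.
Proof.
move=> cf mn /allP fA eD ue ve eA eB [e2 e2D ee2]; apply/negP => wu.
have ev : adj e v by rewrite adjC.
have lk : link D u v [:: e] e e.
  by split=> //; [exact: pth1|move=> c; rewrite inE => /eqP ->].
have fa := first_far cf lk eA; have fb := first_far (config_swap cf) lk eB.
have fw := last_far (config_swap cf) lk eB.
case: (eA) (eB) => Ap ua zv [Bp ub wv].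
have uw : adj u w by rewrite adjC.
have eC : e \notin u :: v :: A ++ B := config_disj cf eD.
(* By [sibling], such a neighbour [o] of [a] would also see [b], and could join the cycle along with
   [e]. *)
have noO o : o \notin u :: v :: A ++ B -> o \notin D -> ~~ adj a o.
  move=> oC oD; apply/negP => ao.
  have nD x : x \in D -> ~~ adj o x.
    move=> xD; apply/negP; rewrite adjC => /(config_closed cf xD) [oD'|oC'].
      by rewrite oD' in oD.
    by rewrite oC' in oC.
  have bo : adj b o.
    by apply: (sibling tf noS ue ee2 ua ub ao); rewrite ?nD // ?(far_adj fa) // (far_adj fb).
  have cyc : pth b o (B ++ [:: u] ++ [:: e] ++ [:: v] ++ rev A ++ [:: o]) by pths.
  have E : perm_eq (B ++ [:: u] ++ [:: e] ++ [:: v] ++ rev A ++ [:: o])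
      (o :: e :: u :: v :: A ++ B) by perms.
  have oe : o != e by apply: contraNneq oD => ->.
  have uE : uniq [:: o, e, u, v & A ++ B].
    apply/andP; split; first by rewrite inE negb_or oe.
    by apply/andP; split=> //; exact: config_uniq cf.
  have := config_longest cf cyc; rewrite (perm_uniq E) uE adjC bo (perm_size E) /= size_cat.
  by move=> /(_ isT isT isT); slia.
have [A' EA] : exists A', A = a :: A' by case: Ap => A' [-> _ _]; exists A'.
(* [s] is the cycle with [a] exchanged for [e]. It closes between [w] and the vertex [y] after [a],
   which is [v] if [A] is just [a]. *)
have [s [y [sp yw Es]]] : exists s y, [/\ pth w y s, adj y w &
    perm_eq (a :: s) (e :: u :: v :: A ++ B)].
  case: A' EA => [|a2 A'] EA.
    exists (rev B ++ [:: u] ++ [:: e] ++ [:: v]), v; split; [by pths|by rewrite adjC|].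
    by rewrite EA; perms.
  have := Ap; rewrite EA -[[:: a, a2 & A']]/([::] ++ [:: a, a2 & A']) => /pth_split2[_ aa2 p2].
  exists (rev B ++ [:: u] ++ [:: e] ++ [:: v] ++ rev (a2 :: A')), a2; split; first by pths.
    have fa2 : far D a2 by apply: fA; rewrite EA !inE eqxx orbT.
    rewrite adjC; apply: (sibling tf noS ue ee2 ua uw aa2);
      by [exact: far_adj fa2 eD|exact: far_adj fa2 e2D|exact: far_adj fa e2D|exact: far_adj fw e2D].
  by perms.
have uas : uniq (a :: s).
  by rewrite (perm_uniq Es) cons_uniq eC (config_uniq cf).
have ss : size s = size [:: u, v & A ++ B] by have /= := perm_size Es; slia.
have A0 := pth_size Ap.
have cyc_s : is_cycle s.
  apply: (pth_cycle sp _ yw); first by case/andP: uas.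
  by rewrite ss /= size_cat; slia.
have := mn s cyc_s ss; rewrite leqNgt => /negP; apply.
have mem x : (x \in a :: s) = (x \in [:: e, u, v & A ++ B]) := perm_mem Es x.
have es : e \in s.
  have := mem e; rewrite !inE eqxx /= => /orP[/eqP ea|//].
  by have := far_neq fa eD; rewrite ea eqxx.
have na x : x \notin s -> x != a -> x \notin [:: u, v & A ++ B].
  move=> xs xa; apply: contra xs => xC.
  have : x \in a :: s by rewrite mem in_cons xC orbT.
  by rewrite in_cons (negbTE xa).
have step x x' : adj x x' -> x \notin s -> x' != a.
  move=> xx' xs; apply/eqP => E; rewrite E adjC in xx'.
  have xa : x != a by apply: contraTneq xx' => ->; rewrite adj_irrefl.
  have [xD|xD] := boolP (x \in D); first by rewrite (negbTE (far_adj fa xD)) in xx'.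
  by rewrite (negbTE (noO x (na x xs xa) xD)) in xx'.
(* An edge off [s] avoids [a], so it was off the old cycle; the edge [e e2] was off the old cycle
   and no longer is. *)
apply: proper_card; apply/properP; split.
  apply/subsetP => -[x x']; rewrite !inE /= => /and3P[xx' xs xs'].
  have x'a := step x x' xx' xs.
  have xa : x != a by apply: (step x' x) => //; rewrite adjC.
  by rewrite xx' !(na _ _ _).
have e2C := config_disj cf e2D.
exists (e, e2); rewrite inE [_.1]/= [_.2]/=; first by rewrite ee2 eC e2C.
by rewrite es andbF.
Qed.
End CommonNeighbour.

(** * Levels around an attachment *)

Section Levels.
Variable G : sgraph.
Implicit Types (x y t u v e : G) (c s A B P W : seq G) (D : {set G}).
Hypothesis tf : forall x y t : G, adj x y -> adj y t -> ~~ adj x t.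
Hypothesis noS : ~ contains_induced G claw_star_star.

Section Reach.
Variables (D : {set G}) (u z1 z2 : G).
Hypotheses (z1D : z1 \in D) (z2D : z2 \in D)
  (uz1 : adj u z1) (z12 : adj z1 z2).

Fixpoint reach n : {set G} := if n is n'.+1 then
  reach n' :|: [set y | far D y && [exists x in reach n', adj x y]] else [set u].

Definition at_level n x := (x \in reach n) && ((n == 0) || (x \notin reach n.-1)).

Lemma reach_mono m n : m <= n -> reach m \subset reach n.
Proof.
elim: n => [|n IH]; first by rewrite leqn0 => /eqP ->.
rewrite leq_eqVlt => /orP[/eqP -> //|/IH s]; apply: subset_trans s _.
exact: subsetUl.
Qed.

Lemma reach_step n x y : x \in reach n -> adj x y -> far D y -> y \in reach n.+1.
Proof.
by move=> xn xy fy; rewrite /= !inE fy; apply/orP; right; apply/exists_inP; exists x.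
Qed.

Lemma reach_level n x : x \in reach n -> exists2 k, k <= n & at_level k x.
Proof.
elim: n => [|n IH] xn; first by exists 0; rewrite // /at_level xn.
have [/IH[k kn kx]|nx] := boolP (x \in reach n); first by exists k => //; apply: ltnW.
by exists n.+1; rewrite // /at_level xn nx.
Qed.

Lemma at_level_uniq m n x : at_level m x -> at_level n x -> m = n.
Proof.
wlog mn : m n / m < n => [W mx nx|].
  case: (ltngtP m n) => // lt; [exact: W|symmetry; exact: W].
case/andP=> mx _ /andP[_]; case: n mn => //= n; rewrite ltnS => mn.
by rewrite (subsetP (reach_mono mn) _ mx).
Qed.

Lemma at_level0 x : at_level 0 x -> x = u.
Proof. by case/andP=> /set1P. Qed.

Lemma at_levelS n x : at_level n.+1 x ->
  far D x /\ exists2 y, at_level n y & adj y x.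
Proof.
case/andP=> /=; rewrite !inE => /orP[->//|/andP[fx /exists_inP[y yn yx]]] nx.
split=> //; exists y => //; rewrite /at_level yn /=.
case: n yn nx => //= n yn nx; apply: contra nx => yn'.
exact: (@reach_step n y x yn' yx fx).
Qed.

Lemma level_sep m n x y : at_level m x -> at_level n y -> m.+1 < n -> ~~ adj x y.
Proof.
move=> /andP[mx _] ny mn; apply/negP => xy; case: n ny mn => // n ny mn.
have [fy _] := at_levelS ny; case/andP: ny => _ /negP[].
by apply: (subsetP (reach_mono (_ : m.+1 <= n)) _ (reach_step mx xy fy)).
Qed.

(* q and q' continue a spider centred at level n backwards; for n = 0, 1 they
   lie on the path u, z1, z2 into D. *)
Definition behind n q q' := [/\ adj q q', forall p, at_level n p -> adj p q,
  forall k x, n < k -> at_level k x -> ~~ adj x q' &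
  forall k x, n.+1 < k -> at_level k x -> ~~ adj x q].

Lemma level_behind n x : at_level n x ->
  (forall k x y, k < n -> at_level k x -> at_level k.+1 y -> adj x y) ->
  exists q q', behind n q q'.
Proof.
move=> nx full; have farS k y e : 0 < k -> at_level k y -> e \in D -> ~~ adj y e.
  by case: k => // k _ /at_levelS[fy _] eD; apply: far_adj fy eD.
case: n nx full => [|[|n]] nx full.
- exists z1, z2; split=> // [p /at_level0 -> //|k y k0 ky|k y k1 ky]; apply: farS ky _ => //.
  exact: ltn_trans k1.
- have u0 : at_level 0 u by rewrite /at_level /= inE eqxx.
  exists u, z1; split=> // [p p1|k y k1 ky|k y k2 ky].
  + by rewrite adjC; apply: full u0 p1.
  + by apply: farS ky _; rewrite // (ltn_trans _ k1).
  + by rewrite adjC; apply: (level_sep u0 ky (ltnW k2)).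
have [_ [q qn qx]] := at_levelS nx; have [_ [q' q'n q'q]] := at_levelS qn.
exists q, q'; split.
- by rewrite adjC.
- by move=> p pn; rewrite adjC; apply: full qn pn.
- by move=> k y kn ky; rewrite adjC; apply: (level_sep q'n ky (ltnW kn)).
- by move=> k y kn ky; rewrite adjC; apply: (level_sep qn ky (ltnW kn)).
Qed.

(** Strong induction. For a parent [p] of [x], the lower levels supply two vertices behind [p] and
    the edge from [p] to the parent [x0] of [y]; then [sibling] passes the neighbour [y] from [x0]
    to [x]. *)
Lemma level_full n x y : at_level n x -> at_level n.+1 y -> adj x y.
Proof.
elim/ltn_ind: n x y => -[|n] IH x y nx ny.
  by have [_ [x0 /at_level0 -> ]] := at_levelS ny; rewrite (at_level0 nx).
have [fy [x0 x0n x0y]] := at_levelS ny; have [_ [p pn px]] := at_levelS nx.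
have [|q [q' [qq pq nq' nq]]] := level_behind pn.
  by move=> k s t kn; apply: IH; apply: ltn_trans kn _.
have px0 : adj p x0 by apply: (IH n) pn x0n.
apply: (sibling tf noS (pq _ pn) qq px0 px x0y).
- by apply: nq ny.
- by apply: nq' ny; apply: ltnW.
- exact: nq' x0n.
- exact: nq' nx.
Qed.

Lemma level_indep n x y : at_level n x -> at_level n y -> ~~ adj x y.
Proof.
case: n => [/at_level0 -> /at_level0 ->|n nx ny]; first by rewrite adj_irrefl.
have [_ [p pn px]] := at_levelS nx; have py := level_full pn ny.
by apply: tf py; rewrite adjC.
Qed.

(** On the set [R] reached within [N] steps, adjacency becomes arithmetic of levels; [N] only has to
    bound the paths considered later. *)
Lemma levels N : exists lev : G -> nat, exists R : pred G,
  [/\ R u /\ lev u = 0, forall x, R x -> lev x = 0 -> x = u,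
    forall s, path adj u s -> all (far D) s -> size s <= N -> all R s &
    forall x y, R x -> R y -> adj x y = consecutive (lev x) (lev y)].
Proof.
pose lev x := find (fun n => x \in reach n) (iota 0 N.+1).
have levP x : x \in reach N -> at_level (lev x) x.
  move=> xN; have [k kN kx] := reach_level xN; suff -> : lev x = k by [].
  have hs : has (fun n => x \in reach n) (iota 0 N.+1).
    by apply/hasP; exists N => //; rewrite mem_iota add0n leq0n ltnSn.
  have lN : lev x < N.+1 by rewrite -[X in _ < X](size_iota 0) -has_find.
  have lx : x \in reach (lev x) by have := nth_find 0 hs; rewrite nth_iota.
  apply: at_level_uniq (_ : at_level _ x) kx; rewrite /at_level lx /=.
  case E : (lev x) => [//|m] /=.
  have := @before_find _ 0 (fun n => x \in reach n) (iota 0 N.+1) m.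
  by rewrite -/(lev x) E => /(_ (ltnSn m)); rewrite nth_iota ?add0n => [->//|]; slia.
have u0 : at_level 0 u by rewrite /at_level /= inE eqxx.
have uN : u \in reach N by apply: (subsetP (reach_mono (leq0n N))); rewrite inE.
exists lev, [pred x | x \in reach N]; split.
- by split=> //; apply: at_level_uniq (levP _ uN) u0.
- by move=> x /levP + x0; rewrite x0 => /at_level0.
- move=> s us fs sN; apply/allP => x /(nthP u)[i is_ <-] /=.
  apply: (subsetP (reach_mono (leq_trans is_ sN))).
  elim: i is_ => [|i IH] is_.
    by case: s us fs {sN} is_ => //= c s /andP[uc _] /andP[fc _] _; apply: (@reach_step 0 u c); rewrite ?inE.
  apply: (@reach_step i.+1 (nth u s i)); first by apply: IH; apply: ltnW.
    by move/(pathP u): us => /(_ i.+1 is_).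
  by apply: (allP fs); apply: mem_nth.
move=> x y /levP xl /levP yl.
wlog le : x y xl yl / lev x <= lev y.
  by move=> W; case: (leqP (lev x) (lev y)) => [|/ltnW] le; [|rewrite adjC consecutive_sym]; apply: W.
have [lt|ge] := ltnP (lev x).+1 (lev y).
  by rewrite (negbTE (level_sep xl yl lt)) /consecutive; slia.
have [E|ne] := eqVneq (lev x) (lev y).
  rewrite E in xl; rewrite (negbTE (level_indep xl yl)) E /consecutive; slia.
have E : lev y = (lev x).+1 by slia.
by rewrite E in yl *; rewrite (level_full xl yl) /consecutive eqxx.
Qed.
End Reach.
End Levels.

(** * Absorbing one side into the other *)

Section Insertion.
Variable G : sgraph.
Implicit Types (x y t u v e g c : G) (s A B P W : seq G) (D : {set G}).
Variables (lev : G -> nat) (R : pred G).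
Hypothesis levE : forall x y, R x -> R y -> adj x y = consecutive (lev x) (lev y).

Lemma level_cross g s h : path adj g s -> all R (g :: s) -> lev g <= h ->
  h < lev (last g s) -> exists s1 x y s2,
  [/\ g :: s = s1 ++ x :: y :: s2, lev x = h & lev y = h.+1].
Proof.
elim: s g => [|t s IH] g /=; first by move=> _ _ *; slia.
case/andP=> gt ts /andP[Rg Rts] gh hl; have /andP[Rt Rs] := Rts.
have [th|th] := leqP (lev t) h.
  have [s1 [x [y [s2 [E xh yh]]]]] := IH t ts Rts th hl.
  by exists (g :: s1), x, y, s2; rewrite E.
exists [::], g, t, s; split=> //.
  by move: gt; rewrite levE // /consecutive => ?; slia.
by move: gt; rewrite levE // /consecutive => ?; slia.
Qed.

(* Two consecutive vertices of W lie on levels h and h + 1, and fit between two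
   consecutive vertices of B on these levels. *)
Lemma insert_pairs b w B W : pth b w B -> all R B -> sorted adj W -> all R W ->
  size W <= 1 \/ all (fun x => lev b <= lev x < lev w) W ->
  exists B' r, [/\ pth b w B', perm_eq (B' ++ r) (B ++ W) & size r <= 1].
Proof.
have [n] := ubnP (size W); elim: n W B => // n IH W B sW Bp RB sortW RW lW.
have [W1|W2] := leqP (size W) 1; first by exists B, W.
case: lW => [|lW]; first by slia.
case: W sW sortW RW lW W2 => [//|x [//|y W]] sW /= /andP[xy yW] /and3P[Rx Ry RW]
  /and3P[/andP[bx xw] /andP[by_ yw] lW] _.
have [B1 [Bp1 E1]] : exists B1, pth b w B1 /\ perm_eq B1 (x :: y :: B).
  have [s [EB bs lw]] := Bp.
  have lxy := xy; rewrite levE // /consecutive in lxy.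
  have [h [hb hw lev_h]] : exists h, [/\ lev b <= h, h < lev w &
      lev x = h /\ lev y = h.+1 \/ lev x = h.+1 /\ lev y = h].
    by case/orP: lxy => /eqP E; [exists (lev x)|exists (lev y)]; split=> //;
      [left|right]; split; rewrite // -E.
  rewrite EB in RB; rewrite -lw in hw.
  have [s1 [g [g' [s2 [Es gh g'h]]]]] := level_cross bs RB hb hw.
  have [Rg Rg'] : R g /\ R g'.
    by move: RB; rewrite Es all_cat /= => /and4P[].
  have := Bp; rewrite EB Es => /pth_split2[p1 gg' p2].
  (* Of [x] and [y], the one on level [h + 1] goes right after [g] and the one on level [h] right
     before [g']. *)
  case: lev_h => -[lx ly].
    exists (rcons s1 g ++ [:: y] ++ [:: x] ++ (g' :: s2)); split; last by perms.
    apply: pth_cat p1 _ (pth_cat (pth1 y) _ (pth_cat (pth1 x) _ p2)).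
    - by rewrite levE // gh ly /consecutive eqxx.
    - by rewrite adjC.
    - by rewrite levE // lx g'h /consecutive eqxx.
  exists (rcons s1 g ++ [:: x] ++ [:: y] ++ (g' :: s2)); split; last by perms.
  apply: pth_cat p1 _ (pth_cat (pth1 x) xy (pth_cat (pth1 y) _ p2)).
  - by rewrite levE // gh lx /consecutive eqxx.
  - by rewrite levE // ly g'h /consecutive eqxx.
have [|||B' [r [B'p E' r1]]] := IH W B1 _ Bp1 _ _ RW (or_intror lW).
- by move: sW => /=; slia.
- by rewrite (perm_all _ E1) /= Rx Ry RB.
- exact: path_sorted yW.
exists B', r; split=> //; apply: perm_trans E' _; perms.
Qed.
End Insertion.

Section SpiderCore.
Variable G : sgraph.
Implicit Types (x y t u v e g c : G) (s A B P W : seq G) (D : {set G}).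
Variables (lev : G -> nat) (R : pred G) (D : {set G}) (u : G) (N : nat).
Hypothesis levE : forall x y, R x -> R y -> adj x y = consecutive (lev x) (lev y).
Hypothesis lev0 : forall x, R x -> lev x = 0 -> x = u.
Hypothesis levu : R u /\ lev u = 0.
Hypothesis levR : forall s, path adj u s -> all (far D) s -> size s <= N -> all R s.

(** With [x] the first neighbour of [w] in [A1] and [W] the part before it, the new cycle takes [P],
    then [A] backwards to [x], jumps to [w], and returns along [B] with [W] absorbed in pairs. At
    most one vertex is lost and [P] has two. *)
Lemma level_core v A1 A2 B P d d' : config D u v (A1 ++ A2) B -> link D u v P d d' ->
  1 < size P -> 1 < size A1 -> all (far D) A1 -> all (far D) B ->
  size A1 <= N -> size B <= N -> lev (last u B) <= (lev (last u A1)).+1 -> False.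
Proof.
move=> cf lk P1 A11 fA fB sA sB le; have [Ru lu] := levu.
have [a [z eA]] := config_endsA cf lk; have [b [w eB]] := config_endsB cf lk.
have uA1 : path adj u A1.
  by have := config_pathA cf; rewrite rcons_cat cat_path => /andP[].
have RA := levR uA1 fA sA.
have uBp : path adj u B by have := config_pathB cf; rewrite rcons_path => /andP[].
have RB := levR uBp fB sB.
case: (eA) (eB) (lk) => Ap ua zv [Bp ub wv] [Pp ud dv Pu PD].
have lB : last u B = w by case: Bp => p [-> _ <-].
have Rb : R b := allP RB _ (pth_head Bp).
have Rw : R w := allP RB _ (pth_last Bp).
have Aneu x : x \in A1 -> x != u.
  by move=> xA; have := config_neqA cf (_ : x \in A1 ++ A2); rewrite mem_cat xA => /(_ isT)/andP[].
have Bneu x : x \in B -> x != u by move=> xB; have /andP[] := config_neqA (config_swap cf) xB.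
have lb : lev b = 1 by have := ub; rewrite levE // lu /consecutive; slia.
have w0 : 0 < lev w.
  rewrite lt0n; apply/eqP => /(lev0 Rw) wu.
  by have := Bneu _ (pth_last Bp); rewrite wu eqxx.
rewrite lB in le.
(* The level condition makes [A1] climb to level [lev w - 1], which sees [w]. If [lev w] is 1, the
   second vertex of [A1], on level 2, takes this part. *)
have hw : has (adj w) A1.
  have [w1|w2] := leqP (lev w) 1.
    case: A1 A11 uA1 RA Aneu {cf eA fA sA le Ap} => [//|a1 [//|a2 A1]] _ /= /and3P[ua1 a12 _]
      /and3P[Ra1 Ra2 _] Aneu.
    have a2u : a2 != u by apply: Aneu; rewrite !inE eqxx orbT.
    have l1 : lev a1 = 1 by have := ua1; rewrite levE // lu /consecutive; slia.
    have l2 : lev a2 != 0 by apply: contra a2u => /eqP /(lev0 Ra2) ->.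
    have l3 : lev a2 = 2 by have := a12; rewrite levE // l1 /consecutive; slia.
    have lw : lev w = 1 by slia.
    by rewrite (levE Rw Ra2) lw l3 orbT.
  have RuA : all R (u :: A1) by rewrite /= Ru.
  have [||s1 [x [y [s2 [Es xh yh]]]]] := level_cross (h := (lev w).-2) levE uA1 RuA.
  - by rewrite lu.
  - by slia.
  have yA : y \in A1.
    case: s1 Es => [[_ ->]|c s1 [_ ->]]; first by rewrite inE eqxx.
    by rewrite mem_cat !inE eqxx !orbT.
  by apply/hasP; exists y => //; rewrite (levE Rw (allP RA _ yA)) yh /consecutive; slia.
have [W [x [A3 [EA wx nW]]]] := first_split hw.
have RW : all R W by apply/allP => c cW; apply: (allP RA); rewrite EA mem_cat cW.
have uW : path adj u W by have := uA1; rewrite EA cat_path => /andP[].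
(* Vertices of [W] avoid the levels next to [lev w], and levels change by one along [W], so [W]
   stays below [lev w - 1]. If [lev w] is 1, a second vertex of [W] would be on level 2. *)
have Wlev : size W <= 1 \/ all (fun x => lev b <= lev x < lev w) W.
  have nl c : c \in W -> [/\ 0 < lev c, lev c != (lev w).-1 & lev c != (lev w).+1].
    move=> cW; have Rc : R c by exact: (allP RW).
    have cu : c != u by apply: Aneu; rewrite EA mem_cat cW.
    have c0 : lev c != 0 by apply: contra cu => /eqP /(lev0 Rc) ->.
    have /allP/(_ _ cW) := nW; rewrite /= levE // /consecutive => nc.
    by split; move: c0 nc; slia.
  have [w1|w2] := leqP (lev w) 1.
    left; have lw : lev w = 1 by slia.
    case: W nl RW uW {EA nW} => [//|c1 [//|c2 W]] nl /and3P[Rc1 Rc2 _] /= /and3P[uc1 c12 _].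
    have l1 : lev c1 = 1 by have := uc1; rewrite levE // lu /consecutive; slia.
    have [|k0 k1 k2] := nl c2; first by rewrite !inE eqxx orbT.
    by rewrite lw in k1 k2; have := c12; rewrite levE // l1 /consecutive; slia.
  right; rewrite lb.
  suff H g s : path adj g s -> R g -> all R s -> lev g < (lev w).-1 ->
      (forall c, c \in s -> [/\ 0 < lev c, lev c != (lev w).-1 & lev c != (lev w).+1]) ->
      all (fun x => 0 < lev x < lev w) s.
    by apply: H uW Ru RW _ nl; rewrite lu; slia.
  elim: s g => //= c s IH g /andP[gc cs] Rg /andP[Rc Rs] lg ns.
  have [|c0 n1 n2] := ns c; first by rewrite inE eqxx.
  have lc : lev c < (lev w).-1.
    by have := gc; rewrite levE // /consecutive; slia.
  rewrite c0 (leq_trans lc (leq_pred _)) /=; apply: (IH c) => // c' c's.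
  by apply: ns; rewrite inE c's orbT.
have sortW : sorted adj W := path_sorted uW.
have [B' [r [B'p EB' r1]]] := insert_pairs levE Bp RB sortW RW Wlev.
have cf' := cf; rewrite EA -catA in cf'.
have := Ap; rewrite EA -catA => /pth_split[_ px].
have r2 : size r < size P by exact: leq_ltn_trans r1 P1.
cyc cf' Pu PD ([:: u] ++ P ++ [:: v] ++ rev (x :: A3 ++ A2) ++ rev B') r.
Qed.
End SpiderCore.

Section SpiderMain.
Variable G : sgraph.
Implicit Types (x y t u v e g c : G) (s A B P W : seq G) (D : {set G}).

(** By [no_common_half] at both ends, the spider with centre [e] and legs [u], [b] and [v], [w] can
    fail only through the edge [b w]. Then [sibling] gives the edge [a w], against
    [cross_first_last]. *)
Lemma no_common D u v A B e :
  (forall x y t : G, adj x y -> adj y t -> ~~ adj x t) ->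
  ~ contains_induced G claw_star_star ->
  config D u v A B -> off_minimal (u :: v :: A ++ B) -> all (far D) A -> e \in D ->
  (exists2 e2, e2 \in D & adj e e2) -> adj u e -> ~~ adj v e.
Proof.
move=> tf noS cf mn fA eD e2P ue; apply/negP => ve; have [e2 e2D ee2] := e2P.
have [eu ev] : adj e u /\ adj e v by rewrite !(adjC e).
have lk : link D u v [:: e] e e.
  by split=> //; [exact: pth1|move=> x; rewrite inE => /eqP ->].
have [a [z eA]] := config_endsA cf lk; have [b [w eB]] := config_endsB cf lk.
have nwu := no_common_half tf noS cf mn fA eD ue ve eA eB e2P.
have E : perm_eq (u :: v :: A ++ B) (v :: u :: rev A ++ rev B) by perms.
have fA' : all (far D) (rev A) by rewrite all_rev.
have nbv := no_common_half tf noS (config_flip cf) (off_minimal_perm E mn) fA' eD ve ue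
  (ends_rev eA) (ends_rev eB) e2P.
have fa := first_far cf lk eA; have fz := last_far cf lk eA.
have fb := first_far (config_swap cf) lk eB; have fw := last_far (config_swap cf) lk eB.
have naw := cross_first_last cf lk eA eB.
have nbz := cross_first_last (config_swap cf) lk eB eA.
case: (eA) (eB) => _ ua zv [_ ub wv].
have [vz vw] : adj v z /\ adj v w by rewrite !(adjC v).
have nuw : ~~ adj u w by rewrite adjC.
have n x : far D x -> adj e2 x = false by move=> fx; apply/negbTE/(far_adjC fx e2D).
have bw : adj b w.
  have := spider tf noS ee2 eu ev ub vw.
  by rewrite !n // (negbTE nuw) (negbTE nbv).
have : adj a w.
  apply: (sibling tf noS ue ee2 ub ua bw);
    by [exact: far_adj fw eD|exact: far_adj fw e2D|exact: far_adj fb e2D|exact: far_adj fa e2D].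
by rewrite (negbTE naw).
Qed.

(** Moves [v] to the first attachment met on [B] and gives the remainder of [B] to the other
    side. *)
Lemma config_first_att D u v A B : config D u v A B -> att D v ->
  exists v1 A1 B1, [/\ config D u v1 A1 B1, all (far D) B1, att D v1 &
    perm_eq (u :: v :: A ++ B) (u :: v1 :: A1 ++ B1)].
Proof.
move=> cf av; have [fB|nB] := boolP (all (far D) B); first by exists v, A, B.
have hB : has (att D) B.
  have /allPn[x xB nx] := nB; apply/hasP; exists x => //.
  by move: nx; rewrite /far (config_inA (config_swap cf) xB) /= negbK.
have [B1 [v1 [B2 [EB av1 nB1]]]] := first_split hB; rewrite EB in cf.
have E : perm_eq (u :: v1 :: (A ++ v :: rev B2) ++ B1) (u :: v :: A ++ B1 ++ v1 :: B2) by perms.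
exists v1, (A ++ v :: rev B2), B1; split=> //; last by rewrite EB perm_sym.
  have := config_pathB cf; rewrite rcons_cat cat_path /= => /and3P[uB1 B1v1 v1B2].
  apply: (config_perm cf E); last by rewrite rcons_path uB1.
  rewrite rcons_cat cat_path /=; have := config_pathA cf.
  by rewrite rcons_path => /andP[-> ->]; apply: path_rcons_rev.
apply/allP => x xB1; rewrite /far (config_inA (config_swap cf)) ?mem_cat ?xB1 //=.
by have /allP/(_ _ xB1) := nB1.
Qed.

(** [v1] and [v2] are the attachments next to [u] on the two sides; without a [v2], both sides end
    at [v1]. In one of the two orders of the sides, the level condition of [level_core] holds. *)
Lemma config_spider D u v A B P d d' : paw_free G ->
  (forall x y, connect (@adj G) x y) -> ~ contains_induced G claw_star_star ->
  config D u v A B -> link D u v P d d' -> 1 < size P ->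
  off_minimal (u :: v :: A ++ B) -> False.
Proof.
move=> paw conn noS cf0 lk0 P1 mn0; have tf := triangle_free paw conn cf0 lk0 P1.
have nbr e : e \in D -> exists2 e2, e2 \in D & adj e e2 := D_nbr cf0 lk0 P1.
have [ud dD] : adj u d /\ d \in D.
  by case: lk0 => Pp ud _ _ PD; split=> //; apply: PD (pth_head Pp).
have av0 : att D v.
  by case: lk0 => Pp _ dv _ PD; apply/attP; exists d'; rewrite 1?adjC // PD ?(pth_last Pp).
have [v1 [A0 [B1 [cf fB av E]]]] := config_first_att cf0 av0.
have mn := off_minimal_perm E mn0.
(* As [d] is not a common neighbour of [u] and [v2], a link from [d] to a neighbour of [v2] has two
   vertices. *)
have good v2 A2 B2 : config D u v2 A2 B2 -> off_minimal (u :: v2 :: A2 ++ B2) ->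
    all (far D) A2 -> att D v2 ->
    exists Q e, link D u v2 Q d e /\ 1 < size Q.
  move=> cf2 mn2 fA2 /attP[e eD ve].
  have de : d != e.
    by apply: contraTneq ve => <-; apply: (no_common tf noS cf2 mn2 fA2 dD (nbr _ dD) ud).
  have [Q lQ Q1] := link_far dD eD ud ve de (config_conn cf2).
  by exists Q, e.
have swapE v2 A2 B2 : perm_eq (u :: v2 :: A2 ++ B2) (u :: v2 :: B2 ++ A2).
  by rewrite !perm_cons perm_catC.
have [Q [e [lQ Q1]]] := good _ _ _ (config_swap cf) (off_minimal_perm (swapE _ _ _) mn) fB av.
have sA := leq_trans Q1 (config_size cf lQ).
have sB := leq_trans Q1 (config_size (config_swap cf) lQ).
have [z2 z2D dz2] := nbr d dD.
have [lev [R [[Ru lu] l0 lR lE]]] := levels tf noS dD z2D ud dz2 (size A0 + size B1).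
have core := level_core lE l0 (conj Ru lu) lR.
have sBN : size B1 <= size A0 + size B1 by apply: leq_addl.
have [fA|nA] := boolP (all (far D) A0).
  have sAN : size A0 <= size A0 + size B1 by apply: leq_addr.
  have cfc : config D u v1 (A0 ++ [::]) B1 by rewrite cats0.
  have scfc : config D u v1 (B1 ++ [::]) A0 by rewrite cats0; exact: config_swap.
  have [le|le] := leqP (lev (last u B1)) (lev (last u A0)).+1.
    exact: (core _ _ _ _ _ _ _ cfc lQ Q1 sA fA fB sAN sBN le).
  by apply: (core _ _ _ _ _ _ _ scfc lQ Q1 sB fB fA sBN sAN); slia.
have hA : has (att D) A0.
  have /allPn[x xA nx] := nA; apply/hasP; exists x => //.
  by move: nx; rewrite /far (config_inA cf xA) /= negbK.
have [A1 [v2 [A2 [EA av2 nA1]]]] := first_split hA.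
have fA1 : all (far D) A1.
  apply/allP => x xA1; rewrite /far (config_inA cf) ?EA ?mem_cat ?xA1 //=.
  by have /allP/(_ _ xA1) := nA1.
rewrite EA in cf mn sBN core.
have E2 : perm_eq (u :: v2 :: A1 ++ (B1 ++ v1 :: rev A2)) (u :: v1 :: (A1 ++ v2 :: A2) ++ B1).
  by perms.
have cf2 : config D u v2 A1 (B1 ++ v1 :: rev A2).
  apply: (config_perm cf E2).
    have := config_pathA cf; rewrite rcons_cat cat_path /= => /and3P[uA1 Av2 _].
    by rewrite rcons_path uA1.
  have := config_pathB cf; rewrite rcons_path => /andP[uB Bv].
  rewrite rcons_cat cat_path /= uB Bv /=; apply: path_rcons_rev.
  by have := config_pathA cf; rewrite rcons_cat cat_path /= => /and3P[].
rewrite perm_sym in E2.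
have [Q2 [e2 [lQ2 Q21]]] := good _ _ _ cf2 (off_minimal_perm E2 mn) fA1 av2.
have sA1 := leq_trans Q21 (config_size cf2 lQ2).
have sA1N : size A1 <= size (A1 ++ v2 :: A2) + size B1 by rewrite size_cat; slia.
have [le|le] := leqP (lev (last u B1)) (lev (last u A1)).+1.
  exact: (core _ _ _ _ _ _ _ cf lQ Q1 sA1 fA1 fB sA1N sBN le).
by apply: (core _ _ _ _ _ _ _ (config_swap cf2) lQ2 Q21 sB fB fA1 sBN sA1N); slia.
Qed.
End SpiderMain.

Lemma claw_freeP G : ~ contains_induced G claw -> claw_free G.
Proof.
move=> nc c x y z cx cy cz xy xz un; apply/negPn/negP => yz; apply: nc.
exact: (contains_claw cx cy cz un).
Qed.

Lemma paw_freeP G : ~ contains_induced G (Z_graph 1) -> paw_free G.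
Proof.
move=> nc a b c p ab ac bc cp; apply/negPn/negP; rewrite negb_or => /andP[ap bp].
by apply: nc; exact: (contains_Z1 ab ac bc cp).
Qed.

Theorem theorem2 (F : seq sgraph)
  (F_connected : forall H : sgraph, List.In H F -> connected H)
  (F_in : List.In F
     [:: [:: claw; Z_graph 4];
         [:: claw; B_graph 1 2];
         [:: claw; N_graph 1 1 1];
         [:: path_graph 4; W_graph];
         [:: claw_star_star; Z_graph 1]])
  (G : sgraph) (G_2connected : k_connected 2 G) (G_free : free F G) :
  has_dominating_cycle G.
Proof.
apply: Classical_Prop.NNPP => nd.
have [D [u [v [A [B [P [d [d' [cf lk P1 off_min]]]]]]]]] := config_exists G_2connected nd.
have [u' [v' [A' [B' [P' [e [e' mc]]]]]]] := min_config_exists cf lk P1.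
have G_free2 H K : F = [:: H; K] -> ~ contains_induced G H /\ ~ contains_induced G K.
  by move=> EF; split; apply: G_free; rewrite EF /=; [left|right; left].
case: F_in => [|[|[|[|[|//]]]]] /esym/G_free2[noH noK].
- exact/noK/(min_config_Z4 (claw_freeP noH) mc).
- exact/noK/(config_B12 (claw_freeP noH) cf lk).
- exact/noK/(config_N111 (claw_freeP noH) cf lk).
- by case: (min_config_P4_W mc).
- apply: (config_spider (paw_freeP noK) (connected_G G_2connected) noH cf lk P1).
  by move=> c cyc_c sc; apply: off_min cyc_c _; rewrite sc /= size_cat.
Qed.
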